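(* Let $H\in(0,\frac12)$ and consider the hyperbolic Anderson model $$\frac{\partial^2v}{\partial t^2}(t,x)=\frac{\partial^2v}{\partial x^2}(t,x)+v(t,x)\dot W(t,x),\quad t\in[0,T],\ x\in\mathbb R,\qquad v(0,x)=u_0(x),\ \ \frac{\partial v}{\partial t}(0,x)=v_0(x),$$ with initial data $u_0$, $v_0$. If this equation has a solution in $\mathcal Z^p(T)$ for some $p\ge2$ and for some $T>0$, then the Hurst parameter $H$ must satisfy $H>\frac14$.
   Context: Noise. On a complete probability space $(\Omega,\mathcal F,\mathbb P)$, $W=\{W(t,x):t\ge0,x\in\mathbb R\}$ is a centered Gaussian field with $\mathbb E[W(t,x)W(s,y)]=\frac12(s\wedge t)\left(|x|^{2H}+|y|^{2H}-|x-y|^{2H}\right)$ ($H$ is the Hurst parameter), $\dot W=\frac{\partial^2}{\partial t\partial x}W$, and $\mathcal F_t=\sigma(W(s,x):s\in[0,t],x\in\mathbb R)$. Stochastic integral. $\mathfrak H$ is the Hilbert space obtained by completing the smooth compactly supported functions on $\mathbb R_+\times\mathbb R$ under $\langle f,g\rangle_{\mathfrak H}=c_H^2\int_{\mathbb R_+\times\mathbb R^2}[f(t,x+y)-f(t,x)][g(t,x+y)-g(t,x)]|y|^{2H-2}\,dx\,dy\,dt$, where $c_H>0$ is the constant depending only on $H$ for which the isometry below holds. A random field $f$ is adapted if $f(t,x)$ is $\mathcal F_t$-measurable for all $(t,x)$. An elementary process is $g(t,x)=\sum_{i=1}^n\sum_{j=1}^mX_{i,j}\mathbf 1_{(a_i,b_i]}(t)\mathbf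 1_{(c_j,d_j]}(x)$ with $0\le a_1<b_1<\dots<a_n<b_n<\infty$, $c_j<d_j$, $X_{i,j}$ being $\mathcal F_{a_i}$-measurable; its integral is $\int g\,dW=\sum_{i,j}X_{i,j}[W(b_i,d_j)-W(a_i,d_j)-W(b_i,c_j)+W(a_i,c_j)]$. $\Lambda_H$ is the space of adapted random fields $g$ with $g\in\mathfrak H$ a.s. and $\mathbb E\|g\|_{\mathfrak H}^2<\infty$. Elementary processes are dense in $\Lambda_H$, and for $g\in\Lambda_H$ the integral $\int_{\mathbb R_+\times\mathbb R}g(t,x)W(dt,dx)$ is the $L^2(\Omega)$-limit of integrals of approximating elementary processes, with $\mathbb E[(\int g\,dW)^2]=\mathbb E\|g\|_{\mathfrak H}^2$. Space $\mathcal Z^p(T)$. It consists of all continuous functions $f$ from $[0,T]\times\mathbb R$ to $L^p(\Omega)$ for which $$\|f\|_{\mathcal Z^p(T)}:=\sup_{t\in[0,T]}\|f(t,\cdot)\|_{L^p(\Omega\times\mathbb R)}+\sup_{t\in[0,T]}\left(\int_{\mathbb R}\|f(t,\cdot+h)-f(t,\cdot)\|_{L^p(\Omega\times\mathbb R)}^2|h|^{2H-2}dh\right)^{1/2}<\infty,$$ where $\|g\|_{L^p(\Omega\times\mathbb R)}=\left(\int_{\mathbb R}\mathbb E|g(x)|^p\,dx\right)^{1/p}$. Solution. Let $G_t(x)=\frac12\mathbf 1_{\{|x|<t\}}$ and $I_0(t,x)=\frac12\int_{x-t}^{x+t}v_0(y)\,dy+\frac12[u_0(x+t)+u_0(x-t)]$.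 A real-valued adapted random field $v$ such that for all $t\in[0,T]$, $x\in\mathbb R$, the field $(s,y)\mapsto G_{t-s}(x-y)v(s,y)\mathbf 1_{[0,t]}(s)$ is in $\Lambda_H$ is a (mild) solution if for all $t\in[0,T]$, $x\in\mathbb R$, almost surely $v(t,x)=I_0(t,x)+\int_0^t\int_{\mathbb R}G_{t-s}(x-y)v(s,y)W(ds,dy)$.
   Formalization: The initial data are assumed non-trivial (not both u_0 = 0 everywhere and v_0 = 0 a.e.), since otherwise v = 0 is a solution for every H; v_0 is taken locally integrable so that I_0 is defined, and random fields are jointly measurable. *)

(* Defs.v *)
From HB Require Import structures.
From mathcomp Require Import all_boot all_order all_algebra.
From mathcomp Require Import all_classical all_reals all_analysis.

Set Implicit Arguments.
Unset Strict Implicit.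
Unset Printing Implicit Defensive.
Import Order.TTheory GRing.Theory Num.Theory.
Import numFieldNormedType.Exports.
Local Open Scope classical_set_scope.
Local Open Scope ring_scope.

(* Space-time functions are total functions of [(t, x)]; random fields are total
   functions [f t x w]. Only times [t >= 0] (or [t] in [[0, T]]) ever matter. *)

Section deterministic.
Context {R : realType}.
Local Notation mu := (@lebesgue_measure R).

Definition smooth (f : R * R -> R) : Prop :=
  forall s : seq (R * R), let g := foldr (fun e h => 'D_e h) f s in
    continuous g /\ (forall z e, derivable g z e).

(* Smooth functions with compact support in [R_+ x R] are taken as restrictions
   to [R_+ x R] of smooth compactly supported functions on the plane. *)
Definition test_function (f : R * R -> R) : Prop :=
  smooth f /\ compact (closure [set z | f z != 0]).

(* The constant for which the isometry holds: for [h] the indicator function of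
   an interval of length [l],
     \int\int (h (x + y) - h x)^2 |y|^(2H-2) dx dy
       = \int 2 min(|y|, l) |y|^(2H-2) dy = l^(2H) / (H (1/2 - H)),
   while the increment of [W] over [(0, 1]] times that interval has variance
   [l^(2H)]. *)
Definition noise_const (H : R) : R := Num.sqrt (H * (2^-1 - H)).

(* Squared norm of the Hilbert space frakH; equal to [+oo] on some functions. *)
Definition hnorm2 (H : R) (f : R -> R -> R) : \bar R :=
  ((noise_const H ^+ 2)%:E *
   \int[mu]_(t in `[0%R, +oo[) \int[mu]_x \int[mu]_y
     ((f t (x + y) - f t x) ^+ 2 * `|y| `^ (2 * H - 2))%:E)%E.

(* [f] belongs to frakH, the completion of the test functions, realized as a
   space of (classes of) functions: an element of the completion is identified
   with the almost everywhere limit of a Cauchy sequence representing it. For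
   [0 < H < 1/2] this is legitimate, and [hnorm2] is then the squared norm of the
   limit: a Cauchy sequence has a subsequence converging a.e. (Sobolev embedding
   of order [1/2 - H] in space), and, by Fatou's lemma, a Cauchy sequence
   tending to 0 a.e. tends to 0 in norm. Merely requiring [hnorm2 H f < +oo]
   would wrongly admit nonzero functions constant in space. *)
Definition in_frakH (H : R) (f : R -> R -> R) : Prop :=
  exists phi : nat -> R * R -> R,
    [/\ forall n, test_function (phi n),
        forall e : R, 0 < e -> exists N : nat, forall m n : nat,
          (N <= m)%N -> (N <= n)%N ->
          (hnorm2 H (fun t x => phi m (t, x) - phi n (t, x))%R < e%:E)%E &
        {ae (mu \x mu)%E, forall z : R * R, 0 <= z.1 ->
          phi n z @[n --> \oo] --> f z.1 z.2}].

Definition wave_kernel (t x : R) : R := if `|x| < t then 2^-1 else 0.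

Definition wave_init (u0 v0 : R -> R) (t x : R) : R :=
  2^-1 * (\int[mu]_(y in `[x - t, x + t]) v0 y) + 2^-1 * (u0 (x + t) + u0 (x - t)).

End deterministic.

Section stochastic.
Context {R : realType} {d : measure_display} {Om : measurableType d}.
Variable P : probability Om R.
Local Notation mu := (@lebesgue_measure R).

(* Gaussian law, possibly degenerate; [normal_prob m 0] is not a Dirac mass. *)
Definition gaussian_law (X : Om -> R) : Prop :=
  (exists m s : R, s != 0 /\
     forall B, measurable B -> P (X @^-1` B) = normal_prob m s B) \/
  (exists m : R, {ae P, forall w, X w = m}).

Definition fractional_noise (H : R) (W : R -> R -> {RV P >-> R}) : Prop :=
  [/\ forall (n : nat) (a t x : 'I_n -> R), (forall i, 0 <= t i) ->
        gaussian_law (fun w => \sum_(i < n) a i * W (t i) (x i) w),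
      forall t x, 0 <= t -> ('E_P[W t x] = 0)%E &
      forall t x s y, 0 <= t -> 0 <= s ->
        ('E_P[fun w => (W t x w * W s y w)%R] =
         (2^-1 * Num.min s t *
           (`|x| `^ (2 * H) + `|y| `^ (2 * H) - `|x - y| `^ (2 * H)))%:E)%E].

Definition noise_filtration (W : R -> R -> {RV P >-> R}) (t : R) : set (set Om) :=
  <<s [set A | exists s x B, [/\ 0 <= s <= t, measurable B & A = W s x @^-1` B]] >>.

Definition measurable_wrt (F : set (set Om)) (X : Om -> R) : Prop :=
  forall B, measurable B -> F (X @^-1` B).

(* Adapted random field indexed by times in [D]. Random fields are jointly
   measurable, so that their trajectories determine them up to null sets. *)
Definition adapted_field (W : R -> R -> {RV P >-> R}) (D : set R)
    (f : R -> R -> Om -> R) : Prop :=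
  measurable_fun (D `*` setT `*` setT) (fun z : R * R * Om => f z.1.1 z.1.2 z.2) /\
  (forall t x, D t -> measurable_wrt (noise_filtration W t) (f t x)).

Definition Lambda (H : R) (W : R -> R -> {RV P >-> R}) (g : R -> R -> Om -> R) : Prop :=
  [/\ adapted_field W `[0, +oo[ g,
      {ae P, forall w, in_frakH H (fun t x => g t x w)} &
      (\int[P]_w hnorm2 H (fun t x => g t x w) < +oo)%E].

Record elementary (W : R -> R -> {RV P >-> R}) := Elementary {
  el_n : nat; el_m : nat;
  el_a : 'I_el_n -> R; el_b : 'I_el_n -> R;
  el_c : 'I_el_m -> R; el_d : 'I_el_m -> R;
  el_X : 'I_el_n -> 'I_el_m -> Om -> R;
  el_a_ge0 : forall i, 0 <= el_a i;
  el_ab : forall i, el_a i < el_b i;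
  el_ba : forall i j : 'I_el_n, (i < j)%N -> el_b i < el_a j;
  el_cd : forall j, el_c j < el_d j;
  el_X_meas : forall i j, measurable_wrt (noise_filtration W (el_a i)) (el_X i j)
}.

Definition elementary_field (W : R -> R -> {RV P >-> R}) (g : elementary W) :
    R -> R -> Om -> R := fun t x w =>
  \sum_(i < el_n g) \sum_(j < el_m g)
    el_X i j w * \1_`]el_a i, el_b i] t * \1_`]el_c j, el_d j] x.

Definition elementary_integral (W : R -> R -> {RV P >-> R}) (g : elementary W) :
    Om -> R := fun w =>
  \sum_(i < el_n g) \sum_(j < el_m g)
    el_X i j w * (W (el_b i) (el_d j) w - W (el_a i) (el_d j) w
                  - W (el_b i) (el_c j) w + W (el_a i) (el_c j) w).

(* [J] is (a version of) the stochastic integral of [g] against [W]. *)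
Definition is_stoch_integral (H : R) (W : R -> R -> {RV P >-> R})
    (g : R -> R -> Om -> R) (J : Om -> R) : Prop :=
  measurable_fun setT J /\
  exists e : nat -> elementary W,
    ((\int[P]_w hnorm2 H (fun t x => elementary_field (e n) t x w - g t x w)%R)%E
       @[n --> \oo] --> 0%E) /\
    ('E_P[fun w => ((elementary_integral (e n) w - J w) ^+ 2)%R]%E
       @[n --> \oo] --> 0%E).

Definition mild_integrand (v : R -> R -> Om -> R) (t x : R) : R -> R -> Om -> R :=
  fun s y w => wave_kernel (t - s) (x - y) * v s y w * \1_`[0, t] s.

Definition mild_solution (H : R) (W : R -> R -> {RV P >-> R}) (u0 v0 : R -> R)
    (T : R) (v : R -> R -> Om -> R) : Prop :=
  adapted_field W `[0, T] v /\
  forall t x, 0 <= t <= T ->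
    Lambda H W (mild_integrand v t x) /\
    exists J, is_stoch_integral H W (mild_integrand v t x) J /\
      {ae P, forall w, v t x w = wave_init u0 v0 t x + J w}.

Definition norm_OmR (p : R) (g : R -> Om -> R) : \bar R :=
  ((\int[mu]_x \int[P]_w (`|g x w| `^ p)%:E) `^ p^-1)%E.

(* [(\int ||g(. + h) - g||_{L^p(Om x R)}^2 |h|^(2H-2) dh)^(1/2)] *)
Definition frac_norm_OmR (H p : R) (g : R -> Om -> R) : \bar R :=
  ((\int[mu]_h (norm_OmR p (fun x w => g (x + h) w - g x w)%R ^+ 2
                * (`|h| `^ (2 * H - 2))%:E)) `^ 2^-1)%E.

Definition Znorm (H p T : R) (f : R -> R -> Om -> R) : \bar R :=
  (ereal_sup [set norm_OmR p (f t) | t in `[0%R, T]] +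
   ereal_sup [set frac_norm_OmR H p (f t) | t in `[0%R, T]])%E.

Definition in_Z (H p T : R) (f : R -> R -> Om -> R) : Prop :=
  [/\ forall t x, 0 <= t <= T -> f t x \in Lfun P p%:E,
      forall t x, 0 <= t <= T ->
        ('N[P]_(p%:E) [ (fun w => (f z.1 z.2 w - f t x w)%:E) ])%E
          @[z --> within [set z : R * R | 0 <= z.1 <= T] (nbhs (t, x))] --> 0%E &
      (Znorm H p T f < +oo)%E].

End stochastic.

(* Main.v *)
Require Import Defs.
From HB Require Import structures.
From mathcomp Require Import all_boot all_order all_algebra.
From mathcomp Require Import all_classical all_reals all_analysis.
From mathcomp Require Import measurable_realfun.
From mathcomp Require Import zify ring lra.
Import Order.TTheory GRing.Theory Num.Theory.
Import numFieldNormedType.Exports.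
Local Open Scope classical_set_scope.
Local Open Scope ring_scope.

Set Implicit Arguments.
Unset Strict Implicit.
Unset Printing Implicit Defensive.

(** The spatial increments of a solution [v] at time [T] are rougher than
membership in the solution space allows when [H <= 1/4].

By the mild formulation, [v T (x + h) - v T x] is a constant plus [J1 - J2],
the difference of two stochastic integrals of mean zero; so its second moment is
at least that of [J1 - J2], which by the isometry is the expected squared norm of
the difference of the two integrands. At each time [s] these integrands are
[v s / 2] on the sections of the backward light cones of [(T, x + h)] and
[(T, x)]. On the strip of width [h] lying in the second cone only, the difference
is [- v s y / 2], and it vanishes to the left of the strip. Jumps from the
strip to points at distance of order [h] to its left contribute at least a
constant times [h * h * h `^ (2 H - 2) = h `^ (2 H)], provided that the second
moment of [v] is bounded below there ([energy_wave_increment],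
[solution_increment_lower_bound]). Since [p >= 2], the squared [L^p] norm of the
increment over an interval of [x] is at least a constant times [h `^ (2 H)] too
([norm_OmR_lower_bound]), and finiteness of its integral against
[h `^ (2 H - 2)] forces [4 H - 2 > -1] ([singular_integral_infty]).

The second moment of [v] is bounded below near some point
([solution_nontrivial], [second_moment_lower_bound]): if [v] vanished almost
surely everywhere, so would the stochastic integrals, hence the deterministic
part of the solution; time [0] then gives [u0 = 0], and the vanishing of the
integrals of [v0] over small intervals gives [v0 = 0] almost everywhere.
Continuity in [L^p] carries the lower bound from one point to a neighbourhood.

The isometry has to be derived from the finite-dimensional laws of the noise.
On simple processes it says that, for [X] bounded and measurable with respect
to the past, an increment [D] of the noise has [E (X D) = 0], and two increments
[D], [D'] over the same time interval have [E (X D D') = E (D D') E X]. For [X] a cosine of a linear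
combination of past values this is a computation in a Gaussian space, based on
Stein's identity and on the fact that equal variances give equal laws
([expectation_cos_product]); bounded functions measurable with respect to the
past are reached from cosines by pointwise limits of bounded functions
([past_multiplier]). On the deterministic side, the fractional norm of a step
function is the covariance form of the noise ([spatial_gram_step_function]).
The second moment of an approximating simple integral is then its expected
squared norm ([simple_isometry]); for the limit it is enough that the expected
squared norm of a difference of integrands is at most four times the second
moment of the difference of their integrals ([energy_le_second_moment]). *)

(** * Integrable real functions *)

Section expectation.
Context {d : measure_display} {T : measurableType d} {R : realType}.
Variable mu : {measure set T -> \bar R}.

Definition L1 (f : T -> R) : Prop := mu.-integrable setT (EFin \o f).

Lemma L1_measurable f : L1 f -> measurable_fun setT f.
Proof. by move=> /(measurable_int mu) /measurable_EFinP. Qed.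

Lemma L1D f g : L1 f -> L1 g -> L1 (fun w => f w + g w).
Proof. by move=> fi gi; exact: (integrableD measurableT fi gi). Qed.

Lemma L1B f g : L1 f -> L1 g -> L1 (fun w => f w - g w).
Proof. by move=> fi gi; exact: (integrableB measurableT fi gi). Qed.

Lemma L1Z k f : L1 f -> L1 (fun w => k * f w).
Proof. by move=> fi; exact: (integrableZl measurableT k fi). Qed.

Lemma L1N f : L1 f -> L1 (fun w => - f w).
Proof. by move=> fi; exact: (integrableN fi). Qed.

Lemma L1_norm f : L1 f -> L1 (fun w => `|f w|).
Proof. by move=> /integrable_norm. Qed.

Lemma L1_sum (I : Type) (s : seq I) (Q : pred I) (f : I -> T -> R) :
  (forall i, L1 (f i)) -> L1 (fun w => \sum_(i <- s | Q i) f i w).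
Proof.
move=> fi; rewrite /L1.
have := @integrable_sum _ _ _ mu setT measurableT I s Q (fun i => EFin \o f i).
move=> /(_ (fun i _ => fi i)); apply: eq_integrable => // w _.
by rewrite /= sumEFin.
Qed.

Lemma le_L1 (f g : T -> R) : measurable_fun setT f -> (forall w, `|f w| <= g w) ->
  L1 g -> L1 f.
Proof.
move=> mf fg; apply: le_integrable => //; first exact/measurable_EFinP.
by move=> w _; rewrite /= lee_fin (le_trans (fg w))// ler_norm.
Qed.

Lemma L1M_bounded M (f g : T -> R) : measurable_fun setT g -> (forall w, `|g w| <= M) ->
  L1 f -> L1 (fun w => g w * f w).
Proof.
move=> mg gM fi; apply: (@le_L1 _ (fun w => M * `|f w|)).
- by apply: measurable_funM => //; exact: L1_measurable.
- by move=> w; rewrite normrM ler_wpM2r.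
- exact/L1Z/L1_norm.
Qed.

Lemma Rintegral_sum (I : Type) (s : seq I) (Q : pred I) (f : I -> T -> R) :
  (forall i, L1 (f i)) ->
  \int[mu]_w (\sum_(i <- s | Q i) f i w) = \sum_(i <- s | Q i) \int[mu]_w f i w.
Proof.
move=> fi; elim: s => [|i s ih].
  under eq_Rintegral do rewrite big_nil.
  by rewrite big_nil Rintegral_cst// mul0r.
under eq_Rintegral do rewrite big_cons.
rewrite big_cons; case: (Q i) => //.
by rewrite RintegralD//; [rewrite ih | exact: fi | exact: L1_sum].
Qed.

Lemma dominated_cvg_Rintegral (f_ : nat -> T -> R) (f g : T -> R) :
  (forall n, measurable_fun setT (f_ n)) ->
  (forall w, f_ n w @[n --> \oo] --> f w) -> L1 g ->
  (forall n w, `|f_ n w| <= g w) ->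
  L1 f /\ \int[mu]_w f_ n w @[n --> \oo] --> \int[mu]_w f w.
Proof.
move=> mf ff gi fg.
have mlim : measurable_fun setT f by apply: measurable_fun_cvg mf _ => w _.
have fle w : `|f w| <= g w.
  have : `|f_ n w| @[n --> \oo] --> `|f w| by apply: cvg_norm; exact: ff.
  move=> cf; apply: (ler_cvg_to cf (cvg_cst (g w))).
  by near=> n; exact: fg.
have fi : L1 f by exact: le_L1 fle gi.
split => //; apply: fine_cvg; rewrite fineK ?integrable_fin_num//.
apply: (@dominated_cvg _ _ _ _ _ _ _ _ (EFin \o g)) => //.
- by move=> n; exact/measurable_EFinP.
- by move=> w _; apply: cvg_EFin; [exact: nearW|exact: ff].
- by move=> n w _; rewrite lee_fin.
Unshelve. all: by end_near. Qed.

End expectation.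

(** * From cosines to the generated sigma-algebra *)

Section smoothstep.
Context {R : realType}.
Implicit Type u : R.

(** A polynomial map of [[0, 1]] whose iterates converge, away from the fixed point
[1/2], to the indicator function of values above [1/2]. It turns a trigonometric polynomial into an approximate
indicator function without leaving the algebra of trigonometric polynomials. *)
Definition smoothstep u : R := u * (u * (3 - 2 * u)).

Lemma smoothstepC u : smoothstep (1 - u) = 1 - smoothstep u.
Proof. by rewrite /smoothstep; ring. Qed.

Lemma smoothstep_itv u : 0 <= u <= 1 -> 0 <= smoothstep u <= 1.
Proof.
move=> /andP[u0 u1]; rewrite /smoothstep; apply/andP; split.
  by rewrite !mulr_ge0//; lra.
have : 0 <= (1 - u) * (1 - u) * (1 + 2 * u) by rewrite !mulr_ge0//; lra.
by lra.
Qed.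

Lemma iter_smoothstep_itv n u : 0 <= u <= 1 -> 0 <= iter n smoothstep u <= 1.
Proof. by move=> u01; elim: n => //= n; exact: smoothstep_itv. Qed.

Lemma iter_smoothstep_lt u : 0 <= u -> u < 2^-1 ->
  iter n smoothstep u @[n --> \oo] --> 0.
Proof.
move=> u0 u2; pose r := u * (3 - 2 * u).
have r0 : 0 <= r by rewrite /r mulr_ge0//; lra.
have r1 : r < 1.
  have : 0 < (1 - u) * (1 - 2 * u) by apply: mulr_gt0; lra.
  by rewrite /r; lra.
have H n : 0 <= iter n smoothstep u <= r ^+ n * u.
  elim: n => [|n /andP[i0 ir]]; first by rewrite expr0 mul1r u0 lexx.
  rewrite iterS exprS; set i := iter n _ _ in i0 ir *.
  have iu : i <= u by rewrite (le_trans ir)// ler_piMl// exprn_ile1// ltW.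
  have ri : i * (3 - 2 * i) <= r.
    have : 0 <= (u - i) * (3 - 2 * (u + i)) by apply: mulr_ge0; lra.
    by rewrite /r; lra.
  have ri0 : 0 <= i * (3 - 2 * i) by apply: mulr_ge0; lra.
  rewrite /smoothstep mulr_ge0//= mulrC -mulrA.
  by apply: ler_pM.
apply: (@squeeze_cvgr _ _ _ _ (cst 0) (fun n => r ^+ n * u)).
- by apply: nearW => n; exact: H.
- exact: cvg_cst.
- suff: r ^+ n * u @[n --> \oo] --> 0 * u by rewrite mul0r.
  apply: cvgM; last exact: cvg_cst.
  by apply: cvg_expr; rewrite ger0_norm.
Qed.

Lemma iter_smoothstep_gt u : u <= 1 -> 2^-1 < u ->
  iter n smoothstep u @[n --> \oo] --> (1 : R).
Proof.
move=> u1 u2.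
have H n : iter n smoothstep u = 1 - iter n smoothstep (1 - u).
  by elim: n => [|n ih]; [rewrite /=; ring|rewrite !iterS ih smoothstepC].
under eq_cvg do rewrite H.
suff: (1 - iter n smoothstep (1 - u)) @[n --> \oo] --> (1 - 0 : R) by rewrite subr0.
apply: cvgB; first exact: cvg_cst.
by apply: iter_smoothstep_lt; lra.
Qed.

Lemma iter_smoothstep_half n : iter n smoothstep (2^-1 : R) = 2^-1.
Proof. by elim: n => // n ih; rewrite iterS ih /smoothstep; field. Qed.

End smoothstep.

Lemma measurable_cos {R : realType} : measurable_fun (setT : set R) (@cos R).
Proof. by apply: continuous_measurable_fun; exact: continuous_cos. Qed.

Lemma measurable_sin {R : realType} : measurable_fun (setT : set R) (@sin R).
Proof. by apply: continuous_measurable_fun; exact: continuous_sin. Qed.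

Section multipliers.
Context {d : measure_display} {Om : measurableType d} {R : realType}.
Variable P : probability Om R.
Variable G : set (Om -> R).
Hypothesis G_meas : forall X, G X -> measurable_fun setT X.
Hypothesis G_lin : forall a X Y, G X -> G Y -> G (fun w => a * X w + Y w).

(** [G] is a vector space of random variables. The integrable functions orthogonal
to all cosines of elements of [G] are shown to be orthogonal to every bounded
function measurable with respect to [G]; the functions [g] such that
multiplication by [g] preserves this orthogonality form an algebra closed under
bounded pointwise limits, so only cosines have to be examined. *)
Definition kills_cos (zeta : Om -> R) : Prop :=
  L1 P zeta /\ forall X b, G X -> \int[P]_w (cos (X w + b) * zeta w) = 0.

Definition multiplier (g : Om -> R) : Prop :=
  [/\ measurable_fun setT g, exists M, forall w, `|g w| <= M &
      forall zeta, kills_cos zeta -> kills_cos (fun w => g w * zeta w)].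

Lemma measurable_cos_shift X b : G X -> measurable_fun setT (fun w => cos (X w + b)).
Proof.
move=> /G_meas mX; apply: (measurableT_comp measurable_cos).
exact: measurable_funD.
Qed.

Lemma norm_cos_le1 (x : R) : `|cos x| <= 1.
Proof. by rewrite ler_norml cos_geN1 cos_le1. Qed.

Lemma norm_sin_le1 (x : R) : `|sin x| <= 1.
Proof. by rewrite ler_norml sin_geN1 sin_le1. Qed.

Lemma multiplier_cst c : multiplier (fun=> c).
Proof.
split => //; first by exists `|c|.
move=> z [iz kz]; split; first exact: L1Z.
move=> X b GX; under eq_Rintegral do rewrite mulrCA.
rewrite RintegralZl//; first by rewrite kz// mulr0.
by apply: (@L1M_bounded _ _ _ _ 1) => // [|w]; [exact: measurable_cos_shift|
  exact: norm_cos_le1].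
Qed.

Lemma multiplierM g h : multiplier g -> multiplier h ->
  multiplier (fun w => g w * h w).
Proof.
move=> [mg [M gM] kg] [mh [N hN] kh]; split.
- exact: measurable_funM.
- by exists (M * N) => w; rewrite normrM ler_pM.
- by move=> z /kh /kg; congr kills_cos; apply/funext => w; rewrite mulrA.
Qed.

Lemma multiplierD g h : multiplier g -> multiplier h ->
  multiplier (fun w => g w + h w).
Proof.
move=> [mg [M gM] kg] [mh [N hN] kh]; split.
- exact: measurable_funD.
- by exists (M + N) => w; rewrite (le_trans (ler_normD _ _))// lerD.
- move=> z kz; have [ig zg] := kg _ kz; have [ih zh] := kh _ kz; split.
    have := L1D ig ih; congr (L1 P _); apply/funext => w; exact/esym/mulrDl.
  move=> X b GX; under eq_Rintegral do rewrite mulrDl mulrDr.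
  have L1c f : L1 P f -> L1 P (fun w => cos (X w + b) * f w).
    by apply: (@L1M_bounded _ _ _ _ 1) => // [|w]; [exact: measurable_cos_shift|
      exact: norm_cos_le1].
  rewrite RintegralD//; [|exact: L1c|exact: L1c].
  by rewrite zg// zh// addr0.
Qed.

Lemma multiplierZ c g : multiplier g -> multiplier (fun w => c * g w).
Proof. by move=> /(multiplierM (multiplier_cst c)). Qed.

Lemma multiplierC g : multiplier g -> multiplier (fun w => 1 - g w).
Proof.
move=> /(multiplierZ (-1)) /(multiplierD (multiplier_cst 1)).
by congr multiplier; apply/funext => w; rewrite mulN1r.
Qed.

Lemma multiplier_cvg M (g_ : nat -> Om -> R) g :
  (forall n, multiplier (g_ n)) -> (forall n w, `|g_ n w| <= M) ->
  (forall w, g_ n w @[n --> \oo] --> g w) -> multiplier g.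
Proof.
move=> mg gM gg.
have mlim : measurable_fun setT g.
  by apply: measurable_fun_cvg (fun w _ => gg w) => n; have [] := mg n.
have gle w : `|g w| <= M.
  have cf : `|g_ n w| @[n --> \oo] --> `|g w| by apply: cvg_norm; exact: gg.
  by apply: (ler_cvg_to cf (cvg_cst M)); apply: nearW => n; exact: gM.
split => //; first by exists M.
move=> z kz; have [iz _] := kz; split; first exact: L1M_bounded gle iz.
move=> X b GX.
have [||||_ cv] := @dominated_cvg_Rintegral _ _ _ P
   (fun n w => cos (X w + b) * (g_ n w * z w))
   (fun w => cos (X w + b) * (g w * z w)) (fun w => M * `|z w|).
- move=> n; apply: measurable_funM; first exact: measurable_cos_shift.
  by apply: measurable_funM; [have [] := mg n|exact: L1_measurable iz].
- move=> w; apply: cvgM; first exact: cvg_cst.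
  by apply: cvgM; [exact: gg|exact: cvg_cst].
- exact/L1Z/L1_norm.
- move=> n w /=; rewrite !normrM (@le_trans _ _ (`|g_ n w| * `|z w|))//.
    by rewrite ler_piMl ?mulr_ge0 ?norm_cos_le1.
  by rewrite ler_wpM2r.
apply: (cvg_unique _ cv) => //=.
rewrite [X in X @ _ --> _](_ : _ = cst 0); first exact: cvg_cst.
apply/funext => n; have [_ _ /(_ _ kz)[_ +]] := mg n; exact.
Qed.

(** The product formula writes [cos A * cos B] as a combination of cosines of
[A + B] and [A - B], which are again cosines of elements of [G]. *)
Lemma multiplier_cos X b : G X -> multiplier (fun w => cos (X w + b)).
Proof.
move=> GX; split; first exact: measurable_cos_shift.
  by exists 1 => w; exact: norm_cos_le1.
move=> z [iz kz].
have L1c Y c f : G Y -> L1 P f -> L1 P (fun w => cos (Y w + c) * f w).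
  move=> GY; apply: (@L1M_bounded _ _ _ _ 1) => // [|w].
    exact: measurable_cos_shift.
  exact: norm_cos_le1.
split; first exact: L1c.
move=> Y c GY.
have GD : G (fun w => 1 * Y w + X w) by exact: G_lin.
have GB : G (fun w => (-1) * X w + Y w) by exact: G_lin.
transitivity (\int[P]_w (2^-1 * (cos (1 * Y w + X w + (c + b)) * z w) +
   2^-1 * (cos ((-1) * X w + Y w + (c - b)) * z w))).
  apply: eq_Rintegral => w _.
  have -> : 1 * Y w + X w + (c + b) = (Y w + c) + (X w + b) by ring.
  have -> : (-1) * X w + Y w + (c - b) = (Y w + c) - (X w + b) by ring.
  by move: (Y w + c) (X w + b) => A B; rewrite cosD cosB; field.
have LD := L1c _ (c + b) _ GD iz; have LB := L1c _ (c - b) _ GB iz.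
rewrite RintegralD//; [|exact: L1Z LD|exact: L1Z LB].
have eD : \int[P]_w (cos (1 * Y w + X w + (c + b)) * z w) = 0 by exact: kz GD.
have eB : \int[P]_w (cos ((-1) * X w + Y w + (c - b)) * z w) = 0 by exact: kz GB.
by rewrite RintegralZl// RintegralZl// eD eB !mulr0 addr0.
Qed.

Let G_scale a X : G X -> G (fun w => a * X w).
Proof.
move=> GX; have := G_lin (a - 1) GX GX.
by congr G; apply/funext => w; ring.
Qed.

(** The function [1/2 + sin ((X - c - 1/n) / n) / 2] is a trigonometric polynomial in
[X]; for [n] large it is above [1/2] exactly when [X > c + 1/n], since [X w / n] is
then within a half period. Iterated smoothsteps produce the indicator
function of this condition, and [n] to infinity that of [X > c]. *)
Lemma multiplier_ray X c : G X -> multiplier (\1_[set w | c < X w]).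
Proof.
move=> GX.
pose f n w := 2^-1 + 2^-1 * cos (n.+1%:R^-1 * X w +
                                 (- (c + n.+1%:R^-1) / n.+1%:R - pi / 2)).
have fE n w : f n w = 2^-1 + 2^-1 * sin ((X w - (c + n.+1%:R^-1)) / n.+1%:R).
  by rewrite /f addrA cosBpihalf; congr (_ + _ * sin _); ring.
have f01 n w : 0 <= f n w <= 1.
  rewrite fE.
  have := sin_geN1 ((X w - (c + n.+1%:R^-1)) / n.+1%:R).
  have := sin_le1 ((X w - (c + n.+1%:R^-1)) / n.+1%:R); lra.
have mf n : multiplier (f n).
  apply: multiplierD; first exact: multiplier_cst.
  by apply: multiplierZ; apply: multiplier_cos; exact: G_scale.
have mit n k : multiplier (fun w => iter k smoothstep (f n w)).
  elim: k => [|k ih] /=; first exact: mf.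
  apply: multiplierM => //; apply: multiplierM => //.
  have := multiplierD (multiplier_cst 3) (multiplierZ (-2) ih).
  by congr multiplier; apply/funext => w; rewrite mulNr.
(* The iterates stay at the fixed point [1/2]; the shift of [c] by [1/n] makes
   this exceptional value disappear for large [n]. *)
pose g n w : R := if f n w < 2^-1 then 0 else if f n w == 2^-1 then 2^-1 else 1.
have mg n : multiplier (g n).
  apply: (@multiplier_cvg 1 (fun k w => iter k smoothstep (f n w))) => //.
    move=> k w; have /andP[i0 i1] := @iter_smoothstep_itv _ k _ (f01 n w).
    by rewrite ger0_norm.
  move=> w; rewrite /g; have /andP[f0 f1] := f01 n w.
  case: ltgtP => [lt2|gt2|->].
  - exact: iter_smoothstep_lt.
  - exact: iter_smoothstep_gt.
  - by under eq_cvg do rewrite iter_smoothstep_half; exact: cvg_cst.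
apply: (multiplier_cvg (M := 1) mg) => [n w|w].
  by rewrite /g; case: ifPn => _; [|case: ifPn => _]; rewrite ger0_norm//; lra.
apply: cvg_near_cst.
have piB : \forall n \near \oo, (`|X w - c| + 1) / n.+1%:R < pi :> R.
  near=> n; rewrite ltr_pdivrMr// -ltr_pdivrMl ?pi_gt0//.
  apply: (@lt_le_trans _ _ n%:R); last by rewrite ler_nat.
  by near: n; exact: nbhs_infty_gtr.
have [Xc|cX] := leP (X w) c.
  near=> n.
  suff : f n w < 2^-1.
    by rewrite /g => ->; rewrite indicE memNset//= ; apply/negP; rewrite -leNgt.
  rewrite fE; set x := (X in sin X).
  suff : 0 < sin (- x) by rewrite sinN; lra.
  have n0 : 0 < n.+1%:R^-1 :> R by rewrite invr_gt0.
  apply: sin_gt0_pi; rewrite /x; apply/andP; split.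
    by rewrite -mulNr mulr_gt0//; move: n0; move: (n.+1%:R^-1) => q ?; lra.
  apply: le_lt_trans (near piB n _) => //; rewrite -mulNr ler_wpM2r ?(ltW n0)//.
  have : n.+1%:R^-1 <= 1 :> R by rewrite invf_le1 ?ler1n.
  have := ler_norm (- (X w - c)); rewrite normrN; move: n0; move: (n.+1%:R^-1) (`|_|) => q r; lra.
have piC : \forall n \near \oo, n.+1%:R^-1 < X w - c :> R.
  near=> n; rewrite invf_plt ?posrE//; last by rewrite subr_gt0.
  apply: (@lt_le_trans _ _ n%:R); last by rewrite ler_nat.
  by near: n; exact: nbhs_infty_gtr.
near=> n.
suff f2 : 2^-1 < f n w.
  rewrite /g ltNge (ltW f2)/= gt_eqF// indicE mem_set//=.
rewrite fE; set x := (X in sin X).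
suff : 0 < sin x by lra.
have n0 : 0 < n.+1%:R^-1 :> R by rewrite invr_gt0.
have nX : n.+1%:R^-1 < X w - c by near: n.
apply: sin_gt0_pi; rewrite /x; apply/andP; split.
  by rewrite mulr_gt0//; move: n0 nX; move: (n.+1%:R^-1) => q; lra.
apply: le_lt_trans (near piB n _) => //; rewrite ler_wpM2r ?(ltW n0)//.
have := ler_norm (X w - c); move: n0; move: (n.+1%:R^-1) (`|_|) => q r; lra.
Unshelve. all: by end_near. Qed.

Lemma multiplier_sigma_algebra : sigma_algebra setT [set A | multiplier (\1_A)].
Proof.
split => /=.
- by rewrite indic0; exact: multiplier_cst.
- move=> A /multiplierC; rewrite setTD.
  congr multiplier; apply/funext => w; rewrite !indicE in_setC.
  by case: (_ \in _); rewrite ?subrr ?subr0.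
- move=> A mA; pose U n := \bigcup_(i < n) A i.
  have mU n : multiplier (\1_(U n)).
    elim: n => [|n ih].
      by rewrite /U bigcup_mkord big_ord0 indic0; exact: multiplier_cst.
    have := multiplierC (multiplierM (multiplierC ih) (multiplierC (mA n))).
    congr multiplier; apply/funext => w.
    rewrite /U !bigcup_mkord big_ord_recr/= !indicE in_setU.
    by do 2 case: (_ \in _);
      rewrite /= ?subrr ?subr0 ?mulr0 ?mul0r ?mulr1 ?subrr ?subr0.
  apply: (multiplier_cvg (M := 1) mU) => [n w|w].
    by rewrite indicE; case: (_ \in _); rewrite ?normr1 ?normr0.
  apply: cvg_near_cst.
  have [[i _ Ai]|nA] := pselect ((\bigcup_k A k) w).
    near=> n; rewrite !indicE !mem_set//; first by exists i.
    by exists i => //=; near: n; exact: nbhs_infty_gt.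
  apply: nearW => n; rewrite !indicE !memNset// => -[i _ Ai]; apply: nA.
  by exists i.
Unshelve. all: by end_near. Qed.

(** Rays generate the Borel sets. *)
Lemma multiplier_preimage X B : G X -> measurable B -> multiplier (\1_(X @^-1` B)).
Proof.
move=> GX mB.
have {}mB : <<s @RGenOInfty.G R >> B.
  have : @measurable _ (g_sigma_algebraType (@ocitv R)) B by exact: mB.
  by rewrite RGenOInfty.measurableE.
have [s0 sC sU] := multiplier_sigma_algebra.
pose S := [set B : set R | multiplier (\1_(X @^-1` B))].
apply: (mB S); split.
  split; rewrite /S/=; first by rewrite preimage_set0.
  - by move=> A /sC; rewrite setTD preimage_setC -setTD.
  - by move=> A mA; rewrite preimage_bigcup; exact: sU.
move=> _ [c ->] /=.
have := multiplier_ray c GX; congr (multiplier \1__).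
by apply/seteqP; split => w; rewrite /= in_itv/= andbT.
Qed.

Lemma multiplier_generated (C : set (set Om)) A :
  (forall B, C B -> multiplier (\1_B)) -> <<s C >> A -> multiplier (\1_A).
Proof.
move=> mC sA; apply: (sA [set A | multiplier (\1_A)]); split => //.
exact: multiplier_sigma_algebra.
Qed.

Lemma multiplier_sum (I : Type) (s : seq I) (f : I -> Om -> R) :
  (forall i, multiplier (f i)) -> multiplier (fun w => \sum_(i <- s) f i w).
Proof.
move=> mf; elim: s => [|i s ih].
  by under eq_fun do rewrite big_nil; exact: multiplier_cst.
by under eq_fun do rewrite big_cons; exact: multiplierD.
Qed.

Import HBNNSimple.

(** [X + M] is nonnegative, hence an increasing limit of simple functions of [X],
which are combinations of indicator functions of preimages by [X]. *)
Lemma multiplier_bounded (M : R) (X : Om -> R) : measurable_fun setT X -> (forall w, `|X w| <= M) ->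
  (forall B, measurable B -> multiplier (\1_(X @^-1` B))) -> multiplier X.
Proof.
move=> mX XM mB.
pose f (y : R) := (Num.max (y + M) 0)%:E.
have mf : measurable_fun setT f.
  apply/measurable_EFinP; apply: measurable_maxr => //; exact: measurable_funD.
have f0 y : setT y -> (0 <= f y)%E by move=> _; rewrite lee_fin le_max lexx orbT.
pose g := nnsfun_approx measurableT mf.
have fX w : f (X w) = (X w + M)%:E.
  rewrite /f max_l//; have := XM w; rewrite ler_norml; lra.
have mg n : multiplier (fun w => g n (X w)).
  under eq_fun do rewrite fimfunE fsbig_finite//=.
  apply: (multiplier_sum _ (f := fun r w => r * \1_(g n @^-1` [set r]) (X w))) => r.
  apply: multiplierZ; have := mB (g n @^-1` [set r]); apply.
  exact: measurable_sfunP.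
have gcvg w : g n (X w) @[n --> \oo] --> X w + M.
  have := @cvg_nnsfun_approx _ _ _ _ measurableT _ mf f0 (X w) I.
  by rewrite fX => /fine_cvg.
have gX : multiplier (fun w => X w + M).
  apply: (multiplier_cvg (M := M + M) mg) => [n w|w].
    rewrite ger0_norm//.
    have nd : {homo (fun n => g n (X w)) : m n / (m <= n)%N >-> m <= n}.
      by move=> i j ij; have /lefP := nd_nnsfun_approx measurableT mf ij; exact.
    apply: (@le_trans _ _ (X w + M)).
      rewrite -(cvg_lim _ (gcvg w))//; apply: (nondecreasing_cvgn_le nd).
      by apply/cvg_ex; exists (X w + M); exact: gcvg.
    by rewrite lerD2r; have := XM w; rewrite ler_norml => /andP[].
  exact: gcvg.
have := multiplierD gX (multiplier_cst (- M)).
by congr multiplier; apply/funext => w; rewrite addrK.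
Qed.

End multipliers.

(** * Normal laws and Stein's identity *)

Section normal_law.
Context {d : measure_display} {Om : measurableType d} {R : realType}.
Variable P : probability Om R.
Local Notation mu := (@lebesgue_measure R).

Lemma integral_normal_prob (m s : R) (f : R -> \bar R) :
  (normal_prob m s).-integrable setT f ->
  (\int[normal_prob m s]_x f x = \int[mu]_x (f x * (normal_pdf m s x)%:E))%E.
Proof.
move=> intf; have dom := @normal_prob_dominates R m s.
have mf := measurable_int _ intf.
have mpdf : measurable_fun setT (fun x => (normal_pdf m s x)%:E).
  by apply: measurableT_comp => //; exact: measurable_normal_pdf.
rewrite -(Radon_Nikodym_change_of_variables dom)//.
apply: ae_eq_integral => //.
- apply: emeasurable_funM => //; apply: (measurable_int mu).
- exact: emeasurable_funM.
- apply: ae_eqe_mul2l.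
  rewrite Radon_NikodymE/=; case: cid => /= h [h1 h2 h3].
  apply: integral_ae_eq => //= E _ mE.
  by rewrite -h3.
Qed.

Section expectation_of_normal.
Variables (X : {RV P >-> R}) (m s : R).
Hypothesis lawX : forall B, measurable B -> P (X @^-1` B) = normal_prob m s B.

Lemma expectation_normal (f : R -> R) : measurable_fun setT f ->
  L1 P (f \o X) -> L1 mu (fun x => f x * normal_pdf m s x) /\
  \int[P]_w f (X w) = \int[mu]_x (f x * normal_pdf m s x).
Proof.
move=> mf fX.
have mid : measurable_fun setT (id : measurableTypeR R -> R).
  by move=> _ B mB; rewrite setTI.
have pushE g : measurable_fun setT g -> (forall x, 0 <= g x)%E ->
    (\int[normal_prob m s]_x g x = \int[P]_w g (X w))%E.
  move=> mg g0; rewrite -[RHS](@ge0_integral_distribution _ _ _ _ _ P X g)//.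
  rewrite -[LHS](@ge0_integral_pushforward _ _ _ _ _ _ mid (normal_prob m s) setT g)//.
  by apply: eq_measure_integral => A mA _; exact/esym/lawX.
have intf : (normal_prob m s).-integrable setT (EFin \o f).
  apply/integrableP; split; first exact/measurable_EFinP.
  rewrite pushE//; first by move/integrableP : fX => [].
  by apply: measurableT_comp => //; exact/measurable_EFinP.
split.
  apply/integrableP; split.
    apply/measurable_EFinP; apply: measurable_funM => //.
    exact: measurable_normal_pdf.
  have /integrableP[_] := integrable_abse intf.
  rewrite integral_normal_prob; last exact: integrable_abse (integrable_abse intf).
  apply: le_lt_trans; apply: ge0_le_integral => //=.
  - apply/measurable_EFinP; apply: measurableT_comp => //.
    by apply: measurable_funM => //; exact: measurable_normal_pdf.
  - apply/measurable_EFinP; apply: measurable_funM => //; last exact: measurable_normal_pdf.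
    by apply: measurableT_comp => //; exact: measurableT_comp.
  - move=> x _; rewrite lee_fin normrM normr_id.
    by rewrite [X in _ * X]ger0_norm// normal_pdf_ge0.
rewrite /Rintegral; congr fine.
under [RHS]eq_integral do rewrite EFinM.
rewrite -integral_normal_prob//.
rewrite -[LHS](@integral_distribution _ _ _ _ _ P X (EFin \o f))//; last first.
  exact/measurable_EFinP.
rewrite -[RHS](@integral_pushforward _ _ _ _ _ _ mid (normal_prob m s) setT (EFin \o f))//.
  by apply: eq_measure_integral => A mA _; exact/lawX.
exact/measurable_EFinP.
Qed.

End expectation_of_normal.
End normal_law.

Section stein.
Context {d : measure_display} {Om : measurableType d} {R : realType}.
Variable P : probability Om R.
Local Notation mu := (@lebesgue_measure R).

Lemma is_derive_normal_pdf (m s x : R) : s != 0 ->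
  is_derive x 1 (normal_pdf m s) (- (x - m) / s ^+ 2 * normal_pdf m s x).
Proof.
move=> s0; rewrite normal_pdfE// /normal_fun.
apply: is_derive_eq.
by rewrite /GRing.scale/=; field.
Qed.

(** The quadratic factor beats the linear growth allowed for test functions in
Stein's identity, so that the boundary terms of the integration by parts vanish
at infinity. *)
Lemma normal_pdf_decay (m s x : R) : s != 0 ->
  (1 + `|x - m|) ^+ 2 * normal_pdf m s x <= (2 + 4 * s ^+ 2) * normal_peak s.
Proof.
move=> s0; rewrite normal_pdfE// /normal_fun mulrCA mulrC ler_pM2r ?normal_peak_gt0//.
set z := x - m; set y := z ^+ 2 / (s ^+ 2 *+ 2).
have s20 : 0 < s ^+ 2 by rewrite exprn_even_gt0.
have y0 : 0 <= y by rewrite /y divr_ge0 ?sqr_ge0// mulrn_wge0// ltW.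
have zy : z ^+ 2 = 2 * s ^+ 2 * y by rewrite /y; field.
have -> : - z ^+ 2 / (s ^+ 2 *+ 2) = - y by rewrite /y mulNr.
have zz : (1 + `|z|) ^+ 2 <= 2 + 2 * z ^+ 2.
  by rewrite -(real_normK (num_real z)); have := sqr_ge0 (1 - `|z|); lra.
rewrite expRN ler_pdivrMr ?expR_gt0//.
have ey := expR_ge1Dx y.
apply: (le_trans zz); rewrite zy.
apply: (@le_trans _ _ ((2 + 4 * s ^+ 2) * (1 + y))); last by rewrite ler_wpM2l//; lra.
have : 0 <= s ^+ 2 * y by rewrite mulr_ge0// ltW.
by lra.
Qed.

Variables (X : {RV P >-> R}) (m s : R).
Hypothesis s_neq0 : s != 0.
Hypothesis lawX : forall B, measurable B -> P (X @^-1` B) = normal_prob m s B.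

(** The density [phi] satisfies [phi' = - (x - m) / s^2 * phi], so the integrand
[F' phi - F (x - m) phi / s^2] is the derivative of [F phi], which vanishes at
infinity. *)
Lemma stein_identity (F F' : R -> R) :
  (forall x : R, is_derive x 1 F (F' x)) -> continuous F' ->
  (forall x : R, `|F x| <= 1 + `|x - m|) ->
  L1 P (fun w => F' (X w)) -> L1 P (fun w => F (X w) * (X w - m)) ->
  \int[P]_w (F (X w) * (X w - m)) = s ^+ 2 * \int[P]_w F' (X w).
Proof.
move=> dF cF' F1 iF' iF.
have cF : continuous F by move=> x; apply: differentiable_continuous; apply/derivable1_diffP; exact: ex_derive.
pose phi := normal_pdf m s.
have cphi : continuous phi by exact: continuous_normal_pdf.
pose f (x : R) := F' x * phi x - (F x * (x - m)) * phi x / s ^+ 2.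
have cf : continuous f.
  move=> x; apply: cvgB; first by apply: cvgM; [exact: cF'|exact: cphi].
  apply: cvgM; last exact: cvg_cst.
  apply: cvgM; last exact: cphi.
  by apply: cvgM; [exact: cF|apply: cvgB; [exact: cvg_id|exact: cvg_cst]].
have dFphi (x : R) : is_derive x 1 (fun x => F x * phi x) (f x).
  have dphi := is_derive_normal_pdf m x s_neq0.
  apply: is_derive_eq; rewrite /f /GRing.scale/= -/phi; field.
  by [].
have [iFphi EF'] := @expectation_normal _ _ _ P X m s lawX F' (continuous_measurable_fun cF') iF'.
have mF : measurable_fun setT (fun x => F x * (x - m)).
  by apply: measurable_funM; [exact: continuous_measurable_fun|exact: measurable_funB].
have [iFphi2 EF] := @expectation_normal _ _ _ P X m s lawX _ mF iF.
have intf : L1 mu f.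
  by have := L1B iFphi (L1Z (s ^+ 2)^-1 iFphi2); congr L1; apply/funext => x; rewrite /f mulrC; congr (_ - _); rewrite mulrC.
have E0 : \int[mu]_x f x = 0.
  pose C := (2 + 4 * s ^+ 2) * normal_peak s.
  have C0 : 0 <= C by rewrite mulr_ge0 ?normal_peak_ge0// addr_ge0// mulr_ge0// sqr_ge0.
  have decay x : `|F x * phi x| * (1 + `|x - m|) <= C.
    rewrite normrM [`|phi x|]ger0_norm ?normal_pdf_ge0// mulrAC.
    apply: le_trans (normal_pdf_decay m x s_neq0).
    by rewrite ler_wpM2r ?normal_pdf_ge0// expr2 ler_wpM2r ?addr_ge0.
  have FTC n : \int[mu]_(x in `[- n.+1%:R, n.+1%:R]) f x =
      F n.+1%:R * phi n.+1%:R - F (- n.+1%:R) * phi (- n.+1%:R).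
    have n0 : 0 < n.+1%:R :> R by [].
    rewrite /Rintegral (@continuous_FTC2 _ f (fun x => F x * phi x))//.
    - lra.
    - exact: continuous_subspaceT.
    - have cFphi : continuous (fun x => F x * phi x).
        by move=> x; apply: cvgM; [exact: cF|exact: cphi].
      split; first by move=> x _; apply: ex_derive.
        by apply: cvg_at_right_filter; exact: cFphi.
      by apply: cvg_at_left_filter; exact: cFphi.
    - by move=> x _; rewrite derive1E; apply: derive_val.
  have [||||_ cv] := @dominated_cvg_Rintegral _ _ _ mu
      (fun n x => f x * \1_(`[- n.+1%:R, n.+1%:R] : set R) x) f (fun x => `|f x|).
  - move=> n; apply: measurable_funM; first exact: L1_measurable intf.
    exact: measurable_indic.
  - move=> x; apply: cvg_near_cst; near=> n.
    rewrite indicE mem_set ?mulr1//= in_itv/= -ler_norml.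
    apply: (@le_trans _ _ n%:R); last by rewrite ler_nat.
    by near: n; exact: nbhs_infty_ger.
  - exact: L1_norm.
  - by move=> n x; rewrite normrM indicE; case: (_ \in _); rewrite ?normr1 ?normr0 ?mulr1 ?mulr0.
  have eqI n : \int[mu]_x (f x * \1_(`[- n.+1%:R, n.+1%:R] : set R) x) =
      F n.+1%:R * phi n.+1%:R - F (- n.+1%:R) * phi (- n.+1%:R).
    rewrite -FTC [RHS]Rintegral_mkcond; apply: eq_Rintegral => x _.
    by rewrite patch_indic.
  have {}cv : F n.+1%:R * phi n.+1%:R - F (- n.+1%:R) * phi (- n.+1%:R)
      @[n --> \oo] --> \int[mu]_x f x.
    by under eq_cvg do rewrite -eqI.
  apply: (cvg_unique _ cv) => //.
  apply/cvgrPdist_le => e e0; near=> n.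
  have small x : 1 + 2 * C / e <= 1 + `|x - m| -> `|F x * phi x| <= e / 2.
    move=> ex; rewrite leNgt; apply/negP => lt.
    have : e / 2 * (1 + 2 * C / e) <= C.
      apply: le_trans (decay x); apply: ler_pM => //; last exact: ltW.
        by rewrite divr_ge0// ltW.
      by rewrite addr_ge0// divr_ge0 ?(ltW e0)// mulr_ge0.
    have -> : e / 2 * (1 + 2 * C / e) = e / 2 + C by field; rewrite gt_eqF.
    by lra.
  have nbig : 2 * C / e + `|m| <= n.+1%:R.
    apply: (@le_trans _ _ n%:R); last by rewrite ler_nat.
    by near: n; exact: nbhs_infty_ger.
  rewrite sub0r normrN (le_trans (ler_normB _ _))//.
  have := small n.+1%:R; have := small (- n.+1%:R).
  have := ler_norm (n.+1%:R - m); have := ler_norm (- (- n.+1%:R - m)).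
  rewrite normrN; have := ler_norm m; have := ler_norm (- m); rewrite normrN.
  move: (2 * C / e) (n.+1%:R) nbig => q N.
  move: (`|m|) (`|N - m|) (`|- N - m|) => ? ? ? ? ? ? ? ? h1 h2.
  by have := h1 ltac:(lra); have := h2 ltac:(lra); lra.
rewrite EF EF'.
have := E0; rewrite /f RintegralB//; last first.
  by have := L1Z (s ^+ 2)^-1 iFphi2; congr L1; apply/funext => x; rewrite mulrC.
rewrite RintegralZr//; move/eqP; rewrite subr_eq0 => /eqP ->.
field.
Unshelve. all: by end_near.
Qed.

End stein.

(** * Centered Gaussian spaces *)

Section centered_gaussian.
Context {d : measure_display} {Om : measurableType d} {R : realType}.
Variable P : probability Om R.
Implicit Types X Y : Om -> R.

Lemma L1_cst (c : R) : L1 P (fun=> c).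
Proof. exact: finite_measure_integrable_cst. Qed.

Lemma L1_bounded X M : measurable_fun setT X -> (forall w, `|X w| <= M) -> L1 P X.
Proof. by move=> mX XM; apply: (le_L1 mX XM); exact: L1_cst. Qed.

Lemma Rintegral_prob_cst (c : R) : \int[P]_w c = c.
Proof. by rewrite Rintegral_cst//= probability_setT mulr1. Qed.

Lemma L1_of_sqr X : measurable_fun setT X -> L1 P (fun w => X w ^+ 2) -> L1 P X.
Proof.
move=> mX iX; apply: (@le_L1 _ _ _ _ _ (fun w => 1 + X w ^+ 2)) => //.
  move=> w; rewrite -(real_normK (num_real (X w))).
  by have := sqr_ge0 (`|X w| - 1); rewrite sqrrB; have := normr_ge0 (X w); nra.
exact: L1D (L1_cst 1) iX.
Qed.

Lemma L1_mul_sqr X Y : measurable_fun setT X -> measurable_fun setT Y ->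
  L1 P (fun w => X w ^+ 2) -> L1 P (fun w => Y w ^+ 2) -> L1 P (fun w => X w * Y w).
Proof.
move=> mX mY iX iY; apply: (@le_L1 _ _ _ _ _ (fun w => X w ^+ 2 + Y w ^+ 2)).
- exact: measurable_funM.
- move=> w; rewrite normrM -(real_normK (num_real (X w))) -(real_normK (num_real (Y w))).
  have := sqr_ge0 (`|X w| - `|Y w|); have := normr_ge0 (X w); have := normr_ge0 (Y w); nra.
- exact: L1D.
Qed.

Lemma ae_eq_Rintegral X Y : measurable_fun setT X -> measurable_fun setT Y ->
  {ae P, forall w, X w = Y w} -> \int[P]_w X w = \int[P]_w Y w.
Proof.
move=> mX mY XY; congr fine; apply: ae_eq_integral => //.
- exact/measurable_EFinP.
- exact/measurable_EFinP.
- by apply: filterS XY => w /= -> .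
Qed.

Definition centered_gaussian X : Prop :=
  [/\ measurable_fun setT X, L1 P (fun w => X w ^+ 2), \int[P]_w X w = 0 &
      gaussian_law P X].

Lemma measurable_cosD X b : measurable_fun setT X ->
  measurable_fun setT (fun w => cos (X w + b)).
Proof. by move=> mX; apply: (measurableT_comp measurable_cos); exact: measurable_funD. Qed.

Lemma measurable_sinD X b : measurable_fun setT X ->
  measurable_fun setT (fun w => sin (X w + b)).
Proof. by move=> mX; apply: (measurableT_comp measurable_sin); exact: measurable_funD. Qed.

(** Stein's identity with constant and linear test functions identifies the mean
and variance parameters of a normal law with the moments of the variable. *)
Lemma centered_gaussian_cases X : centered_gaussian X ->
  ({ae P, forall w, X w = 0} /\ \int[P]_w X w ^+ 2 = 0) \/
  (exists s : R, [/\ s != 0, \int[P]_w X w ^+ 2 = s ^+ 2 &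
     forall B, measurable B -> P (X @^-1` B) = normal_prob 0 s B]).
Proof.
move=> [mX iX2 EX [[m [s [s0 lawX]]]|[m Xm]]]; last first.
  left; have m0 : m = 0.
    rewrite -EX -[LHS]Rintegral_prob_cst; apply: ae_eq_Rintegral => //.
    by apply: filterS Xm => w ->.
  rewrite {}m0 in Xm; split => //; rewrite -[RHS](Rintegral_prob_cst 0).
  apply: ae_eq_Rintegral => //; first exact: measurable_funX.
  by apply: filterS Xm => w ->; rewrite expr0n.
right; exists s.
pose X' : {RV P >-> R} := mfun_Sub (mem_set mX).
have iX := L1_of_sqr mX iX2.
have m0 : m = 0.
  have : \int[P]_w (cst 1 (X w) * (X w - m)) = s ^+ 2 * \int[P]_w (cst 0 (X w)).
  apply: (@stein_identity _ _ _ P X' m s s0 lawX (cst 1) (cst 0)) => //.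
  - by move=> x; exact: cvg_cst.
  - by move=> x; rewrite /= normr1 lerDl.
  - exact: L1_cst.
  - have := L1B iX (L1_cst m); congr L1; apply/funext => w; by rewrite /= mul1r.
  have -> : \int[P]_w (cst 0 (X w)) = 0 by rewrite Rintegral_prob_cst.
  under eq_Rintegral do rewrite /= mul1r.
  rewrite mulr0 RintegralB//; last exact: L1_cst.
  by rewrite Rintegral_prob_cst [X in X - _]EX sub0r => /eqP; rewrite oppr_eq0 => /eqP.
rewrite {}m0 in lawX; split => //.
have : \int[P]_w (id (X w) * (X w - 0)) = s ^+ 2 * \int[P]_w (cst 1 (X w)).
apply: (@stein_identity _ _ _ P X' 0 s s0 lawX id (cst 1)) => //.
- by move=> x; exact: cvg_cst.
- by move=> x; rewrite subr0 lerDr.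
- exact: L1_cst.
- by have := iX2; congr L1; apply/funext => w; rewrite subr0 expr2.
under eq_Rintegral do rewrite subr0 -expr2.
by move=> ->; rewrite Rintegral_prob_cst mulr1.
Qed.

Lemma gaussian_stein_sin X b : centered_gaussian X ->
  \int[P]_w (sin (X w + b) * X w) =
  \int[P]_w X w ^+ 2 * \int[P]_w cos (X w + b).
Proof.
move=> gX; have [mX iX2 EX _] := gX.
have := centered_gaussian_cases gX => -[[X0 ->]|[s [s0 -> lawX]]].
  rewrite mul0r -[RHS](Rintegral_prob_cst 0); apply: ae_eq_Rintegral => //.
    by apply: measurable_funM => //; exact: measurable_sinD.
  by apply: filterS X0 => w ->; rewrite mulr0.
pose X' : {RV P >-> R} := mfun_Sub (mem_set mX).
transitivity (\int[P]_w (sin (X w + b) * (X w - 0))).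
  by apply: eq_Rintegral => w _; rewrite subr0.
apply: (@stein_identity _ _ _ P X' 0 s s0 lawX (fun x => sin (x + b)) (fun x => cos (x + b))) => //.
- by move=> x; apply: is_derive_eq; rewrite /GRing.scale/= addr0 mulr1.
- by move=> x; apply: continuous_comp; [apply: cvgD; [exact: cvg_id|exact: cvg_cst]|exact: continuous_cos].
- by move=> x; rewrite (le_trans (norm_sin_le1 _))// lerDl.
- by apply: (@L1_bounded _ 1) => [|w]; [exact: measurable_cosD|exact: norm_cos_le1].
- under eq_fun do rewrite subr0.
  apply: (@L1M_bounded _ _ _ P 1 X (fun w => sin (X w + b))).
  + exact: measurable_sinD.
  + by move=> w; exact: norm_sin_le1.
  + exact: L1_of_sqr.
Qed.

(** A centered Gaussian law is determined by its variance. *)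
Lemma gaussian_cos_eq X Y b : centered_gaussian X -> centered_gaussian Y ->
  \int[P]_w X w ^+ 2 = \int[P]_w Y w ^+ 2 ->
  \int[P]_w cos (X w + b) = \int[P]_w cos (Y w + b).
Proof.
move=> gX gY XY; have [mX _ _ _] := gX; have [mY _ _ _] := gY.
have mc (Z : Om -> R) : measurable_fun setT Z -> {ae P, forall w, Z w = 0} ->
    \int[P]_w cos (Z w + b) = cos b.
  move=> mZ Z0; rewrite -[RHS]Rintegral_prob_cst; apply: ae_eq_Rintegral => //.
    exact: measurable_cosD.
  by apply: filterS Z0 => w ->; rewrite add0r.
have := centered_gaussian_cases gX => -[[X0 EX]|[s [s0 EX lawX]]];
have := centered_gaussian_cases gY => -[[Y0 EY]|[t [t0 EY lawY]]].
- by rewrite !mc.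
- by move: XY; rewrite EX EY => /esym/eqP; rewrite expf_eq0/= (negbTE t0).
- by move: XY; rewrite EX EY => /eqP; rewrite expf_eq0/= (negbTE s0).
have st : s ^+ 2 = t ^+ 2 by rewrite -EX -EY.
have mcos : measurable_fun setT (fun x : R => cos (x + b)).
  by apply: (measurableT_comp measurable_cos); exact: measurable_funD.
have L1c (Z : Om -> R) : measurable_fun setT Z -> L1 P (fun w => cos (Z w + b)).
  by move=> mZ; apply: (@L1_bounded _ 1) => [|w]; [exact: measurable_cosD|exact: norm_cos_le1].
have [_ ->] := @expectation_normal _ _ _ P (mfun_Sub (mem_set mX)) 0 s lawX _ mcos (L1c _ mX).
have [_ ->] := @expectation_normal _ _ _ P (mfun_Sub (mem_set mY)) 0 t lawY _ mcos (L1c _ mY).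
by apply: eq_Rintegral => x _; rewrite !normal_pdfE// /normal_peak /normal_fun st.
Qed.

End centered_gaussian.

Section difference_quotients.
Context {R : realType}.

Lemma sin_lipschitz (x y : R) : `|sin x - sin y| <= `|x - y|.
Proof.
wlog yx : x y / y < x.
  move=> H; have [xy|yx|->] := ltgtP x y; last by rewrite !subrr.
    by rewrite distrC [leRHS]distrC; exact: H.
  exact: H.
have [c _ ->] := @MVT R sin cos y x yx (fun x _ => is_derive_sin x)
  (continuous_subspaceT (@continuous_sin R)).
by rewrite normrM ler_piMl// norm_cos_le1.
Qed.

Lemma cos_lipschitz (x y : R) : `|cos x - cos y| <= `|x - y|.
Proof.
by rewrite -!sinDpihalf (le_trans (sin_lipschitz _ _))// opprD addrACA subrr addr0.
Qed.

Lemma cvg_difference_quotient (F : R -> R) (x y l : R) : is_derive x 1 F l ->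
  n.+1%:R * (F (x + y / n.+1%:R) - F x) @[n --> \oo] --> l * y.
Proof.
move=> dF; have [->|y0] := eqVneq y 0.
  rewrite mulr0; under eq_cvg do rewrite mul0r addr0 subrr mulr0.
  exact: cvg_cst.
have cv : h^-1 *: ((F \o shift x) (h *: 1) - F x) @[h --> 0^'] --> l.
  by rewrite -(@derive_val _ _ _ _ _ _ _ dF); exact: ex_derive.
have cu : (y / n.+1%:R : R) @[n --> \oo] --> 0^'.
  have cu0 : (y / n.+1%:R : R) @[n --> \oo] --> (0 : R).
    suff : y * harmonic n @[n --> \oo] --> y * 0 by rewrite mulr0.
    by apply: cvgM; [exact: cvg_cst|exact: cvg_harmonic].
  move=> A A0.
  have h : \forall n \near \oo, (y / n.+1%:R : R) != 0 -> A (y / n.+1%:R) := cu0 _ A0.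
  suff : \forall n \near \oo, A (y / n.+1%:R) by [].
  by apply: filterS h => n; apply; rewrite mulf_neq0// invr_eq0.
have e n : n.+1%:R * (F (x + y / n.+1%:R) - F x) =
    (y / n.+1%:R)^-1 *: ((F \o shift x) ((y / n.+1%:R) *: 1) - F x) * y.
  rewrite /GRing.scale/= mulr1 [y / _ + x]addrC; field.
  by rewrite y0 addrC natr1 pnatr_eq0.
under eq_cvg do rewrite e.
exact: (cvgM (cvg_comp _ _ cu cv) (cvg_cst y)).
Qed.
End difference_quotients.

Section gaussian_space.
Context {d : measure_display} {Om : measurableType d} {R : realType}.
Variable P : probability Om R.

Lemma cvg_expectation_difference_quotient (F F' : R -> R) (X Y Z : Om -> R) :
  (forall x : R, is_derive x 1 F (F' x)) ->
  (forall x y, `|F x - F y| <= `|x - y|) ->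
  measurable_fun setT X -> measurable_fun setT Y -> measurable_fun setT Z ->
  L1 P (fun w => Y w * Z w) ->
  \int[P]_w (n.+1%:R * (F (X w + Y w / n.+1%:R) - F (X w)) * Z w) @[n --> \oo]
  --> \int[P]_w (F' (X w) * (Y w * Z w)).
Proof.
move=> dF lipF mX mY mZ iYZ.
have mF : measurable_fun setT F.
  apply: continuous_measurable_fun => x.
  by apply: differentiable_continuous; apply/derivable1_diffP; exact: ex_derive.
have [||||_] := @dominated_cvg_Rintegral _ _ _ P
   (fun n w => n.+1%:R * (F (X w + Y w / n.+1%:R) - F (X w)) * Z w)
   (fun w => F' (X w) * (Y w * Z w)) (fun w => `|Y w * Z w|).
- move=> n; apply: measurable_funM => //; apply: measurable_funM => //.
  apply: measurable_funB; apply: (measurableT_comp mF) => //.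
  by apply: measurable_funD => //; apply: measurable_funM.
- move=> w; rewrite mulrA; apply: cvgM; last exact: cvg_cst.
  exact: cvg_difference_quotient.
- exact: L1_norm.
- move=> n w; rewrite !normrM ler_wpM2r// [`|_%:R|]ger0_norm//.
  apply: (@le_trans _ _ (n.+1%:R * `|Y w / n.+1%:R|)).
    by rewrite ler_wpM2l// (le_trans (lipF _ _))// addrC addKr.
  by rewrite normrM [`|_^-1|]ger0_norm// mulrCA divff ?mulr1.
by [].
Qed.

Variable G : set (Om -> R).
Hypothesis G_gauss : forall X, G X -> centered_gaussian P X.
Hypothesis G_lin : forall a X Y, G X -> G Y -> G (fun w => a * X w + Y w).

Let G_meas X : G X -> measurable_fun setT X.
Proof. by move=> /G_gauss[]. Qed.

Let G_sqr X : G X -> L1 P (fun w => X w ^+ 2).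
Proof. by move=> /G_gauss[]. Qed.

Let G_L1 X : G X -> L1 P X.
Proof. by move=> GX; apply: L1_of_sqr; [exact: G_meas|exact: G_sqr]. Qed.

Let G_mul X Y : G X -> G Y -> L1 P (fun w => X w * Y w).
Proof. by move=> GX GY; apply: L1_mul_sqr; (exact: G_meas || exact: G_sqr). Qed.

Lemma expectation_mulDl a X Y Z : G X -> G Y -> G Z ->
  \int[P]_w ((a * X w + Y w) * Z w) =
  a * \int[P]_w (X w * Z w) + \int[P]_w (Y w * Z w).
Proof.
move=> GX GY GZ; under eq_Rintegral do rewrite mulrDl -mulrA.
rewrite RintegralD//; [|exact: L1Z (G_mul GX GZ)|exact: G_mul].
by rewrite RintegralZl//; exact: G_mul.
Qed.

Lemma L1_cosD X b : G X -> L1 P (fun w => cos (X w + b)).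
Proof.
move=> GX; apply: (@L1_bounded _ _ _ _ _ 1) => [|w]; last exact: norm_cos_le1.
by apply: measurable_cosD; exact: G_meas.
Qed.

(** When [X] and [Y] are uncorrelated, [X + u Y] and [X - u Y] have the same
variance, hence the same law; so the derivative of [E cos (X + u Y + b)] at
[u = 0], which is [- E (sin (X + b) Y)], is equal to its opposite. *)
Lemma expectation_sin_uncorrelated X Y b : G X -> G Y ->
  \int[P]_w (X w * Y w) = 0 -> \int[P]_w (sin (X w + b) * Y w) = 0.
Proof.
move=> GX GY XY0; have mX := G_meas GX; have mY := G_meas GY.
have YX0 : \int[P]_w (Y w * X w) = 0.
  by rewrite -[RHS]XY0; apply: eq_Rintegral => w _; rewrite mulrC.
have Gp n : G (fun w => n.+1%:R^-1 * Y w + X w) by exact: G_lin.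
have Gm n : G (fun w => - n.+1%:R^-1 * Y w + X w) by exact: G_lin.
have sq a : \int[P]_w (a * Y w + X w) ^+ 2 =
            a ^+ 2 * \int[P]_w (Y w * Y w) + \int[P]_w (X w * X w).
  have GaX : G (fun w => a * Y w + X w) by exact: G_lin.
  under eq_Rintegral do rewrite expr2.
  rewrite expectation_mulDl//.
  under eq_Rintegral do rewrite mulrC; rewrite expectation_mulDl//.
  under [X in _ + X]eq_Rintegral do rewrite mulrC; rewrite expectation_mulDl//.
  by rewrite XY0 YX0; ring.
have eqcos n : \int[P]_w cos (n.+1%:R^-1 * Y w + X w + b) =
               \int[P]_w cos (- n.+1%:R^-1 * Y w + X w + b).
  by apply: gaussian_cos_eq; [exact: G_gauss|exact: G_gauss|rewrite !sq sqrrN].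
have mXb : measurable_fun setT (fun w => X w + b) by exact: measurable_funD.
have dcos (x : R) : is_derive x 1 cos (- sin x) by exact: is_derive_cos.
have mY1 : measurable_fun setT (fun w => - Y w) by exact: measurableT_comp.
have c1 := @cvg_expectation_difference_quotient cos (fun x => - sin x)
   (fun w => X w + b) Y (cst 1) dcos (@cos_lipschitz R) mXb mY.
have c2 := @cvg_expectation_difference_quotient cos (fun x => - sin x)
   (fun w => X w + b) (fun w => - Y w) (cst 1) dcos (@cos_lipschitz R) mXb mY1.
have quot n a : G (fun w => a * Y w + X w) ->
    \int[P]_w (n.+1%:R * (cos (a * Y w + X w + b) - cos (X w + b)) * 1) =
    n.+1%:R * (\int[P]_w cos (a * Y w + X w + b) - \int[P]_w cos (X w + b)).
  move=> Ga; under eq_Rintegral do rewrite mulr1.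
  have ia := L1_cosD b Ga; have i0 := L1_cosD b GX.
  by rewrite RintegralZl//; [rewrite RintegralB|exact: L1B ia i0].
have iY1 : L1 P (fun w => Y w * 1).
  by have := G_L1 GY; congr L1; apply/funext => w; rewrite mulr1.
have iNY1 : L1 P (fun w => - Y w * 1).
  by have := L1N (G_L1 GY); congr L1; apply/funext => w; rewrite mulr1.
have {}c1 : n.+1%:R * (\int[P]_w cos (n.+1%:R^-1 * Y w + X w + b) - \int[P]_w cos (X w + b))
    @[n --> \oo] --> \int[P]_w (- sin (X w + b) * (Y w * 1)).
  have e n : n.+1%:R * (\int[P]_w cos (n.+1%:R^-1 * Y w + X w + b) - \int[P]_w cos (X w + b))
     = \int[P]_w (n.+1%:R * (cos (X w + b + Y w / n.+1%:R) - cos (X w + b)) * 1).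
    rewrite -quot//; apply: eq_Rintegral => w _.
    by congr (_ * (cos _ - _) * _); ring.
  under eq_cvg do rewrite e.
  exact: c1 (measurable_cst _) iY1.
have {}c2 : n.+1%:R * (\int[P]_w cos (- n.+1%:R^-1 * Y w + X w + b) - \int[P]_w cos (X w + b))
    @[n --> \oo] --> \int[P]_w (- sin (X w + b) * (- Y w * 1)).
  have e n : n.+1%:R * (\int[P]_w cos (- n.+1%:R^-1 * Y w + X w + b) - \int[P]_w cos (X w + b))
     = \int[P]_w (n.+1%:R * (cos (X w + b + - Y w / n.+1%:R) - cos (X w + b)) * 1).
    rewrite -quot//; apply: eq_Rintegral => w _.
    by congr (_ * (cos _ - _) * _); ring.
  under eq_cvg do rewrite e.
  exact: c2 (measurable_cst _) iNY1.
have {}c2 : n.+1%:R * (\int[P]_w cos (n.+1%:R^-1 * Y w + X w + b) - \int[P]_w cos (X w + b))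
    @[n --> \oo] --> \int[P]_w (- sin (X w + b) * (- Y w * 1)).
  by under eq_cvg do rewrite eqcos.
have e : \int[P]_w (- sin (X w + b) * (Y w * 1)) =
         \int[P]_w (- sin (X w + b) * (- Y w * 1)).
  exact: (cvg_unique _ c1 c2).
have isY : L1 P (fun w => sin (X w + b) * Y w).
  apply: (@L1M_bounded _ _ _ P 1); [exact: measurable_sinD| |exact: G_L1].
  by move=> w; exact: norm_sin_le1.
have -> : \int[P]_w (sin (X w + b) * Y w) = \int[P]_w (- sin (X w + b) * (- Y w * 1)).
  by apply: eq_Rintegral => w _; rewrite mulr1 mulrNN.
have : \int[P]_w (- sin (X w + b) * (- Y w * 1)) = \int[P]_w (-1 * (- sin (X w + b) * (Y w * 1))).
  by apply: eq_Rintegral => w _; ring.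
rewrite RintegralZl//; first by rewrite e; lra.
have := L1N isY; congr L1; apply/funext => w; ring.
Qed.

(** Subtracting from [Y] its regression on [X] leaves a variable uncorrelated with
[X], and Stein's identity handles the multiple of [X]. *)
Lemma expectation_sin_gaussian X Y b : G X -> G Y ->
  \int[P]_w (sin (X w + b) * Y w) =
  \int[P]_w (X w * Y w) * \int[P]_w cos (X w + b).
Proof.
move=> GX GY; have gX := G_gauss GX.
have isX (Z : Om -> R) : G Z -> L1 P (fun w => sin (X w + b) * Z w).
  move=> GZ; apply: (@L1M_bounded _ _ _ P 1); [|by move=> w; exact: norm_sin_le1|exact: G_L1].
  by apply: measurable_sinD; exact: G_meas.
have := centered_gaussian_cases gX => -[[X0 EX]|[s [s0 EX _]]].
  have -> : \int[P]_w (X w * Y w) = 0.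
    rewrite -[RHS](Rintegral_prob_cst P 0); apply: ae_eq_Rintegral => //.
      by apply: measurable_funM; exact: G_meas.
    by apply: filterS X0 => w ->; rewrite mul0r.
  rewrite mul0r expectation_sin_uncorrelated//.
  rewrite -[RHS](Rintegral_prob_cst P 0); apply: ae_eq_Rintegral => //.
    by apply: measurable_funM; exact: G_meas.
  by apply: filterS X0 => w ->; rewrite mul0r.
pose r := \int[P]_w (X w * Y w) / s ^+ 2.
have GZ : G (fun w => - r * X w + Y w) by exact: G_lin.
have := expectation_sin_uncorrelated b GX GZ.
have -> : \int[P]_w (X w * (- r * X w + Y w)) = 0.
  under eq_Rintegral do rewrite mulrC; rewrite expectation_mulDl//.
  under eq_Rintegral do rewrite -expr2.
  under [X in _ + X]eq_Rintegral do rewrite mulrC.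
  by rewrite EX mulNr /r divfK ?expf_neq0// addNr.
move=> /(_ erefl).
under eq_Rintegral do rewrite mulrDr mulrCA.
rewrite RintegralD//; [|exact: L1Z (isX _ GX)|exact: isX].
rewrite RintegralZl//; last exact: isX.
rewrite gaussian_stein_sin// EX => /eqP; rewrite addrC addr_eq0 => /eqP ->.
by rewrite mulNr opprK mulrA /r divfK ?expf_neq0.
Qed.

Lemma expectation_cos_uncorrelated X Y b : G X -> G Y ->
  \int[P]_w (X w * Y w) = 0 -> \int[P]_w (cos (X w + b) * Y w) = 0.
Proof.
move=> GX GY XY; rewrite -[RHS](@expectation_sin_uncorrelated X Y (b + pi / 2))//.
by apply: eq_Rintegral => w _; rewrite addrA sinDpihalf.
Qed.

(** This is the derivative at [u = 0] of the identity
[E (sin (X + u Y + b) Z) = E ((X + u Y) Z) E cos (X + u Y + b)], in which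
[E ((X + u Y) Z) = u E (Y Z)]. *)
Lemma expectation_cos_product X Y Z b : G X -> G Y -> G Z ->
  \int[P]_w (X w * Y w) = 0 -> \int[P]_w (X w * Z w) = 0 ->
  \int[P]_w (cos (X w + b) * (Y w * Z w)) =
  \int[P]_w (Y w * Z w) * \int[P]_w cos (X w + b).
Proof.
move=> GX GY GZ XY XZ.
have mX := G_meas GX; have mY := G_meas GY; have mZ := G_meas GZ.
have mXb : measurable_fun setT (fun w => X w + b) by exact: measurable_funD.
have dsin (x : R) : is_derive x 1 sin (cos x) by exact: is_derive_sin.
have Gn n : G (fun w => n.+1%:R^-1 * Y w + X w) by exact: G_lin.
have isX (V : Om -> R) : G V -> L1 P (fun w => sin (V w + b) * Z w).
  move=> GV; apply: (@L1M_bounded _ _ _ P 1); [|by move=> w; exact: norm_sin_le1|exact: G_L1].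
  by apply: measurable_sinD; exact: G_meas.
have c := cvg_expectation_difference_quotient dsin (@sin_lipschitz R) mXb mY mZ (G_mul GY GZ).
have quot n : \int[P]_w (n.+1%:R * (sin (X w + b + Y w / n.+1%:R) - sin (X w + b)) * Z w) =
    \int[P]_w (Y w * Z w) * \int[P]_w cos (n.+1%:R^-1 * Y w + X w + b).
  transitivity (\int[P]_w (n.+1%:R * (sin (n.+1%:R^-1 * Y w + X w + b) * Z w - sin (X w + b) * Z w))).
    apply: eq_Rintegral => w _; rewrite -mulrA mulrBl; congr (_ * (sin _ * _ - _)); ring.
  rewrite RintegralZl//; last exact: L1B (isX _ (Gn n)) (isX _ GX).
  rewrite RintegralB//; [|exact: isX|exact: isX].
  rewrite expectation_sin_uncorrelated// subr0 expectation_sin_gaussian//.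
  by rewrite expectation_mulDl// XZ addr0; field; rewrite addrC natr1 pnatr_eq0.
have {}c : \int[P]_w (Y w * Z w) * \int[P]_w cos (n.+1%:R^-1 * Y w + X w + b)
    @[n --> \oo] --> \int[P]_w (cos (X w + b) * (Y w * Z w)).
  by under eq_cvg do rewrite -quot.
suff c' : \int[P]_w (Y w * Z w) * \int[P]_w cos (n.+1%:R^-1 * Y w + X w + b)
    @[n --> \oo] --> \int[P]_w (Y w * Z w) * \int[P]_w cos (X w + b).
  exact: (cvg_unique _ c c').
apply: cvgM; first exact: cvg_cst.
have [||||_] := @dominated_cvg_Rintegral _ _ _ P
   (fun n w => cos (n.+1%:R^-1 * Y w + X w + b)) (fun w => cos (X w + b)) (fun=> 1).
- by move=> n; apply: measurable_cosD; exact: G_meas (Gn n).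
- move=> w; apply: continuous_cvg; first exact: continuous_cos.
  suff : (harmonic n * Y w + X w + b) @[n --> \oo] --> 0 * Y w + X w + b by rewrite mul0r add0r.
  apply: cvgD; last exact: cvg_cst.
  apply: cvgD; last exact: cvg_cst.
  by apply: cvgM; [exact: cvg_harmonic|exact: cvg_cst].
- exact: L1_cst.
- by move=> n w; exact: norm_cos_le1.
by [].
Qed.

End gaussian_space.

(** * Orthogonality of noise increments to the past *)

Section noise.
Context {R : realType} {d : measure_display} {Om : measurableType d}.
Variable P : probability Om R.
Variables (H : R) (W : R -> R -> {RV P >-> R}).
Hypothesis W_noise : fractional_noise H W.

Definition noise_span (D : set R) : set (Om -> R) :=
  [set X | exists n (a t x : 'I_n -> R), (forall i, D (t i)) /\
     X = fun w => \sum_(i < n) a i * W (t i) (x i) w].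

Lemma noise_span_lin D c X Y : noise_span D X -> noise_span D Y ->
  noise_span D (fun w => c * X w + Y w).
Proof.
move=> [n [a [t [x [Dt ->]]]]] [m [b [s [y [Ds ->]]]]].
pose glue (f : 'I_n -> R) (g : 'I_m -> R) (i : 'I_(n + m)) :=
  match fintype.split i with inl j => f j | inr j => g j end.
exists (n + m)%N, (glue (fun i => c * a i) b), (glue t s), (glue x y); split.
  by move=> i; rewrite /glue; case: (fintype.split i).
apply/funext => w; rewrite big_split_ord/= mulr_sumr; congr (_ + _).
  by apply: eq_bigr => i _; rewrite /glue (unsplitK (inl i)) mulrA.
by apply: eq_bigr => i _; rewrite /glue (unsplitK (inr i)).
Qed.

Lemma noise_span1 (D : set R) t x : D t -> noise_span D (W t x).
Proof.
move=> Dt; exists 1%N, (fun=> 1), (fun=> t), (fun=> x); split => //.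
by apply/funext => w; rewrite big_ord1 mul1r.
Qed.

Lemma noise_span_sub (D D' : set R) : D `<=` D' -> noise_span D `<=` noise_span D'.
Proof.
by move=> DD' X [n [a [t [x [Dt ->]]]]]; exists n, a, t, x; split => // i; exact: DD'.
Qed.

Lemma noise_spanB (D : set R) X Y : noise_span D X -> noise_span D Y ->
  noise_span D (fun w => X w - Y w).
Proof.
move=> DX DY; have := noise_span_lin (-1) DY DX.
by congr noise_span; apply/funext => w; rewrite mulN1r addrC.
Qed.

Definition noise_cov (t s x y : R) : R :=
  2^-1 * Num.min s t *
  (`|x| `^ (2 * H) + `|y| `^ (2 * H) - `|x - y| `^ (2 * H)).

Lemma noise_sqr t x : 0 <= t -> L1 P (fun w => W t x w ^+ 2).
Proof.
move=> t0; apply/integrableP; split.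
  by apply/measurable_EFinP; exact: measurable_funX.
have [_ _ /(_ t x t x t0 t0)] := W_noise; rewrite unlock => e.
under eq_integral do rewrite /= ger0_norm ?sqr_ge0// expr2.
by rewrite e ltry.
Qed.

Lemma noise_mul t x s y : 0 <= t -> 0 <= s ->
  L1 P (fun w => W t x w * W s y w).
Proof. by move=> t0 s0; apply: L1_mul_sqr => //; exact: noise_sqr. Qed.

Lemma expectation_noise t x : 0 <= t -> \int[P]_w W t x w = 0.
Proof.
by move=> t0; have [_ + _] := W_noise => /(_ t x t0); rewrite unlock /Rintegral => ->.
Qed.

Lemma expectation_noise_mul t x s y : 0 <= t -> 0 <= s ->
  \int[P]_w (W t x w * W s y w) = noise_cov t s x y.
Proof.
move=> t0 s0; have [_ _ /(_ t x s y t0 s0)] := W_noise.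
by rewrite unlock /Rintegral => ->.
Qed.

Lemma noise_centered_gaussian X :
  noise_span [set t | 0 <= t] X -> centered_gaussian P X.
Proof.
move=> GX; have [n [a [t [x [t0 XE]]]]] := GX.
have iW i : L1 P (fun w => a i * W (t i) (x i) w).
  by apply: L1Z; apply: L1_of_sqr => //; apply: noise_sqr; exact: t0.
have mX : measurable_fun setT X.
  rewrite XE; apply: measurable_sum => i; apply: measurable_funM => //.
split => //.
- rewrite XE /=; under eq_fun do rewrite expr2 mulr_suml.
  apply: L1_sum => i; under eq_fun do rewrite mulr_sumr.
  apply: L1_sum => j.
  have := L1Z (a i * a j) (noise_mul (x i) (x j) (t0 i) (t0 j)).
  by congr L1; apply/funext => w; ring.
- rewrite XE Rintegral_sum// big1// => i _.
  rewrite RintegralZl//; first by rewrite expectation_noise ?mulr0//; exact: t0.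
  by apply: L1_of_sqr => //; apply: noise_sqr; exact: t0.
- by have [g _ _] := W_noise; rewrite XE; exact: g.
Qed.

Definition noise_incr (a b x : R) (w : Om) : R := W b x w - W a x w.

Lemma noise_incr_span a b x : 0 <= a -> a <= b ->
  noise_span [set t | 0 <= t] (noise_incr a b x).
Proof.
move=> a0 ab; apply: noise_spanB; apply: noise_span1 => //=.
exact: le_trans ab.
Qed.

Lemma noise_incr_past a b x X : 0 <= a -> a <= b ->
  noise_span [set t | 0 <= t <= a] X ->
  \int[P]_w (X w * noise_incr a b x w) = 0.
Proof.
move=> a0 ab [n [c [t [y [ta ->]]]]].
have b0 : 0 <= b by exact: le_trans ab.
have t0 i : 0 <= t i by have /andP[] := ta i.
transitivity (\int[P]_w \sum_(i < n) (c i * (W (t i) (y i) w * W b x w) -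
                                      c i * (W (t i) (y i) w * W a x w))).
  apply: eq_Rintegral => w _; rewrite mulr_suml; apply: eq_bigr => i _.
  by rewrite /noise_incr; ring.
have im i u : 0 <= u -> L1 P (fun w => c i * (W (t i) (y i) w * W u x w)).
  by move=> u0; apply: L1Z; exact: noise_mul.
rewrite Rintegral_sum => [|i]; last by apply: L1B; exact: im.
rewrite big1// => i _; rewrite RintegralB//; [|exact: im|exact: im].
rewrite !RintegralZl//; [|exact: noise_mul|exact: noise_mul].
rewrite !expectation_noise_mul// /noise_cov.
have /andP[_ tia] := ta i.
by rewrite !min_r ?subrr// (le_trans tia).
Qed.

Lemma expectation_noise_incr_mul a b x y : 0 <= a -> a <= b ->
  \int[P]_w (noise_incr a b x w * noise_incr a b y w) =
  (b - a) * (2^-1 * (`|x| `^ (2 * H) + `|y| `^ (2 * H) - `|x - y| `^ (2 * H))).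
Proof.
move=> a0 ab; have b0 : 0 <= b by exact: le_trans ab.
transitivity (\int[P]_w ((W b x w * W b y w - W b x w * W a y w) -
                         (W a x w * W b y w - W a x w * W a y w))).
  by apply: eq_Rintegral => w _; rewrite /noise_incr; ring.
have im u v : 0 <= u -> 0 <= v -> L1 P (fun w => W u x w * W v y w).
  by move=> *; exact: noise_mul.
rewrite RintegralB//; [|by apply: L1B; exact: im|by apply: L1B; exact: im].
rewrite !RintegralB//; try exact: im.
rewrite !expectation_noise_mul// /noise_cov.
rewrite !minxx (min_l ab) (min_r ab); ring.
Qed.

Section past.
Variables (a b : R).
Hypotheses (a_ge0 : 0 <= a) (ab : a <= b).
Local Notation past := (noise_span [set t | 0 <= t <= a]).

Let past_all X : past X -> noise_span [set t | 0 <= t] X.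
Proof. by apply: noise_span_sub => t /= /andP[]. Qed.

Let past_meas X : past X -> measurable_fun setT X.
Proof. by move=> /past_all /noise_centered_gaussian[]. Qed.

(** The past sigma-algebra is generated by the variables [W s x] with [s <= a], and
these belong to the linear span whose cosines are considered. *)
Lemma past_multiplier (M : R) (X : Om -> R) : measurable_fun setT X -> (forall w, `|X w| <= M) ->
  measurable_wrt (noise_filtration W a) X -> multiplier P past X.
Proof.
move=> mX XM FX; apply: (multiplier_bounded past_meas mX XM) => B mB.
apply: (multiplier_generated past_meas _ (FX _ mB)).
move=> _ [s [x [B' [sa mB' ->]]]].
apply: (multiplier_preimage _ past_meas (@noise_span_lin _)) => //.
exact: noise_span1.
Qed.

Lemma past0 : past (fun=> 0).
Proof.
exists 0%N, (fun=> 0), (fun=> 0), (fun=> 0); split; first by case.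
by apply/funext => w; rewrite big_ord0.
Qed.

Lemma kills_cos_past (M : R) (X eta : Om -> R) : measurable_fun setT X -> (forall w, `|X w| <= M) ->
  measurable_wrt (noise_filtration W a) X -> kills_cos P past eta ->
  \int[P]_w (X w * eta w) = 0.
Proof.
move=> mX XM FX ke; have [_ _ /(_ _ ke)[_ /(_ _ 0 past0)]] := past_multiplier mX XM FX.
by under eq_Rintegral do rewrite addr0 cos0 mul1r.
Qed.

(** An increment of the noise after time [a] is uncorrelated with the Gaussian span
of the past, hence orthogonal to its cosines, hence to all bounded functions of
the past. *)
Lemma expectation_past_incr (M : R) (X : Om -> R) x : measurable_fun setT X -> (forall w, `|X w| <= M) ->
  measurable_wrt (noise_filtration W a) X ->
  \int[P]_w (X w * noise_incr a b x w) = 0.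
Proof.
move=> mX XM FX; apply: (kills_cos_past mX XM FX).
have Gi := noise_incr_span x a_ge0 ab; have [mi i2 _ _] := noise_centered_gaussian Gi.
split; first exact: L1_of_sqr.
move=> Y c pY.
apply: (expectation_cos_uncorrelated noise_centered_gaussian (@noise_span_lin _)) => //.
  exact: past_all.
exact: noise_incr_past.
Qed.

(** The centered product of two increments is orthogonal to the cosines of the past
by [expectation_cos_product]. *)
Lemma expectation_past_incr_mul (M : R) (X : Om -> R) x y : measurable_fun setT X -> (forall w, `|X w| <= M) ->
  measurable_wrt (noise_filtration W a) X ->
  \int[P]_w (X w * (noise_incr a b x w * noise_incr a b y w)) =
  \int[P]_w (noise_incr a b x w * noise_incr a b y w) * \int[P]_w X w.
Proof.
move=> mX XM FX; set k := (X in _ = X * _).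
have Gx := noise_incr_span x a_ge0 ab; have [mx ix _ _] := noise_centered_gaussian Gx.
have Gy := noise_incr_span y a_ge0 ab; have [my iy _ _] := noise_centered_gaussian Gy.
have ixy := L1_mul_sqr mx my ix iy.
have : \int[P]_w (X w * (noise_incr a b x w * noise_incr a b y w - k)) = 0.
  apply: (kills_cos_past mX XM FX); split; first by apply: L1B => //; exact: L1_cst.
  move=> Y c pY; have GY := past_all pY.
  have mc := measurable_cosD c (past_meas pY).
  have ic : L1 P (fun w => cos (Y w + c)).
    by apply: (@L1_bounded _ _ _ _ _ 1) => // w; exact: norm_cos_le1.
  under eq_Rintegral do rewrite mulrBr.
  rewrite RintegralB//; last 2 first.
  - by apply: (@L1M_bounded _ _ _ P 1) => // w; exact: norm_cos_le1.
  - by have := L1Z k ic; congr L1; apply/funext => w; rewrite mulrC.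
  rewrite RintegralZr//.
  rewrite (expectation_cos_product noise_centered_gaussian (@noise_span_lin _))//.
  - by rewrite -/k mulrC subrr.
  - exact: noise_incr_past.
  - exact: noise_incr_past.
under eq_Rintegral do rewrite mulrBr.
have iX : L1 P X by exact: L1_bounded mX XM.
rewrite RintegralB//; last 2 first.
- exact: L1M_bounded XM ixy.
- by have := L1Z k iX; congr L1; apply/funext => w; rewrite mulrC.
by rewrite RintegralZr// => /eqP; rewrite subr_eq0 => /eqP ->; rewrite mulrC.
Qed.

End past.
End noise.

(** * Integrals of powers *)

Section power_integrals.
Context {R : realType}.
Local Notation mu := (@lebesgue_measure R).

Lemma integral_powR_itv (a b r : R) : 0 < a -> a < b -> r != 0 ->
  (\int[mu]_(y in `[a, b]) (y `^ (r - 1))%:E = ((b `^ r - a `^ r) / r)%:E)%E.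
Proof.
move=> a0 ab r0.
have cpow (s x : R) : 0 < x -> {for x, continuous (fun y : R => y `^ s)}.
  move=> x0; apply: differentiable_continuous; apply/derivable1_diffP.
  by apply: derivable_powR; rewrite in_itv/= x0.
rewrite (@continuous_FTC2 _ _ (fun y => y `^ r / r) a b)//.
- by rewrite -EFinB mulrBl.
- apply: continuous_in_subspaceT => x /[!inE]/=; rewrite in_itv/= => /andP[ax _].
  by apply: cpow; exact: lt_le_trans ax.
- have cF (x : R) : 0 < x -> {for x, continuous (fun y : R => y `^ r / r)}.
    by move=> x0; apply: cvgM; [exact: cpow|exact: cvg_cst].
  split.
  + move=> x; rewrite in_itv/= => /andP[ax _].
    apply: derivableM => //; apply: derivable_powR; rewrite in_itv/= andbT.
    exact: lt_trans ax.
  + by apply: cvg_at_right_filter; exact: cF.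
  + by apply: cvg_at_left_filter; apply: cF; exact: lt_trans ab.
- move=> x; rewrite in_itv/= => /andP[ax _].
  have x0 : 0 < x by exact: lt_trans ax.
  have dx := is_derive1_powR r x0.
  have dF : is_derive x 1 (fun y => y `^ r / r) (x `^ (r - 1)).
    by apply: is_derive_eq; rewrite /GRing.scale/=; field.
  by rewrite derive1E derive_val.
Qed.

Lemma cvg_powR_infty (u : nat -> R) (r : R) : 0 < r -> (forall n, 0 < u n) ->
  (forall M, \forall n \near \oo, M <= u n) -> (u n `^ (- r)) @[n --> \oo] --> 0.
Proof.
move=> r0 u0 uy.
have e n : u n `^ (- r) = (u n)^-1 `^ r.
  by rewrite -powR_inv1 ?(ltW (u0 n))// -powRrM mulN1r.
under eq_cvg do rewrite e.
apply: (cvg_comp _ _ _ (powR_cvg0 r0)).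
move=> A [e0 /= e00 eA].
suff : \forall n \near \oo, A (u n)^-1 by [].
near=> n; apply: eA => /=; last by rewrite invr_gt0.
rewrite sub0r normrN gtr0_norm ?invr_gt0// invf_plt ?posrE//.
apply: (@lt_le_trans _ _ (e0^-1 + 1)); first by rewrite ltrDl.
by near: n; exact: uy.
Unshelve. all: by end_near. Qed.

Lemma measurable_powR_itv (r : R) (D : set R) : measurable_fun D (fun y => (y `^ r)%:E).
Proof. by apply/measurable_EFinP; apply: measurable_funTS; exact: measurable_powR. Qed.

Lemma integral_exhaustion (F : nat -> set R) (f : R -> R) (u : nat -> R) (l : R) :
  (forall n, F n `<=` F n.+1) -> (forall n, measurable (F n)) ->
  measurable_fun setT f -> (forall x, 0 <= f x) ->
  (forall n, (\int[mu]_(y in F n) (f y)%:E = (u n)%:E)%E) ->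
  u n @[n --> \oo] --> l ->
  (\int[mu]_(y in \bigcup_n F n) (f y)%:E = l%:E)%E.
Proof.
move=> ndF mF mf f0 Fu ul.
have cv : (\int[mu]_(y in F n) (f y)%:E)%E @[n --> \oo] -->
          (\int[mu]_(y in \bigcup_n F n) (f y)%:E)%E.
  apply: ge0_nondecreasing_set_cvg_integral => //.
  - by apply/nondecreasing_seqP => n; rewrite subsetEset.
  - by move=> n; apply/measurable_EFinP; exact: measurable_funTS.
  - by move=> n x _; rewrite lee_fin.
suff cv' : (\int[mu]_(y in F n) (f y)%:E)%E @[n --> \oo] --> l%:E.
  exact: (cvg_unique _ cv cv').
under eq_cvg do rewrite Fu.
by apply: cvg_EFin; [exact: nearW|].
Qed.

Lemma integral_powR_0 (b r : R) : 0 < b -> 0 < r ->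
  (\int[mu]_(y in `]0%R, b]) (y `^ (r - 1))%:E = (b `^ r / r)%:E)%E.
Proof.
move=> b0 r0.
have bn0 n : 0 < b / n.+2%:R by rewrite divr_gt0.
have bnb n : b / n.+2%:R < b by rewrite gtr_pMr// invf_lt1// ltr1n.
have -> : `]0%R, b]%classic = \bigcup_n `[b / n.+2%:R, b]%classic.
  apply/seteqP; split => x /=; rewrite in_itv/=.
    move=> /andP[x0 xb]; pose n := Num.truncn (b / x).
    exists n => //=; rewrite in_itv/= xb andbT ler_pdivrMr// mulrC -ler_pdivrMr//.
    have := truncnS_gt (b / x); rewrite -/n => /ltW /le_trans; apply.
    by rewrite ler_nat.
  by move=> [n _] /=; rewrite in_itv/= => /andP[bx ->]; rewrite (lt_le_trans _ bx).
apply: (@integral_exhaustion _ _ (fun n => (b `^ r - (b / n.+2%:R) `^ r) / r)).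
- move=> n x /=; rewrite !in_itv/= => /andP[bx ->]; rewrite andbT (le_trans _ bx)//.
  by rewrite ler_pM2l// lef_pV2 ?posrE// ler_nat.
- by [].
- exact: measurable_powR.
- by move=> x; exact: powR_ge0.
- by move=> n; rewrite integral_powR_itv// gt_eqF.
have e n : (b / n.+2%:R) `^ r = (n.+2%:R / b) `^ (- r).
  have -> : b / n.+2%:R = (n.+2%:R / b) `^ (-1).
    by rewrite powR_inv1 ?divr_ge0 ?(ltW b0)// invf_div.
  by rewrite -powRrM mulN1r.
suff : (b `^ r - (n.+2%:R / b) `^ (- r)) / r @[n --> \oo] --> (b `^ r - 0) / r.
  by rewrite subr0; under eq_cvg do rewrite -e.
apply: cvgM; last exact: cvg_cst.
apply: cvgB; first exact: cvg_cst.
apply: cvg_powR_infty => // [n|M]; first by rewrite divr_gt0.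
near=> n; rewrite ler_pdivlMr//; apply: (@le_trans _ _ n%:R); last by rewrite ler_nat -addn2 leq_addr.
by near: n; exact: nbhs_infty_ger.
Unshelve. all: by end_near. Qed.

Lemma integral_powR_infty (a r : R) : 0 < a -> 0 < r ->
  (\int[mu]_(y in `[a, +oo[) (y `^ (- r - 1))%:E = (a `^ (- r) / r)%:E)%E.
Proof.
move=> a0 r0.
have -> : `[a, +oo[%classic = \bigcup_n `[a, a + n.+1%:R]%classic.
  apply/seteqP; split => x /=; rewrite in_itv/= ?andbT.
    move=> ax; exists (Num.truncn (x - a)) => //=; rewrite in_itv/= ax/= -lerBlDl.
    exact/ltW/truncnS_gt.
  by move=> [n _] /=; rewrite in_itv/= => /andP[].
apply: (@integral_exhaustion _ _ (fun n => (a `^ (- r) - (a + n.+1%:R) `^ (- r)) / r)).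
- move=> n x /=; rewrite !in_itv/= => /andP[-> /le_trans] /=; apply.
  by rewrite lerD2l ler_nat.
- by [].
- exact: measurable_powR.
- by move=> x; exact: powR_ge0.
- move=> n; rewrite integral_powR_itv ?oppr_eq0 ?(gt_eqF r0)// ?ltrDl//.
  by rewrite invrN mulrN -mulNr opprB.
suff : (a `^ (- r) - (a + n.+1%:R) `^ (- r)) / r @[n --> \oo] --> (a `^ (- r) - 0) / r.
  by rewrite subr0.
apply: cvgM; last exact: cvg_cst.
apply: cvgB; first exact: cvg_cst.
apply: cvg_powR_infty => // [n|M]; first by rewrite addr_gt0.
near=> n; rewrite -lerBlDl; apply: (@le_trans _ _ n%:R); last by rewrite ler_nat.
by near: n; exact: nbhs_infty_ger.
Unshelve. all: by end_near. Qed.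

(** This computation fixes the value of the noise constant: splitting the half line
at [k], it gives [k `^ (2 H) / (2 H) + k `^ (2 H) / (1 - 2 H)], and
[1 / (2 H) + 1 / (1 - 2 H) = 1 / (4 H (1/2 - H))]. *)
Lemma integral_min_powR (H k : R) : 0 < H < 2^-1 -> 0 <= k ->
  (\int[mu]_y (Num.min `|y| k * `|y| `^ (2 * H - 2))%:E =
   (k `^ (2 * H) / (2 * noise_const H ^+ 2))%:E)%E.
Proof.
move=> /andP[H0 H2]; rewrite /noise_const sqr_sqrtr; last first.
  by rewrite mulr_ge0// ?subr_ge0 ltW.
rewrite le_eqVlt => /predU1P[<-|k0].
  rewrite powR0 ?mulf_neq0 ?gt_eqF// mul0r integral0_eq// => y _.
  by rewrite min_r// mul0r.
pose f (y : R) : R := Num.min `|y| k * `|y| `^ (2 * H - 2).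
have f0 y : 0 <= f y by rewrite mulr_ge0 ?powR_ge0// le_min normr_ge0 ltW.
have mf : measurable_fun setT f.
  apply: measurable_funM; first by apply: measurable_minr => //; exact: measurableT_comp.
  apply: (measurableT_comp (measurable_powR _)) => //; exact: measurableT_comp.
have mfE D : measurable_fun D (fun y => (f y)%:E).
  by apply/measurable_EFinP; exact: measurable_funTS.
have half : (\int[mu]_(y in `]0%R, +oo[) (f y)%:E = (k `^ (2 * H) / (2 * (H * (2^-1 - H)) * 2))%:E)%E.
  rewrite (@itv_bndbnd_setU _ _ (BRight 0) (BRight k) +oo%O)//; last by rewrite bnd_simp ltW.
  rewrite ge0_integral_setU//=; last 3 first.
  - exact: mfE.
  - by move=> x _; rewrite lee_fin.
  - apply/disj_setPS => x [] /=; rewrite !in_itv/= andbT => /andP[_ xk] kx.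
    by move: (le_lt_trans xk kx); rewrite ltxx.
  have -> : (\int[mu]_(y in `]0%R, k]) (f y)%:E = (k `^ (2 * H) / (2 * H))%:E)%E.
    rewrite -integral_powR_0// ?mulr_gt0//; apply: eq_integral => y.
    rewrite inE/= in_itv/= => /andP[y0 yk]; congr EFin.
    rewrite /f gtr0_norm// min_l// -[X in X * _]powRr1 ?(ltW y0)// -powRD ?(gt_eqF y0) ?implybT//.
    by congr (_ `^ _); ring.
  have -> : (\int[mu]_(y in `]k, +oo[) (f y)%:E = (k * (k `^ (- (1 - 2 * H)) / (1 - 2 * H)))%:E)%E.
    rewrite EFinM -integral_powR_infty//; last lra.
    rewrite integral_itv_obnd_cbnd; last exact: mfE.
    rewrite -ge0_integralZl//; last 3 first.
    - exact: measurable_powR_itv.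
    - by move=> y _; rewrite lee_fin powR_ge0.
    - by rewrite lee_fin ltW.
    apply: eq_integral => y; rewrite inE/= in_itv/= andbT => ky; rewrite -EFinM; congr EFin.
    have y0 : 0 < y by exact: lt_le_trans ky.
    by rewrite /f gtr0_norm// min_r//; congr (_ * _ `^ _); ring.
  rewrite -EFinD mulrA -[X in _ + X * _ / _]powRr1 ?(ltW k0)// -powRD ?(gt_eqF k0) ?implybT//.
  have -> : 1 - (1 - 2 * H) = 2 * H by ring.
  by congr EFin; field; rewrite !lt0r_neq0//; lra.
transitivity (\int[mu]_(y in `]-oo, +oo[) (f y)%:E)%E; first by rewrite set_itvE.
rewrite (@itv_bndbnd_setU _ _ -oo%O (BRight 0) +oo%O)//.
rewrite ge0_integral_setU//=; last 3 first.
- exact: mfE.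
- by move=> x _; rewrite lee_fin.
- apply/disj_setPS => x [] /=; rewrite !in_itv/= andbT => x0 /lt_le_trans /(_ x0).
  by rewrite ltxx.
have -> : (\int[mu]_(y in `]-oo, 0%R]) (f y)%:E = \int[mu]_(y in `]0%R, +oo[) (f y)%:E)%E.
  rewrite integral_itv_obnd_cbnd; last exact: mfE.
  rewrite ge0_integration_by_substitution0//.
  by apply: eq_integral => y _; rewrite /f normrN.
by rewrite half -EFinD; congr EFin; field; rewrite !lt0r_neq0//; lra.
Qed.

End power_integrals.

(** * Fractional norm of step functions *)

Section spatial_gram.
Context {R : realType}.
Local Notation mu := (@lebesgue_measure R).

(** Increment by [y] of the indicator function of the ray []-oo, e]]. The rays
themselves are not square integrable, their increments are. *)
Definition ray_shift (e y u : R) : R := (u + y <= e)%R%:R - (u <= e)%R%:R.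

(** Both factors are indicator functions, up to the common sign of [- y], of
intervals of length [|y|] ending or starting at [e] and [e']. *)
Lemma ray_shift_mul (e e' y u : R) :
  ray_shift e y u * ray_shift e' y u =
  \1_(`]Num.max e e' - Num.max y 0, Num.min e e' + Num.max (- y) 0] : set R) u.
Proof.
rewrite indicE mem_setE in_itv/= /ray_shift.
have [y0|] := boolP (0 <= y).
  have y0' : - y <= 0 by rewrite oppr_le0.
  rewrite (max_l y0) (max_r y0') addr0 ltrBlDr gt_max le_min.
  rewrite !ltNge.
  case: (leP (u + y) e) => h1; case: (leP u e) => h2;
  case: (leP (u + y) e') => h3; case: (leP u e') => h4; rewrite /=; try lra.
rewrite -ltNge => y0; have y0' : 0 <= - y by rewrite oppr_ge0 ltW.
rewrite (max_r (ltW y0)) (max_l y0') subr0 gt_max.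
rewrite -lerBlDr opprK le_min !ltNge.
case: (leP (u + y) e) => h1; case: (leP u e) => h2;
case: (leP (u + y) e') => h3; case: (leP u e') => h4; rewrite /=; lra.
Qed.

Lemma integral_ray_shift_mul (e e' y : R) :
  L1 mu (fun u => ray_shift e y u * ray_shift e' y u) /\
  \int[mu]_u (ray_shift e y u * ray_shift e' y u) =
    `|y| - Num.min `|y| `|e - e'|.
Proof.
set I := `]Num.max e e' - Num.max y 0, Num.min e e' + Num.max (- y) 0].
have E : (fun u => ray_shift e y u * ray_shift e' y u) = \1_([set` I] : set R).
  by apply/funext => u; rewrite ray_shift_mul.
rewrite E; split; first exact: integrable_indic_itv.
rewrite /Rintegral integral_indic//= setIT lebesgue_measure_itv/= lte_fin.
have -> : `|y| = Num.max y 0 + Num.max (- y) 0.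
  by case: (leP 0 y) => y0; [rewrite ger0_norm// max_r|rewrite ltr0_norm// max_l]; lra.
have -> : `|e - e'| = Num.max e e' - Num.min e e'.
  by case: (leP e e') => ee; [rewrite ler0_norm|rewrite gtr0_norm]; lra.
move: (Num.max e e') (Num.min e e') (Num.max y 0) (Num.max (- y) 0) => M m p q.
case: ltP => h /=; case: leP => /= h'; lra.
Qed.

Variable H : R.
Hypothesis H_range : 0 < H < 2^-1.

(** Covariance of the increments over [c, d] and [c', d'] of a fractional Brownian
motion of Hurst parameter [H]. *)
Definition rect_cov (c c' d d' : R) : R :=
  2^-1 * (`|d - c'| `^ (2 * H) + `|c - d'| `^ (2 * H)
          - `|d - d'| `^ (2 * H) - `|c - c'| `^ (2 * H)).

Section family.
Variables (I : finType) (c d z : I -> R).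
Hypothesis cd : forall i, c i <= d i.

Let f (u : R) := \sum_i z i * \1_(`]c i, d i] : set R) u.

Let D i (y u : R) := ray_shift (d i) y u - ray_shift (c i) y u.

Let fD y u : f (u + y) - f u = \sum_i z i * D i y u.
Proof.
rewrite /f -sumrB; apply: eq_bigr => i _; rewrite -mulrBr /D; congr (_ * _).
rewrite !indicE !mem_setE !in_itv/= /ray_shift !ltNge.
have := cd i; case: (leP (u + y) (d i)) => h1; case: (leP (u + y) (c i)) => h2;
case: (leP u (d i)) => h3; case: (leP u (c i)) => h4; rewrite /=; lra.
Qed.

Let rho i j (y : R) : R :=
  Num.min `|y| `|d i - c j| + Num.min `|y| `|c i - d j|
  - Num.min `|y| `|d i - d j| - Num.min `|y| `|c i - c j|.

Let integral_D i j y : L1 mu (fun u => D i y u * D j y u) /\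
  \int[mu]_u (D i y u * D j y u) = rho i j y.
Proof.
have [dd dd'] := integral_ray_shift_mul (d i) (d j) y.
have [dc dc'] := integral_ray_shift_mul (d i) (c j) y.
have [cd1 cd'] := integral_ray_shift_mul (c i) (d j) y.
have [cc cc'] := integral_ray_shift_mul (c i) (c j) y.
have E : (fun u => D i y u * D j y u) = (fun u =>
   (ray_shift (d i) y u * ray_shift (d j) y u - ray_shift (d i) y u * ray_shift (c j) y u) -
   (ray_shift (c i) y u * ray_shift (d j) y u - ray_shift (c i) y u * ray_shift (c j) y u)).
  by apply/funext => u; rewrite /D; ring.
rewrite E; split; first by apply: L1B; exact: L1B.
rewrite RintegralB//; [|exact: L1B dd dc|exact: L1B cd1 cc].
by rewrite !RintegralB// dd' dc' cd' cc' /rho; ring.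
Qed.

Let square_integral y : L1 mu (fun u => (f (u + y) - f u) ^+ 2) /\
  \int[mu]_u ((f (u + y) - f u) ^+ 2) = \sum_i \sum_j z i * z j * rho i j y.
Proof.
have E : (fun u => (f (u + y) - f u) ^+ 2) =
         (fun u => \sum_i \sum_j z i * z j * (D i y u * D j y u)).
  apply/funext => u; rewrite fD expr2 mulr_suml; apply: eq_bigr => i _.
  by rewrite mulr_sumr; apply: eq_bigr => j _; ring.
have iD i j : L1 mu (fun u => z i * z j * (D i y u * D j y u)).
  by apply: L1Z; have [] := integral_D i j y.
rewrite E; split; first by apply: L1_sum => i; exact: L1_sum.
rewrite Rintegral_sum => [|i]; last exact: L1_sum.
apply: eq_bigr => i _; rewrite Rintegral_sum//; apply: eq_bigr => j _.
by have [iDD DD] := integral_D i j y; rewrite RintegralZl// DD.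
Qed.

Let kernel_integral (k : R) : 0 <= k ->
  L1 mu (fun y => Num.min `|y| k * `|y| `^ (2 * H - 2)) /\
  \int[mu]_y (Num.min `|y| k * `|y| `^ (2 * H - 2)) =
     k `^ (2 * H) / (2 * noise_const H ^+ 2).
Proof.
move=> k0; have E := integral_min_powR H_range k0.
split; last by rewrite /Rintegral E.
apply/integrableP; split.
  apply/measurable_EFinP; apply: measurable_funM.
    by apply: measurable_minr => //; exact: measurableT_comp.
  by apply: (measurableT_comp (measurable_powR _)) => //; exact: measurableT_comp.
under eq_integral.
  move=> y _; rewrite /= ger0_norm; last first.
    by rewrite mulr_ge0 ?powR_ge0// le_min normr_ge0.
  over.
by rewrite E ltry.
Qed.

(** Writing each interval as a difference of rays, the integral in [u] of the
product of two increments is a combination of terms [|y| - min (|y|, |e - e'|)],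
in which the divergent part [|y|] cancels; integrating the remaining minima
against the kernel gives powers of the distances between end points. *)
Lemma spatial_gram_step_function :
  (\int[mu]_u \int[mu]_y ((f (u + y) - f u) ^+ 2 * `|y| `^ (2 * H - 2))%:E =
  ((noise_const H ^+ 2)^-1 * \sum_i \sum_j z i * z j * rect_cov (c i) (c j) (d i) (d j))%:E)%E.
Proof.
have mf : measurable_fun setT f.
  apply: measurable_sum => i; apply: measurable_funM => //; exact: measurable_indic.
pose F (p : R * R) := ((f (p.1 + p.2) - f p.1) ^+ 2 * `|p.2| `^ (2 * H - 2))%:E.
have mF : measurable_fun [set: measurableTypeR R * measurableTypeR R] F.
  apply/measurable_EFinP; apply: measurable_funM.
    apply: measurable_funX; apply: measurable_funB; apply: (measurableT_comp mf) => //.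
    exact: measurable_funD.
  by apply: (measurableT_comp (measurable_powR _)) => //; exact: measurableT_comp.
have F0 p : (0 <= F p)%E by rewrite lee_fin mulr_ge0 ?sqr_ge0 ?powR_ge0.
rewrite [LHS](@fubini_tonelli _ _ _ _ _ mu mu F mF F0).
transitivity (\int[mu]_y (\sum_i \sum_j z i * z j * (rho i j y * `|y| `^ (2 * H - 2)))%:E)%E.
  apply: eq_integral => y _; rewrite /F /=.
  have [iS S] := square_integral y.
  under eq_integral do rewrite EFinM.
  rewrite integralZr//.
  rewrite -[X in (X * _)%E]fineK; last exact: integrable_fin_num.
  rewrite [fine _]S -EFinM mulr_suml; congr EFin; apply: eq_bigr => i _.
  by rewrite mulr_suml; apply: eq_bigr => j _; rewrite mulrA.
pose K (k y : R) := Num.min `|y| k * `|y| `^ (2 * H - 2).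
have rK i j y : rho i j y * `|y| `^ (2 * H - 2) =
   K `|d i - c j| y + K `|c i - d j| y - K `|d i - d j| y - K `|c i - c j| y.
  by rewrite /rho /K; ring.
have iK k : 0 <= k -> L1 mu (K k) by move=> /kernel_integral[].
have irho i j : L1 mu (fun y => rho i j y * `|y| `^ (2 * H - 2)).
  under eq_fun do rewrite rK.
  by apply: L1B; [apply: L1B; [apply: L1D|]|]; exact: iK.
have Erho i j : \int[mu]_y (rho i j y * `|y| `^ (2 * H - 2)) =
    (noise_const H ^+ 2)^-1 * rect_cov (c i) (c j) (d i) (d j).
  have i1 := iK _ (normr_ge0 (d i - c j)); have i2 := iK _ (normr_ge0 (c i - d j)).
  have i3 := iK _ (normr_ge0 (d i - d j)); have i4 := iK _ (normr_ge0 (c i - c j)).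
  under eq_Rintegral do rewrite rK.
  rewrite RintegralB//; last by apply: L1B => //; exact: L1D.
  rewrite RintegralB//; last exact: L1D.
  rewrite RintegralD//.
  have EK k : 0 <= k -> \int[mu]_y K k y = k `^ (2 * H) / (2 * noise_const H ^+ 2).
    by move=> /kernel_integral[].
  rewrite !EK// /rect_cov; field.
  rewrite gt_eqF// sqrtr_gt0 mulr_gt0//; move: H_range; lra.
rewrite -[LHS]fineK; last first.
  apply: integrable_fin_num => //.
  by apply: L1_sum => i; apply: L1_sum => j; apply: L1Z.
congr EFin; rewrite -/(Rintegral _ _ _) Rintegral_sum; last first.
  by move=> i; apply: L1_sum => j; exact: L1Z.
rewrite mulr_sumr; apply: eq_bigr => i _; rewrite Rintegral_sum; last first.
  by move=> j; exact: L1Z.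
rewrite mulr_sumr; apply: eq_bigr => j _.
transitivity (z i * z j * \int[mu]_y (rho i j y * `|y| `^ (2 * H - 2))).
  by apply: RintegralZl => //; exact: irho.
by rewrite Erho; ring.
Qed.

End family.
End spatial_gram.

(** * Adapted random variables *)

Section filtration.
Context {R : realType} {d : measure_display} {Om : measurableType d}.
Variable P : probability Om R.
Variable W : R -> R -> {RV P >-> R}.

Definition filtration_generators (a : R) : set (set Om) :=
  [set A | exists s x B, [/\ 0 <= s <= a, measurable B & A = W s x @^-1` B]].

Lemma measurable_wrtP a (X : Om -> R) :
  measurable_wrt (noise_filtration W a) X <->
  measurable_fun setT (X : g_sigma_algebraType (filtration_generators a) -> R).
Proof.
split => [FX _ B mB|mX B mB]; first by rewrite setTI; exact: FX.
by have := mX measurableT B mB; rewrite setTI.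
Qed.

Lemma noise_filtration_sub a b : a <= b -> noise_filtration W a `<=` noise_filtration W b.
Proof.
move=> ab; apply: sub_smallest2r; first exact: smallest_sigma_algebra.
move=> _ [s [x [B [/andP[s0 sa] mB ->]]]]; exists s, x, B; split => //.
by rewrite s0 (le_trans sa ab).
Qed.

Lemma noise_filtration_measurable a A : noise_filtration W a A -> measurable A.
Proof.
move=> FA; apply: (FA measurable); split.
  exact: (@sigma_algebra_measurable _ Om).
move=> _ [s [x [B [_ mB ->]]]]; rewrite -[X in measurable X]setTI.
exact: measurable_funP.
Qed.

Lemma measurable_wrt_measurable a (X : Om -> R) :
  measurable_wrt (noise_filtration W a) X -> measurable_fun setT X.
Proof. by move=> FX _ B mB; rewrite setTI; apply: noise_filtration_measurable; exact: FX. Qed.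

Lemma measurable_wrt_le a b (X : Om -> R) : a <= b ->
  measurable_wrt (noise_filtration W a) X -> measurable_wrt (noise_filtration W b) X.
Proof. by move=> ab FX B mB; apply: noise_filtration_sub (FX _ mB). Qed.

Lemma measurable_wrt_noise s a x : 0 <= s <= a ->
  measurable_wrt (noise_filtration W a) (W s x).
Proof. by move=> sa B mB; apply: sub_sigma_algebra; exists s, x, B. Qed.

Section closure.
Variable a : R.
Local Notation F := (noise_filtration W a).

Lemma measurable_wrt_cst (c : R) : measurable_wrt F (fun=> c).
Proof. by apply/measurable_wrtP; exact: measurable_cst. Qed.

Lemma measurable_wrtM (X Y : Om -> R) : measurable_wrt F X -> measurable_wrt F Y ->
  measurable_wrt F (fun w => X w * Y w).
Proof.
move=> /measurable_wrtP mX /measurable_wrtP mY; apply/measurable_wrtP.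
exact: measurable_funM.
Qed.

Lemma measurable_wrtB (X Y : Om -> R) : measurable_wrt F X -> measurable_wrt F Y ->
  measurable_wrt F (fun w => X w - Y w).
Proof.
move=> /measurable_wrtP mX /measurable_wrtP mY; apply/measurable_wrtP.
exact: measurable_funB.
Qed.

Lemma measurable_wrt_sum (I : Type) (s : seq I) (X : I -> Om -> R) :
  (forall i, measurable_wrt F (X i)) ->
  measurable_wrt F (fun w => \sum_(i <- s) X i w).
Proof.
by move=> mX; apply/measurable_wrtP; apply: measurable_sum => i; exact/measurable_wrtP.
Qed.

Lemma measurable_wrt_bound (X : Om -> R) (M : R) : measurable_wrt F X ->
  measurable_wrt F (fun w => (`|X w| <= M)%R%:R : R).
Proof.
move=> /measurable_wrtP mX; apply/measurable_wrtP.
have -> : (fun w => (`|X w| <= M)%R%:R : R) =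
    (\1_(`]-oo, M] : set R) \o (fun w => `|X w|)).
  by apply/funext => w; rewrite /= indicE mem_setE in_itv.
apply: measurableT_comp; first exact: measurable_indic.
exact: measurableT_comp.
Qed.

Lemma measurable_wrt_prod (I : Type) (s : seq I) (X : I -> Om -> R) :
  (forall i, measurable_wrt F (X i)) ->
  measurable_wrt F (fun w => \prod_(i <- s) X i w).
Proof.
move=> mX; elim: s => [|i s ih].
  by under eq_fun do rewrite big_nil; exact: measurable_wrt_cst.
by under eq_fun do rewrite big_cons; exact: measurable_wrtM.
Qed.

End closure.

Lemma eq_measurable_wrt (F : set (set Om)) (X Y : Om -> R) :
  X =1 Y -> measurable_wrt F X -> measurable_wrt F Y.
Proof. by move=> /funext ->. Qed.

End filtration.

(** * Isometry for simple processes *)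

Section cell.
Context {R : realType} {d : measure_display} {Om : measurableType d}.
Variable P : probability Om R.
Variables (H : R) (W : R -> R -> {RV P >-> R}).
Hypothesis W_noise : fractional_noise H W.
Variables (a b : R).
Hypotheses (a_ge0 : 0 <= a) (ab : a < b).
Variables (I : finType) (c d' : I -> R) (alpha : I -> Om -> R).
Local Notation F := (noise_filtration W a).
Hypothesis F_alpha : forall i, measurable_wrt F (alpha i).

Definition rect_noise (a b c d : R) (w : Om) : R :=
  noise_incr W a b d w - noise_incr W a b c w.

Let Delta i := rect_noise a b (c i) (d' i).

Definition cell_sum (w : Om) : R := \sum_i alpha i w * Delta i w.

Definition cell_energy (w : Om) : R :=
  \sum_i \sum_j alpha i w * alpha j w * rect_cov H (c i) (c j) (d' i) (d' j).

Let incr_L2 x : measurable_fun setT (noise_incr W a b x) /\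
  L1 P (fun w => noise_incr W a b x w ^+ 2).
Proof.
have := noise_centered_gaussian W_noise (noise_incr_span W x a_ge0 (ltW ab)).
by case.
Qed.

Let incr_mul x y : L1 P (fun w => noise_incr W a b x w * noise_incr W a b y w).
Proof.
have [mx ix] := incr_L2 x; have [my iy] := incr_L2 y; exact: L1_mul_sqr.
Qed.

Let malpha i : measurable_fun setT (alpha i).
Proof. exact: measurable_wrt_measurable (F_alpha i). Qed.

Let mDelta i : measurable_fun setT (Delta i).
Proof. by apply: measurable_funB; [have [] := incr_L2 (d' i)|have [] := incr_L2 (c i)]. Qed.

Lemma measurable_cell_sum : measurable_fun setT cell_sum.
Proof.
rewrite /cell_sum; apply: measurable_sum => i; apply: measurable_funM => //.
Qed.

Lemma measurable_cell_energy : measurable_fun setT cell_energy.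
Proof.
rewrite /cell_energy; apply: measurable_sum => i; apply: measurable_sum => j.
by apply: measurable_funM => //; exact: measurable_funM.
Qed.

Section bounded_factor.
Variables (M : R) (X : Om -> R).
Hypotheses (FX : measurable_wrt F X) (XM : forall w, `|X w| <= M).

Let mX : measurable_fun setT X. Proof. exact: measurable_wrt_measurable FX. Qed.

Lemma expectation_bounded_rect i : L1 P (fun w => X w * Delta i w) /\
  \int[P]_w (X w * Delta i w) = 0.
Proof.
have i1 x : L1 P (fun w => X w * noise_incr W a b x w).
  by apply: (L1M_bounded mX XM); have [mx ix] := incr_L2 x; exact: L1_of_sqr.
have E : (fun w => X w * Delta i w) =
    (fun w => X w * noise_incr W a b (d' i) w - X w * noise_incr W a b (c i) w).
  by apply/funext => w; rewrite /Delta /rect_noise mulrBr.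
rewrite E; split; first exact: L1B.
rewrite RintegralB//; [|exact: i1|exact: i1].
by rewrite !(expectation_past_incr W_noise a_ge0 (ltW ab) _ mX XM FX) subrr.
Qed.

Lemma expectation_bounded_rect_mul i j :
  L1 P (fun w => X w * (Delta i w * Delta j w)) /\
  \int[P]_w (X w * (Delta i w * Delta j w)) =
  (b - a) * rect_cov H (c i) (c j) (d' i) (d' j) * \int[P]_w X w.
Proof.
pose K x y w := X w * (noise_incr W a b x w * noise_incr W a b y w).
have iK x y : L1 P (K x y) by apply: (L1M_bounded mX XM); exact: incr_mul.
have EK x y : \int[P]_w K x y w =
    (b - a) * (2^-1 * (`|x| `^ (2 * H) + `|y| `^ (2 * H) - `|x - y| `^ (2 * H))) * \int[P]_w X w.
  rewrite (expectation_past_incr_mul W_noise a_ge0 (ltW ab) _ _ mX XM FX).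
  by rewrite (expectation_noise_incr_mul W_noise _ _ a_ge0 (ltW ab)).
have E : (fun w => X w * (Delta i w * Delta j w)) =
    (fun w => (K (d' i) (d' j) w - K (d' i) (c j) w) - (K (c i) (d' j) w - K (c i) (c j) w)).
  by apply/funext => w; rewrite /Delta /rect_noise /K; ring.
rewrite E; split; first by apply: L1B; exact: L1B.
rewrite RintegralB//; [|by apply: L1B; exact: iK|by apply: L1B; exact: iK].
rewrite RintegralB//; [|exact: iK|exact: iK].
rewrite RintegralB//; [|exact: iK|exact: iK].
by rewrite !EK /rect_cov; ring.
Qed.

End bounded_factor.

Let trunc (n : nat) (w : Om) : R := \prod_i (`|alpha i w| <= n%:R)%R%:R.

Let truncE n w : trunc n w = [forall i, `|alpha i w| <= n%:R]%:R.
Proof.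
rewrite /trunc; case: forallP => [h|/forallP]; first by rewrite big1// => i _; rewrite h.
by rewrite negb_forall => /existsP[i /negbTE h]; rewrite (bigD1 i)//= h mul0r.
Qed.

Let Ftrunc n : measurable_wrt F (trunc n).
Proof. by apply: measurable_wrt_prod => i; exact: measurable_wrt_bound. Qed.

Let trunc_bound n i w : `|alpha i w * trunc n w| <= n%:R.
Proof.
rewrite truncE; case: forallP => [/(_ i)|_]; first by rewrite mulr1.
by rewrite mulr0 normr0.
Qed.

Let trunc01 n w : trunc n w = 0 \/ trunc n w = 1.
Proof. by rewrite truncE; case: [forall i, _]; [right|left]. Qed.

Let trunc_sqr n w : trunc n w * trunc n w = trunc n w.
Proof. by case: (trunc01 n w) => ->; rewrite ?mulr0 ?mulr1. Qed.

Let cvg_trunc w : trunc n w @[n --> \oo] --> (1 : R).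
Proof.
apply: cvg_near_cst; near=> n; rewrite truncE.
suff -> : [forall i, `|alpha i w| <= n%:R] by [].
apply/forallP => i; apply: (@le_trans _ _ (\sum_j `|alpha j w|)).
  by rewrite (bigD1 i)//= lerDl sumr_ge0.
by near: n; exact: nbhs_infty_ger.
Unshelve. all: by end_near. Qed.

Let trunc_nd w m n : (m <= n)%N -> trunc m w <= trunc n w.
Proof.
move=> mn; rewrite !truncE; case: forallP => // h; case: forallP => // k.
by exfalso; apply: k => i; rewrite (le_trans (h i))// ler_nat.
Qed.

(** On the event that all coefficients are at most [n] in absolute value, which
belongs to the past, the products of coefficients are bounded and the formula
for two increments applies; [n] then tends to infinity, by dominated convergence
for the energy and by monotone convergence for the square of the sum. Single
terms of the sums need not be integrable, only the energy as a whole is. *)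
Lemma cell_isometry : (forall w, 0 <= cell_energy w) -> L1 P cell_energy ->
  L1 P (fun w => cell_sum w ^+ 2) /\
  \int[P]_w cell_sum w ^+ 2 = (b - a) * \int[P]_w cell_energy w.
Proof.
move=> E0 iE.
have mS := measurable_cell_sum.
have mT n : measurable_fun setT (trunc n) by exact: measurable_wrt_measurable (Ftrunc n).
have ET n : (fun w => cell_sum w ^+ 2 * trunc n w) = (fun w => \sum_i \sum_j
      (alpha i w * trunc n w) * (alpha j w * trunc n w) * (Delta i w * Delta j w)).
  apply/funext => w; rewrite -[in LHS]trunc_sqr /cell_sum expr2 !mulr_suml; apply: eq_bigr => i _.
  rewrite mulr_sumr mulr_suml; apply: eq_bigr => j _; ring.
have B n i j := @expectation_bounded_rect_mul (n%:R * n%:R)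
   (fun w => (alpha i w * trunc n w) * (alpha j w * trunc n w)).
have {}B n i j : L1 P (fun w => (alpha i w * trunc n w) * (alpha j w * trunc n w) * (Delta i w * Delta j w)) /\
   \int[P]_w ((alpha i w * trunc n w) * (alpha j w * trunc n w) * (Delta i w * Delta j w)) =
   (b - a) * rect_cov H (c i) (c j) (d' i) (d' j) * \int[P]_w ((alpha i w * trunc n w) * (alpha j w * trunc n w)).
  apply: (B n i j).
    by apply: measurable_wrtM; apply: measurable_wrtM.
  by move=> w; rewrite normrM ler_pM.
have iaa n i j : L1 P (fun w => (alpha i w * trunc n w) * (alpha j w * trunc n w)).
  apply: (@L1_bounded _ _ _ _ _ (n%:R * n%:R)).
    by apply: measurable_funM; exact: measurable_funM.
  by move=> w; rewrite normrM ler_pM.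
have iT n : L1 P (fun w => cell_sum w ^+ 2 * trunc n w).
  by rewrite ET; apply: L1_sum => i; apply: L1_sum => j; have [] := B n i j.
have eqT n : \int[P]_w (cell_sum w ^+ 2 * trunc n w) =
    (b - a) * \int[P]_w (cell_energy w * trunc n w).
  transitivity (\int[P]_w (\sum_i \sum_j ((alpha i w * trunc n w) * (alpha j w * trunc n w) * (Delta i w * Delta j w)))).
    by apply: eq_Rintegral => w _; rewrite -[LHS]/((fun w => _) w) ET.
  transitivity ((b - a) * \int[P]_w (\sum_i \sum_j (rect_cov H (c i) (c j) (d' i) (d' j) * ((alpha i w * trunc n w) * (alpha j w * trunc n w))))).
    rewrite Rintegral_sum => [|i]; last by apply: L1_sum => j; have [] := B n i j.
    rewrite Rintegral_sum => [|i]; last by apply: L1_sum => j; exact: L1Z.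
    rewrite mulr_sumr; apply: eq_bigr => i _.
    rewrite Rintegral_sum => [|j]; last by have [] := B n i j.
    rewrite Rintegral_sum => [|j]; last exact: L1Z.
    rewrite mulr_sumr; apply: eq_bigr => j _; have [_ ->] := B n i j.
    by rewrite RintegralZl ?mulrA//; exact: iaa.
  congr (_ * _); apply: eq_Rintegral => w _.
  rewrite -[in RHS]trunc_sqr /cell_energy !mulr_suml; apply: eq_bigr => i _.
  by rewrite !mulr_suml; apply: eq_bigr => j _; ring.
have [||||_ cvE] := @dominated_cvg_Rintegral _ _ _ P
  (fun n w => cell_energy w * trunc n w) cell_energy (fun w => `|cell_energy w|).
- by move=> n; apply: measurable_funM => //; exact: measurable_cell_energy.
- move=> w; rewrite -[X in _ --> X]mulr1; apply: cvgM; [exact: cvg_cst|exact: cvg_trunc].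
- exact: L1_norm.
- by move=> n w; case: (trunc01 n w) => ->; rewrite ?mulr1// mulr0 normr0.
have S0 n w : 0 <= cell_sum w ^+ 2 * trunc n w.
  by case: (trunc01 n w) => ->; rewrite ?mulr1 ?mulr0 ?sqr_ge0.
have cvS : (\int[P]_w (cell_sum w ^+ 2 * trunc n w)%:E)%E @[n --> \oo] -->
           (\int[P]_w (cell_sum w ^+ 2)%:E)%E.
  have -> : (\int[P]_w (cell_sum w ^+ 2)%:E =
      \int[P]_w limn (fun n => (cell_sum w ^+ 2 * trunc n w)%:E))%E.
    apply: eq_integral => w _; apply/esym/cvg_lim => //.
    apply: cvg_EFin; first exact: nearW.
    rewrite -[X in _ --> X]mulr1; apply: cvgM; [exact: cvg_cst|exact: cvg_trunc].
  apply: cvg_monotone_convergence => //.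
  - move=> n; apply/measurable_EFinP; apply: measurable_funM => //; exact: measurable_funX.
  - by move=> n w _; rewrite lee_fin.
  - by move=> w _ m n mn; rewrite lee_fin ler_wpM2l ?sqr_ge0// trunc_nd.
have cvS' : (\int[P]_w (cell_sum w ^+ 2 * trunc n w)%:E)%E @[n --> \oo] -->
           ((b - a) * \int[P]_w cell_energy w)%:E.
  have e n : (\int[P]_w (cell_sum w ^+ 2 * trunc n w)%:E =
              ((b - a) * \int[P]_w (cell_energy w * trunc n w))%:E)%E.
    by rewrite -eqT /Rintegral fineK// (integrable_fin_num _ (iT n)).
  under eq_cvg do rewrite e.
  apply: cvg_EFin; first exact: nearW.
  by apply: cvgM; [exact: cvg_cst|exact: cvE].
have E : (\int[P]_w (cell_sum w ^+ 2)%:E = ((b - a) * \int[P]_w cell_energy w)%:E)%E.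
  exact: (cvg_unique _ cvS cvS').
split; last by rewrite /Rintegral E.
apply/integrableP; split; first by apply/measurable_EFinP; exact: measurable_funX.
under eq_integral do rewrite /= ger0_norm ?sqr_ge0//.
by rewrite E ltry.
Qed.

Lemma cell_sum_orthogonal (Z : Om -> R) : measurable_wrt F Z ->
  L1 P (fun w => Z w ^+ 2) -> L1 P (fun w => cell_sum w ^+ 2) ->
  \int[P]_w (Z w * cell_sum w) = 0.
Proof.
move=> FZ iZ iS; have mZ := measurable_wrt_measurable FZ.
have mS := measurable_cell_sum.
have iZS := L1_mul_sqr mZ mS iZ iS.
pose T n w := trunc n w * (`|Z w| <= n%:R)%R%:R.
have FT n : measurable_wrt F (T n).
  by apply: measurable_wrtM => //; exact: measurable_wrt_bound.
have [||||_ cv] := @dominated_cvg_Rintegral _ _ _ P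
  (fun n w => Z w * cell_sum w * T n w) (fun w => Z w * cell_sum w)
  (fun w => `|Z w * cell_sum w|).
- move=> n; apply: measurable_funM; first exact: measurable_funM.
  exact: measurable_wrt_measurable (FT n).
- move=> w; rewrite -[X in _ --> X]mulr1; apply: cvgM; first exact: cvg_cst.
  rewrite -[X in _ --> X]mulr1; apply: cvgM; first exact: cvg_trunc.
  apply: cvg_near_cst; near=> n.
  by suff -> : `|Z w| <= n%:R by []; near: n; exact: nbhs_infty_ger.
- exact: L1_norm.
- move=> n w; rewrite /T; case: (trunc01 n w) => ->; first by rewrite mul0r mulr0 normr0.
  by case: (`|Z w| <= n%:R); rewrite mul1r ?mulr1// mulr0 normr0.
suff e : forall n, \int[P]_w (Z w * cell_sum w * T n w) = 0.
  have {}cv : (0 : R) @[n --> \oo] --> \int[P]_w (Z w * cell_sum w).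
    by under eq_cvg => n do rewrite -(e n).
  exact: (cvg_unique _ cv (cvg_cst _)).
move=> n.
have B i := @expectation_bounded_rect (n%:R * n%:R) (fun w => Z w * (`|Z w| <= n%:R)%R%:R * (alpha i w * trunc n w)).
have {}B i : L1 P (fun w => Z w * (`|Z w| <= n%:R)%R%:R * (alpha i w * trunc n w) * Delta i w) /\
  \int[P]_w (Z w * (`|Z w| <= n%:R)%R%:R * (alpha i w * trunc n w) * Delta i w) = 0.
  apply: (B i).
    apply: measurable_wrtM; apply: measurable_wrtM => //.
    exact: measurable_wrt_bound.
  move=> w; rewrite normrM ler_pM//.
  by case: (boolP (`|Z w| <= n%:R)) => h; rewrite ?mulr1// mulr0 normr0.
transitivity (\int[P]_w \sum_i (Z w * (`|Z w| <= n%:R)%R%:R * (alpha i w * trunc n w) * Delta i w)).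
  apply: eq_Rintegral => w _; rewrite /T /cell_sum mulr_sumr mulr_suml.
  by apply: eq_bigr => i _; ring.
rewrite Rintegral_sum => [|i]; last by have [] := B i.
by rewrite big1// => i _; have [] := B i.
Unshelve. all: by end_near. Qed.

End cell.

Section grid.
Context {R : realType}.

Lemma partial_telescope (u : nat -> R) (i j n : nat) : (i <= j)%N ->
  \sum_(l < n) (i <= l < j)%N%:R * (u l.+1 - u l) = u (minn n j) - u (minn n i).
Proof.
move=> ij; elim: n => [|n ih]; first by rewrite big_ord0 !min0n subrr.
rewrite big_ord_recr/= ih.
have [jn|nj] := leqP j n.
  by rewrite andbF mul0r addr0 !(minn_idPr _)//; lia.
have [il|li] := leqP i n.
  by rewrite mul1r (minn_idPl nj) (minn_idPr (leqW il)); ring.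
rewrite mul0r addr0 (minn_idPl nj) (minn_idPl li).
by rewrite !subrr.
Qed.

(** Any increment between two points of a grid is the sum of the increments over the
cells in between; this refines the time intervals of a simple process to a
common subdivision. *)
Lemma grid_telescope (s : seq R) (g : R -> R) a b :
  sorted <%R s -> a \in s -> b \in s -> a <= b ->
  \sum_(l < (size s).-1) (a <= s`_l < b)%R%:R * (g s`_l.+1 - g s`_l) = g b - g a.
Proof.
move=> ss sa sb ab.
have ia : (index a s < size s)%N by rewrite index_mem.
have ib : (index b s < size s)%N by rewrite index_mem.
have iab : (index a s <= index b s)%N.
  by rewrite leqNgt -(lt_sorted_ltn_nth 0 ss)// ?inE// !nth_index// -leNgt.
have := partial_telescope (fun l => g s`_l) (size s).-1 iab.
rewrite (minn_idPr _); last lia.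
rewrite (minn_idPr _); last lia.
rewrite !nth_index// => <-; apply: eq_bigr => l _; congr (_%:R * _).
have ls : (l < size s)%N by have := ltn_ord l; lia.
rewrite -{1}(nth_index 0 sa) -{1}(nth_index 0 sb).
by rewrite (lt_sorted_leq_nth 0 ss) ?inE// (lt_sorted_ltn_nth 0 ss) ?inE.
Qed.

End grid.

Section simple_processes.
Context {R : realType} {d : measure_display} {Om : measurableType d}.
Variable P : probability Om R.
Variable W : R -> R -> {RV P >-> R}.

(** Compared with elementary processes, the space-time rectangles are arbitrary and
may overlap, so that the difference of two such processes is again one, by
juxtaposition. *)
Record simple := Simple {
  sp_I : finType;
  sp_a : sp_I -> R; sp_b : sp_I -> R; sp_c : sp_I -> R; sp_d : sp_I -> R;
  sp_X : sp_I -> Om -> R;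
  sp_a_ge0 : forall i, 0 <= sp_a i;
  sp_ab : forall i, sp_a i < sp_b i;
  sp_cd : forall i, sp_c i < sp_d i;
  sp_X_meas : forall i, measurable_wrt (noise_filtration W (sp_a i)) (sp_X i) }.

Definition simple_field (g : simple) (t x : R) (w : Om) : R :=
  \sum_(i : sp_I g) sp_X i w * \1_`]sp_a i, sp_b i] t * \1_`]sp_c i, sp_d i] x.

Definition simple_integral (g : simple) (w : Om) : R :=
  \sum_(i : sp_I g) sp_X i w * (W (sp_b i) (sp_d i) w - W (sp_a i) (sp_d i) w
                    - W (sp_b i) (sp_c i) w + W (sp_a i) (sp_c i) w).

Local Notation mu := (@lebesgue_measure R).
Variable H : R.
Hypothesis H_range : 0 < H < 2^-1.
Hypothesis W_noise : fractional_noise H W.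

Section isometry.
Variable g : simple.

Definition grid : seq R :=
  sort <=%R (undup (map (@sp_a g) (enum (sp_I g)) ++ map (@sp_b g) (enum (sp_I g)))).

Lemma grid_sorted : sorted <%R grid.
Proof. by rewrite sort_lt_sorted undup_uniq. Qed.

Lemma grid_a (i : sp_I g) : sp_a i \in grid.
Proof. by rewrite mem_sort mem_undup mem_cat map_f// mem_enum. Qed.

Lemma grid_b (i : sp_I g) : sp_b i \in grid.
Proof. by rewrite mem_sort mem_undup mem_cat orbC map_f// mem_enum. Qed.

Lemma grid_ge0 t : t \in grid -> 0 <= t.
Proof.
rewrite mem_sort mem_undup mem_cat => /orP[] /mapP[i _ ->]; first exact: sp_a_ge0.
by apply: (le_trans (sp_a_ge0 i)); exact/ltW/sp_ab.
Qed.

Local Notation N := (size grid).-1.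

Lemma grid_cell (l : 'I_N) : 0 <= grid`_l /\ grid`_l < grid`_l.+1.
Proof.
have lN : (l.+1 < size grid)%N by have := ltn_ord l; lia.
split; first by apply: grid_ge0; rewrite mem_nth// ltnW.
by rewrite (lt_sorted_ltn_nth 0 grid_sorted)// inE// ltnW.
Qed.

Let active (l : nat) (i : sp_I g) : R := (sp_a i <= grid`_l < sp_b i)%R%:R.
Let alpha l i w := sp_X i w * active l i.
Let Y l := cell_sum W grid`_l grid`_l.+1 (@sp_c g) (@sp_d g) (alpha l).
Let E l := cell_energy H (@sp_c g) (@sp_d g) (alpha l).

Let F_alpha l i : measurable_wrt (noise_filtration W grid`_l) (alpha l i).
Proof.
rewrite /alpha /active; case: (boolP (sp_a i <= grid`_l)) => [al|_] /=.
  apply: measurable_wrtM; last exact: measurable_wrt_cst.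
  exact: measurable_wrt_le al (@sp_X_meas g i).
by apply: (eq_measurable_wrt (X := fun=> 0)) => [w|]; [rewrite mulr0|exact: measurable_wrt_cst].
Qed.

Let integralE w : simple_integral g w = \sum_(l < N) Y l w.
Proof.
rewrite /simple_integral exchange_big/=; apply: eq_bigr => i _.
pose G t := W t (sp_d i) w - W t (sp_c i) w.
transitivity (sp_X i w * (G (sp_b i) - G (sp_a i))); first by rewrite /G; ring.
rewrite -(grid_telescope G grid_sorted (grid_a i) (grid_b i) (ltW (sp_ab i))).
rewrite mulr_sumr; apply: eq_bigr => l _.
by rewrite /alpha /active /rect_noise /noise_incr /G; ring.
Qed.

(** Two time intervals meet along a union of grid cells, those on which both are
active. *)
Let overlap (i j : sp_I g) :
  L1 (@lebesgue_measure R) (fun t : R =>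
    \1_(`]sp_a i, sp_b i] : set R) t * \1_(`]sp_a j, sp_b j] : set R) t) /\
  \int[@lebesgue_measure R]_t
    (\1_(`]sp_a i, sp_b i] : set R) t * \1_(`]sp_a j, sp_b j] : set R) t) =
   \sum_(l < N) (grid`_l.+1 - grid`_l) * (active l i * active l j).
Proof.
pose M := Num.max (sp_a i) (sp_a j); pose m := Num.min (sp_b i) (sp_b j).
have -> : (fun t : R => \1_(`]sp_a i, sp_b i] : set R) t *
    \1_(`]sp_a j, sp_b j] : set R) t) = (\1_(`]M, m] : set R) : R -> R).
  apply/funext => t; rewrite !indicE !mem_setE !in_itv/= gt_max le_min -natrM mulnb.
  by rewrite andbACA.
split; first exact: integrable_indic_itv.
rewrite /Rintegral integral_indic//= setIT lebesgue_measure_itv/= lte_fin.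
have act l : active l i * active l j = (M <= grid`_l < m)%R%:R.
  rewrite /active -natrM mulnb ge_max lt_min; congr (_%:R).
  by rewrite andbACA.
have gM : M \in grid by rewrite /M; case: leP => _; exact: grid_a.
have gm : m \in grid by rewrite /m; case: leP => _; exact: grid_b.
case: ltP => [Mm|mM].
  have /= <- := grid_telescope id grid_sorted gM gm (ltW Mm).
  by apply: eq_bigr => l _; rewrite act mulrC.
rewrite big1// => l _; rewrite act.
case: (boolP (M <= grid`_l)) => //= [Ml|]; last by rewrite mulr0.
by rewrite ltNge (le_trans mM Ml) mulr0.
Qed.

(** At each time a simple field is a step function in space, whose fractional norm
is a quadratic form in the coefficients; integrating in time replaces products
of indicator functions by lengths of grid cells. *)
Lemma hnorm2_simple w :
  hnorm2 H (fun t x => simple_field g t x w) =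
  (\sum_(l < N) (grid`_l.+1 - grid`_l) * E l w)%:E.
Proof.
pose I (i : sp_I g) : set R := `]sp_a i, sp_b i]%classic.
pose r (i j : sp_I g) := rect_cov H (sp_c i) (sp_c j) (sp_d i) (sp_d j).
pose q (t : R) : R := \sum_(i : sp_I g) \sum_(j : sp_I g)
  (sp_X i w * sp_X j w * r i j) * (\1_(I i) t * \1_(I j) t).
have nc0 : 0 < noise_const H ^+ 2.
  by rewrite exprn_gt0// sqrtr_gt0 mulr_gt0//; move: H_range; lra.
have spaceE t : (\int[mu]_x \int[mu]_y
     ((simple_field g t (x + y) w - simple_field g t x w) ^+ 2 *
       `|y| `^ (2 * H - 2))%:E = ((noise_const H ^+ 2)^-1 * q t)%:E)%E.
  rewrite [LHS](spatial_gram_step_function H_range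
    (fun i => sp_X i w * \1_(I i) t) (fun i => ltW (@sp_cd g i))).
  congr (_ * _)%:E; apply: eq_bigr => i _; apply: eq_bigr => j _.
  by rewrite -/(r i j); ring.
have q0 t : 0 <= q t.
  have : (0 <= ((noise_const H ^+ 2)^-1 * q t)%:E)%E.
    rewrite -spaceE; apply: integral_ge0 => x _; apply: integral_ge0 => y _.
    by rewrite lee_fin mulr_ge0 ?sqr_ge0 ?powR_ge0.
  by rewrite lee_fin pmulr_rge0// invr_gt0.
have qneg t : ~ (`[0%R, +oo[%classic : set R) t -> q t = 0.
  rewrite /= in_itv/= andbT => /negP; rewrite -ltNge => t0.
  rewrite /q big1// => i _; rewrite big1// => j _.
  have -> : \1_(I i) t = 0 :> R; last by rewrite mul0r mulr0.
  rewrite indicE memNset// /I/= in_itv/= => /andP[at_ _].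
  by have := sp_a_ge0 i; rewrite leNgt (lt_trans at_ t0).
have iq i j : L1 mu (fun t => (sp_X i w * sp_X j w * r i j) * (\1_(I i) t * \1_(I j) t)).
  by apply: L1Z; have [] := overlap i j.
have iQ : L1 mu q by apply: L1_sum => i; exact: L1_sum.
have intq : (\int[mu]_t (q t)%:E = (\sum_(l < N) (grid`_l.+1 - grid`_l) * E l w)%:E)%E.
  rewrite -[LHS]fineK; last exact: integrable_fin_num.
  congr EFin; rewrite -/(Rintegral _ _ _).
  transitivity (\sum_(i : sp_I g) \sum_(j : sp_I g) (sp_X i w * sp_X j w * r i j) *
      \sum_(l < N) (grid`_l.+1 - grid`_l) * (active l i * active l j)).
    rewrite Rintegral_sum => [|i]; last exact: L1_sum.
    apply: eq_bigr => i _; rewrite Rintegral_sum//; apply: eq_bigr => j _.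
    by have [io oE] := overlap i j; rewrite RintegralZl// -oE.
  under eq_bigr do under eq_bigr do rewrite mulr_sumr.
  under eq_bigr do rewrite exchange_big/=.
  rewrite exchange_big/=; apply: eq_bigr => l _.
  rewrite /E /cell_energy mulr_sumr; apply: eq_bigr => i _.
  rewrite mulr_sumr; apply: eq_bigr => j _.
  by rewrite /alpha -/(r i j); ring.
rewrite /hnorm2; under eq_integral do rewrite spaceE EFinM.
rewrite ge0_integralZl//=; last 3 first.
- by apply/measurable_EFinP; apply: measurable_funTS; exact: L1_measurable iQ.
- by move=> t _; rewrite lee_fin.
- by rewrite lee_fin invr_ge0 ltW.
rewrite muleA -EFinM divff ?gt_eqF// mul1e -intq integral_mkcond.
apply: eq_integral => t _; rewrite patchE; case: ifPn => //.
by rewrite notin_setE => /qneg ->.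
Qed.

Lemma cell_energy_ge0 l w : 0 <= E l w.
Proof.
have := spatial_gram_step_function H_range (fun i => alpha l i w) (fun i => ltW (@sp_cd g i)).
move=> h; have : (0 <= ((noise_const H ^+ 2)^-1 * E l w)%:E)%E.
  rewrite -h; apply: integral_ge0 => x _; apply: integral_ge0 => y _.
  by rewrite lee_fin mulr_ge0 ?sqr_ge0 ?powR_ge0.
rewrite lee_fin pmulr_rge0// invr_gt0 exprn_gt0// sqrtr_gt0 mulr_gt0//; move: H_range; lra.
Qed.

(** Grouped by cells of the time grid, the integral is a sum of pairwise orthogonal
terms of mean zero, and each of them satisfies [cell_isometry]. *)
Lemma simple_isometry :
  (\int[P]_w hnorm2 H (fun t x => simple_field g t x w) < +oo)%E ->
  [/\ L1 P (fun w => simple_integral g w ^+ 2), \int[P]_w simple_integral g w = 0 &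
      (\int[P]_w hnorm2 H (fun t x => simple_field g t x w) =
       (\int[P]_w simple_integral g w ^+ 2)%:E)%E].
Proof.
under eq_integral do rewrite hnorm2_simple.
have mE l : measurable_fun setT (E l).
  by rewrite /E; apply: measurable_cell_energy => i; exact: F_alpha.
have dt0 (l : 'I_N) : 0 < grid`_l.+1 - grid`_l by rewrite subr_gt0; have [] := grid_cell l.
have sum0 w : 0 <= \sum_(l < N) (grid`_l.+1 - grid`_l) * E l w.
  by apply: sumr_ge0 => l _; rewrite mulr_ge0 ?cell_energy_ge0// ltW.
move=> fin.
have isum : L1 P (fun w => \sum_(l < N) (grid`_l.+1 - grid`_l) * E l w).
  apply/integrableP; split.
    by apply/measurable_EFinP; apply: measurable_sum => l; exact: measurable_funM.
  by under eq_integral do rewrite /= ger0_norm//.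
have iE (l : 'I_N) : L1 P (E l).
  have := L1Z (grid`_l.+1 - grid`_l)^-1 isum; apply: le_L1 => // w.
  rewrite ger0_norm ?cell_energy_ge0// mulrC ler_pdivlMr// mulrC.
  rewrite (bigD1 l)//= lerDl sumr_ge0// => k _.
  by rewrite mulr_ge0 ?cell_energy_ge0// ltW.
have iso (l : 'I_N) : L1 P (fun w => Y l w ^+ 2) /\
    \int[P]_w Y l w ^+ 2 = (grid`_l.+1 - grid`_l) * \int[P]_w E l w.
  have [l0 ll] := grid_cell l.
  exact: (cell_isometry W_noise l0 ll (@F_alpha l) (cell_energy_ge0 l) (iE l)).
have mY (l : 'I_N) : measurable_fun setT (Y l).
  have [l0 ll] := grid_cell l.
  exact: (measurable_cell_sum W_noise l0 ll _ _ (@F_alpha l)).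
have iYY (k l : 'I_N) : L1 P (fun w => Y k w * Y l w).
  by apply: L1_mul_sqr => //; [have [] := iso k|have [] := iso l].
have lt_size (l : 'I_N) : (l < size grid)%N.
  exact: leq_trans (ltn_ord l) (leq_pred _).
have FY (k l : 'I_N) : (k < l)%N -> measurable_wrt (noise_filtration W grid`_l) (Y k).
  move=> kl; have [k0 kk] := grid_cell k; have [l0 _] := grid_cell l.
  have kl' : grid`_k.+1 <= grid`_l.
    rewrite (lt_sorted_leq_nth 0 grid_sorted)// inE.
      exact: (leq_ltn_trans kl (lt_size l)).
    exact: lt_size.
  apply: measurable_wrt_sum => i; apply: measurable_wrtM.
    by apply: measurable_wrt_le (@F_alpha k i); rewrite (le_trans (ltW kk)).
  apply: measurable_wrtB; apply: measurable_wrtB; apply: measurable_wrt_noise;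
    rewrite ?k0 ?kl' ?(le_trans k0 (ltW kk)) ?(le_trans (ltW kk) kl')//.
have orth (k l : 'I_N) : k != l -> \int[P]_w (Y k w * Y l w) = 0.
  wlog kl : k l / (k < l)%N.
    move=> h kl; have : (k < l)%N || (l < k)%N by rewrite -neq_ltn.
    case/orP => lt; first exact: h.
    rewrite -(h l k lt) 1?eq_sym//; apply: eq_Rintegral => w _; exact: mulrC.
  move=> _; have [l0 ll] := grid_cell l.
  by apply: (cell_sum_orthogonal W_noise l0 ll (@F_alpha l) (FY _ _ kl));
    [have [] := iso k|have [] := iso l].
have mean (l : 'I_N) : \int[P]_w Y l w = 0.
  have [l0 ll] := grid_cell l.
  under eq_Rintegral do rewrite -[Y l _]mul1r.
  have F1 : measurable_wrt (noise_filtration W grid`_l) (fun=> 1 : R).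
    exact: measurable_wrt_cst.
  apply: (cell_sum_orthogonal W_noise l0 ll (@F_alpha l) F1); first exact: L1_cst.
  by have [] := iso l.
have sqE w : simple_integral g w ^+ 2 = \sum_(k < N) \sum_(l < N) Y k w * Y l w.
  by rewrite integralE expr2 mulr_suml; apply: eq_bigr => k _; rewrite mulr_sumr.
split.
- under eq_fun do rewrite sqE.
  by apply: L1_sum => k; exact: L1_sum.
- under eq_Rintegral do rewrite integralE.
  rewrite Rintegral_sum => [|l]; first by rewrite big1// => l _; exact: mean.
  by apply: L1_of_sqr => //; have [] := iso l.
under [in RHS]eq_Rintegral do rewrite sqE.
rewrite Rintegral_sum => [|k]; last exact: L1_sum.
rewrite -[LHS]fineK; last exact: integrable_fin_num.
congr EFin; rewrite -/(Rintegral _ _ _) Rintegral_sum => [|l]; last exact: L1Z.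
apply: eq_bigr => k _; rewrite Rintegral_sum//.
rewrite (bigD1 k)//= big1 => [|l lk]; last by rewrite orth// eq_sym.
rewrite addr0 RintegralZl//; last exact: iE.
by have [_ <-] := iso k; apply: eq_Rintegral => w _; rewrite expr2.
Qed.

End isometry.
End simple_processes.

(** * Expected energy of random fields *)

Section iterated_integral.
Context {R : realType} {d : measure_display} {Om : measurableType d}.
Variable P : probability Om R.
Local Notation mu := (@lebesgue_measure R).
Local Notation space := (Om * measurableTypeR R * measurableTypeR R * measurableTypeR R)%type.
Implicit Types F G : space -> \bar R.

Local Open Scope ereal_scope.

Definition iterated F : \bar R := \int[P]_w \int[mu]_t \int[mu]_x \int[mu]_y F (w, t, x, y).

Section measurability.
Variable F : space -> \bar R.
Hypotheses (mF : measurable_fun setT F) (F0 : forall z, 0 <= F z).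

Lemma inner_y_measurable : measurable_fun setT (fun z => \int[mu]_y F (z, y)).
Proof. exact: (@measurable_fun_fubini_tonelli_F _ _ _ _ _ mu F mF F0). Qed.

Lemma inner_xy_measurable : measurable_fun setT (fun z => \int[mu]_x \int[mu]_y F (z, x, y)).
Proof.
apply: (@measurable_fun_fubini_tonelli_F _ _ _ _ _ mu (fun z => \int[mu]_y F (z, y))).
  exact: inner_y_measurable.
by move=> z; exact: integral_ge0.
Qed.

Lemma inner_txy_measurable :
  measurable_fun setT (fun w => \int[mu]_t \int[mu]_x \int[mu]_y F (w, t, x, y)).
Proof.
apply: (@measurable_fun_fubini_tonelli_F _ _ _ _ _ mu
  (fun z => \int[mu]_x \int[mu]_y F (z, x, y))).
  exact: inner_xy_measurable.
by move=> z; apply: integral_ge0 => x _; exact: integral_ge0.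
Qed.

Lemma section_y_measurable w t x : measurable_fun setT (fun y => F (w, t, x, y)).
Proof. exact: (measurableT_comp mF (measurable_pair1 _)). Qed.

Lemma section_xy_measurable w t : measurable_fun setT (fun x => \int[mu]_y F (w, t, x, y)).
Proof. exact: (measurableT_comp inner_y_measurable (measurable_pair1 _)). Qed.

Lemma section_txy_measurable w :
  measurable_fun setT (fun t => \int[mu]_x \int[mu]_y F (w, t, x, y)).
Proof. exact: (measurableT_comp inner_xy_measurable (measurable_pair1 _)). Qed.

Lemma iteratedZ (k : R) : (0 <= k)%R -> iterated (fun z => k%:E * F z) = k%:E * iterated F.
Proof.
move=> k0; rewrite /iterated -ge0_integralZl//; last first.
- by move=> w _; apply: integral_ge0 => t _; apply: integral_ge0 => x _; exact: integral_ge0.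
- exact: inner_txy_measurable.
apply: eq_integral => w _; rewrite -ge0_integralZl//; last first.
- by move=> t _; apply: integral_ge0 => x _; exact: integral_ge0.
- exact: section_txy_measurable.
apply: eq_integral => t _; rewrite -ge0_integralZl//; last first.
- by move=> x _; exact: integral_ge0.
- exact: section_xy_measurable.
apply: eq_integral => x _; rewrite -ge0_integralZl//; exact: section_y_measurable.
Qed.

End measurability.

Lemma iteratedD F G : measurable_fun setT F -> (forall z, 0 <= F z) ->
  measurable_fun setT G -> (forall z, 0 <= G z) ->
  iterated (fun z => F z + G z) = iterated F + iterated G.
Proof.
move=> mF F0 mG G0; rewrite /iterated -ge0_integralD//; last first.
- exact: inner_txy_measurable.
- by move=> w _; apply: integral_ge0 => t _; apply: integral_ge0 => x _; exact: integral_ge0.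
- exact: inner_txy_measurable.
- by move=> w _; apply: integral_ge0 => t _; apply: integral_ge0 => x _; exact: integral_ge0.
apply: eq_integral => w _; rewrite -ge0_integralD//; last first.
- exact: section_txy_measurable.
- by move=> t _; apply: integral_ge0 => x _; exact: integral_ge0.
- exact: section_txy_measurable.
- by move=> t _; apply: integral_ge0 => x _; exact: integral_ge0.
apply: eq_integral => t _; rewrite -ge0_integralD//; last first.
- exact: section_xy_measurable.
- by move=> x _; exact: integral_ge0.
- exact: section_xy_measurable.
- by move=> x _; exact: integral_ge0.
apply: eq_integral => x _; rewrite -ge0_integralD//; exact: section_y_measurable.
Qed.

Lemma le_iterated F G : measurable_fun setT F -> (forall z, 0 <= F z) ->
  measurable_fun setT G -> (forall z, F z <= G z) -> iterated F <= iterated G.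
Proof.
move=> mF F0 mG FG; have G0 z : 0 <= G z by exact: le_trans (FG z).
rewrite /iterated; apply: ge0_le_integral; first exact: measurableT.
- by move=> w _; apply: integral_ge0 => t _; apply: integral_ge0 => x _; exact: integral_ge0.
- exact: inner_txy_measurable mF F0.
- exact: inner_txy_measurable mG G0.
move=> w _; apply: ge0_le_integral; first exact: measurableT.
- by move=> t _; apply: integral_ge0 => x _; exact: integral_ge0.
- exact: section_txy_measurable mF F0 w.
- exact: section_txy_measurable mG G0 w.
move=> t _; apply: ge0_le_integral; first exact: measurableT.
- by move=> x _; exact: integral_ge0.
- exact: section_xy_measurable mF F0 w t.
- exact: section_xy_measurable mG G0 w t.
move=> x _; apply: ge0_le_integral; first exact: measurableT.
- by move=> y _; exact: F0.
- exact: section_y_measurable mF w t x.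
- exact: section_y_measurable mG w t x.
- by move=> y _; exact: FG.
Qed.

Lemma iterated_expectation_inside F : measurable_fun setT F -> (forall z, 0 <= F z) ->
  iterated F = \int[mu]_t \int[mu]_x \int[mu]_y \int[P]_w F (w, t, x, y).
Proof.
move=> mF F0.
have m1 := inner_xy_measurable mF F0; have m2 := inner_y_measurable mF F0.
rewrite /iterated (@fubini_tonelli _ _ _ _ _ P mu (fun z => \int[mu]_x \int[mu]_y F (z, x, y)))//; last first.
  by move=> z; apply: integral_ge0 => x _; exact: integral_ge0.
apply: eq_integral => t _.
have mt : measurable_fun setT (fun z : Om * measurableTypeR R => (z.1, t, z.2)).
  by apply: measurable_fun_pair => //; apply: measurable_fun_pair.
rewrite [LHS](@fubini_tonelli _ _ _ _ _ P mu (fun z => \int[mu]_y F (z.1, t, z.2, y)))//; last first.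
- by move=> z; exact: integral_ge0.
- exact: (measurableT_comp m2 mt).
apply: eq_integral => x _.
rewrite [LHS](@fubini_tonelli _ _ _ _ _ P mu (fun z => F (z.1, t, x, z.2)))//.
apply: (measurableT_comp mF); apply: measurable_fun_pair => //.
by apply: measurable_fun_pair => //; apply: measurable_fun_pair.
Qed.

End iterated_integral.

Lemma eq_lee {R : realType} (x y : \bar R) : x = y -> (x <= y)%E.
Proof. by move=> ->. Qed.

Section energy.
Context {R : realType} {d : measure_display} {Om : measurableType d}.
Variable P : probability Om R.
Variable H : R.
Hypothesis H_range : 0 < H < 2^-1.
Local Notation mu := (@lebesgue_measure R).
Implicit Types f g : R -> R -> Om -> R.

Definition jointly_measurable f : Prop :=
  measurable_fun setT (fun z : R * R * Om => f z.1.1 z.1.2 z.2).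

Definition energy f : \bar R := (\int[P]_w hnorm2 H (fun t x => f t x w))%E.

(** The order of the variables, [w], [t], [x] and then [y], is the order of
integration in the energy. *)
Definition energy_density f
    (z : Om * measurableTypeR R * measurableTypeR R * measurableTypeR R) : \bar R :=
  (\1_(`[0, +oo[ : set R) z.1.1.2 *
   ((f z.1.1.2 (z.1.2 + z.2) z.1.1.1 - f z.1.1.2 z.1.2 z.1.1.1) ^+ 2
    * `|z.2| `^ (2 * H - 2)))%:E.

Lemma energy_density_ge0 f z : (0 <= energy_density f z)%E.
Proof.
rewrite lee_fin mulr_ge0//.
by rewrite mulr_ge0 ?sqr_ge0 ?powR_ge0.
Qed.

Lemma measurable_energy_density f : jointly_measurable f ->
  measurable_fun setT (energy_density f).
Proof.
pose T4 := (Om * measurableTypeR R * measurableTypeR R * measurableTypeR R)%type.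
move=> mf.
have mt : measurable_fun setT (fun z : T4 => z.1.1.2 : R).
  exact: (measurableT_comp measurable_snd (measurableT_comp measurable_fst measurable_fst)).
have mw : measurable_fun setT (fun z : T4 => z.1.1.1).
  exact: (measurableT_comp measurable_fst (measurableT_comp measurable_fst measurable_fst)).
have mx : measurable_fun setT (fun z : T4 => z.1.2 : R).
  exact: (measurableT_comp measurable_snd measurable_fst).
have my : measurable_fun setT (fun z : T4 => z.2 : R) by exact: measurable_snd.
apply/measurable_EFinP; apply: measurable_funM.
  have mi : measurable_fun setT (\1_(`[0, +oo[ : set R) : R -> R).
    exact: measurable_indic.
  exact: (measurableT_comp mi mt).
apply: measurable_funM; last first.
  have mp : measurable_fun setT (fun y : R => `|y| `^ (2 * H - 2)).
    by apply: (measurableT_comp (measurable_powR _)) => //; exact: measurableT_comp.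
  exact: (measurableT_comp mp my).
have m1 := measurable_fun_pair (measurable_fun_pair mt (measurable_funD mx my)) mw.
have m2 := measurable_fun_pair (measurable_fun_pair mt mx) mw.
apply: measurable_funX; apply: measurable_funB.
  exact: (measurableT_comp mf m1).
exact: (measurableT_comp mf m2).
Qed.

Lemma energyE f : jointly_measurable f ->
  energy f = ((noise_const H ^+ 2)%:E * iterated P (energy_density f))%E.
Proof.
move=> mf; have mD := measurable_energy_density mf.
have D0 := @energy_density_ge0 f.
transitivity (\int[P]_w ((noise_const H ^+ 2)%:E *
    \int[mu]_t \int[mu]_x \int[mu]_y energy_density f (w, t, x, y)))%E; last first.
  rewrite [LHS](@ge0_integralZl _ _ _ P setT measurableT
    (fun w => \int[mu]_t \int[mu]_x \int[mu]_y energy_density f (w, t, x, y))%E).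
  - by [].
  - exact: inner_txy_measurable mD D0.
  - by move=> w _; apply: integral_ge0 => t _; apply: integral_ge0 => x _; exact: integral_ge0.
  - by rewrite lee_fin sqr_ge0.
apply: eq_integral => w _.
rewrite /hnorm2.
apply: (congr1 (fun z => (noise_const H ^+ 2)%:E * z)%E).
rewrite integral_mkcond.
apply: eq_integral => t _.
rewrite patchE.
rewrite /energy_density /=.
case: ifPn => [t0|t0].
  by apply: eq_integral => x _; apply: eq_integral => y _; rewrite indicE t0 mul1r.
apply/esym/integral0_eq => x _; apply: integral0_eq => y _.
by rewrite indicE (negbTE t0) mul0r.
Qed.

Lemma energyN f : energy (fun t x w => - f t x w) = energy f.
Proof.
rewrite /energy; apply: eq_integral => w _; rewrite /hnorm2.
apply: (congr1 (fun z => (noise_const H ^+ 2)%:E * z)%E).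
apply: eq_integral => t _; apply: eq_integral => x _; apply: eq_integral => y _.
by rewrite -opprB opprK addrC sqrrN opprD.
Qed.

Lemma jointly_measurableD f g : jointly_measurable f -> jointly_measurable g ->
  jointly_measurable (fun t x w => f t x w + g t x w).
Proof. by move=> mf mg; exact: measurable_funD. Qed.

Lemma jointly_measurableB f g : jointly_measurable f -> jointly_measurable g ->
  jointly_measurable (fun t x w => f t x w - g t x w).
Proof. by move=> mf mg; exact: measurable_funB. Qed.

(** Only the quadratic inequality [(a + b)^2 <= 2 a^2 + 2 b^2] is used instead of a
triangle inequality: constants are irrelevant for the exponent of [h]. *)
Lemma energyD f g : jointly_measurable f -> jointly_measurable g ->
  (energy (fun t x w => f t x w + g t x w)%R <= 2%:E * energy f + 2%:E * energy g)%E.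
Proof.
move=> mf mg; have mfg := jointly_measurableD mf mg.
have mDf := measurable_energy_density mf; have mDg := measurable_energy_density mg.
have D0 h := @energy_density_ge0 h.
have I0 h : (0 <= iterated P (energy_density h))%E.
  apply: integral_ge0 => w _; apply: integral_ge0 => t _.
  by apply: integral_ge0 => x _; apply: integral_ge0 => y _; exact: D0.
have m2 h : jointly_measurable h ->
    measurable_fun setT (fun z => 2%:E * energy_density h z)%E.
  by move=> mh; apply: measurable_funeM; exact: measurable_energy_density.
have le2 h z : (0 <= 2%:E * energy_density h z)%E by exact: mule_ge0.
have core : (iterated P (energy_density (fun t x w => f t x w + g t x w)%R) <=
    2%:E * iterated P (energy_density f) + 2%:E * iterated P (energy_density g))%E.
  have Z1 := iteratedZ P mDf (D0 f) (ler0n R 2).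
  have Z2 := iteratedZ P mDg (D0 g) (ler0n R 2).
  have S := iteratedD P (m2 _ mf) (le2 f) (m2 _ mg) (le2 g).
  have {}S := etrans S (f_equal2 (fun a b => a + b)%E Z1 Z2).
  apply: (@le_trans _ _ _ _ _ _ (eq_lee S)).
  apply: (le_iterated P (measurable_energy_density mfg) (D0 _)
    (emeasurable_funD (m2 _ mf) (m2 _ mg))).
  move=> z; rewrite /energy_density -!EFinM -EFinD lee_fin.
  have i0 : 0 <= \1_(`[0, +oo[ : set R) z.1.1.2 :> R by rewrite indicE.
  have k0 : 0 <= `|z.2| `^ (2 * H - 2) by exact: powR_ge0.
  move: (\1_(`[0, +oo[ : set R) z.1.1.2) (`|z.2| `^ (2 * H - 2)) i0 k0 => i k i0 k0.
  move: (f _ _ _) (f _ _ _) (g _ _ _) (g _ _ _) => a b c e.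
  rewrite (_ : 2 * _ + _ = i * ((2 * (a - b) ^+ 2 + 2 * (c - e) ^+ 2) * k)); last by ring.
  rewrite ler_wpM2l// ler_wpM2r//.
  by have := sqr_ge0 ((a - b) - (c - e)); nra.
rewrite (energyE mfg) (energyE mf) (energyE mg).
move: core (I0 f) (I0 g) (I0 (fun t x w => f t x w + g t x w)).
move: (iterated P _) (iterated P _) (iterated P _) => A B C ABC A0 B0 C0.
rewrite muleCA [X in (_ + X)%E]muleCA -ge0_muleDr; [|exact: mule_ge0|exact: mule_ge0].
by apply: lee_wpmul2l => //; rewrite lee_fin sqr_ge0.
Qed.

Lemma energyB f g : jointly_measurable f -> jointly_measurable g ->
  (energy (fun t x w => f t x w - g t x w)%R <= 2%:E * energy f + 2%:E * energy g)%E.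
Proof.
move=> mf mg; rewrite -[energy g]energyN.
apply: (@energyD f (fun t x w => - g t x w)) => //.
exact: measurableT_comp.
Qed.

End energy.

(** * Stochastic integrals as limits of simple integrals *)

Section stochastic_integral.
Context {R : realType} {d : measure_display} {Om : measurableType d}.
Variable P : probability Om R.
Variables (H : R) (W : R -> R -> {RV P >-> R}).
Hypothesis H_range : 0 < H < 2^-1.
Hypothesis W_noise : fractional_noise H W.

Definition simple_of_elementary (e : elementary W) : simple W :=
  @Simple _ _ _ _ W ('I_(el_n e) * 'I_(el_m e))%type
    (fun ij => @el_a _ _ _ _ _ e ij.1) (fun ij => @el_b _ _ _ _ _ e ij.1)
    (fun ij => @el_c _ _ _ _ _ e ij.2) (fun ij => @el_d _ _ _ _ _ e ij.2)
    (fun ij => @el_X _ _ _ _ _ e ij.1 ij.2)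
    (fun ij => @el_a_ge0 _ _ _ _ _ e ij.1) (fun ij => @el_ab _ _ _ _ _ e ij.1)
    (fun ij => @el_cd _ _ _ _ _ e ij.2)
    (fun ij => @el_X_meas _ _ _ _ _ e ij.1 ij.2).

Lemma simple_field_of_elementary e t x w :
  simple_field (simple_of_elementary e) t x w = elementary_field e t x w.
Proof. by rewrite /elementary_field pair_big. Qed.

Lemma simple_integral_of_elementary e w :
  simple_integral (simple_of_elementary e) w = elementary_integral e w.
Proof. by rewrite /elementary_integral pair_big. Qed.

Section difference.
Variables e f : simple W.
Let I := (sp_I e + sp_I f)%type.
Let glue (u : sp_I e -> R) (v : sp_I f -> R) (i : I) : R :=
  match i with inl j => u j | inr j => v j end.
Let X (i : I) : Om -> R :=
  match i with inl j => sp_X j | inr j => fun w => - sp_X j w end.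

Let a_ge0 i : 0 <= glue (@sp_a _ _ _ _ _ e) (@sp_a _ _ _ _ _ f) i.
Proof. by case: i => i; exact: sp_a_ge0. Qed.

Let ab i : glue (@sp_a _ _ _ _ _ e) (@sp_a _ _ _ _ _ f) i
  < glue (@sp_b _ _ _ _ _ e) (@sp_b _ _ _ _ _ f) i.
Proof. by case: i => i; exact: sp_ab. Qed.

Let cd i : glue (@sp_c _ _ _ _ _ e) (@sp_c _ _ _ _ _ f) i
  < glue (@sp_d _ _ _ _ _ e) (@sp_d _ _ _ _ _ f) i.
Proof. by case: i => i; exact: sp_cd. Qed.

Let X_meas i : measurable_wrt
  (noise_filtration W (glue (@sp_a _ _ _ _ _ e) (@sp_a _ _ _ _ _ f) i)) (X i).
Proof.
case: i => i; first exact: sp_X_meas.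
apply: (eq_measurable_wrt (X := fun w => 0 - sp_X i w)) => [w|]; first by rewrite sub0r.
by apply: measurable_wrtB; [exact: measurable_wrt_cst|exact: sp_X_meas].
Qed.

Definition simple_sub : simple W := @Simple _ _ _ _ W I _ _ _ _ X a_ge0 ab cd X_meas.

Lemma simple_field_sub t x w :
  simple_field simple_sub t x w = simple_field e t x w - simple_field f t x w.
Proof.
rewrite /simple_field big_sumType/= -sumrN; congr (_ + _).
by apply: eq_bigr => i _; rewrite !mulNr.
Qed.

Lemma simple_integral_sub w :
  simple_integral simple_sub w = simple_integral e w - simple_integral f w.
Proof.
rewrite /simple_integral big_sumType/= -sumrN; congr (_ + _).
by apply: eq_bigr => i _; rewrite mulNr.
Qed.

End difference.

Lemma jointly_measurable_simple (e : simple W) : jointly_measurable (simple_field e).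
Proof.
rewrite /jointly_measurable /simple_field; apply: measurable_sum => i.
have mX := measurable_wrt_measurable (@sp_X_meas _ _ _ _ _ e i).
have mi (A : set R) : measurable A -> measurable_fun setT (\1_A : R -> R).
  by move=> mA; exact: measurable_indic.
apply: measurable_funM; first apply: measurable_funM.
- exact: (measurableT_comp mX measurable_snd).
- exact: (measurableT_comp (mi _ (measurable_itv _)) (measurableT_comp measurable_fst measurable_fst)).
- exact: (measurableT_comp (mi _ (measurable_itv _)) (measurableT_comp measurable_snd measurable_fst)).
Qed.

Local Notation energy := (energy P H).

Lemma measurable_simple_integral (e : simple W) : measurable_fun setT (simple_integral e).
Proof.
rewrite /simple_integral; apply: measurable_sum => i.
have mX := measurable_wrt_measurable (@sp_X_meas _ _ _ _ _ e i).
by apply: measurable_funM => //; apply: measurable_funD => //; apply: measurable_funB => //;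
  apply: measurable_funB.
Qed.

Lemma stoch_integral_approx (g : R -> R -> Om -> R) (J : Om -> R) (eps : R) :
  0 < eps -> is_stoch_integral H W g J ->
  exists e : simple W, [/\
    (energy (fun t x w => simple_field e t x w - g t x w)%R <= eps%:E)%E,
    L1 P (fun w => (simple_integral e w - J w) ^+ 2) &
    \int[P]_w (simple_integral e w - J w) ^+ 2 <= eps].
Proof.
move=> eps0 [mJ [e [cE cI]]].
have pos : nbhs (0 : \bar R) [set x | x < eps%:E]%E.
  by apply: open_nbhs_nbhs; split; [exact: open_ereal_lt_ereal|rewrite /= lte_fin].
have [n [/= En In]] : exists n,
   ((\int[P]_w hnorm2 H (fun t x => elementary_field (e n) t x w - g t x w)%R) < eps%:E)%E /\
   ('E_P[fun w => ((elementary_integral (e n) w - J w) ^+ 2)%R] < eps%:E)%E.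
  have := cE _ pos; have := cI _ pos; move=> [N1 _ h1] [N2 _ h2].
  exists (maxn N1 N2); split; [apply: h2|apply: h1]; rewrite /= ?leq_maxr ?leq_maxl//.
exists (simple_of_elementary (e n)).
have IE w : simple_integral (simple_of_elementary (e n)) w = elementary_integral (e n) w.
  exact: simple_integral_of_elementary.
have mI : measurable_fun setT (fun w => (simple_integral (simple_of_elementary (e n)) w - J w) ^+ 2).
  by apply: measurable_funX; apply: measurable_funB => //; exact: measurable_simple_integral.
have EI : 'E_P[fun w => ((elementary_integral (e n) w - J w) ^+ 2)%R]%E =
  (\int[P]_w ((simple_integral (simple_of_elementary (e n)) w - J w) ^+ 2)%:E)%E.
  by rewrite unlock; apply: eq_integral => w _; rewrite IE.
rewrite EI in In.
split.
- apply/ltW; apply: le_lt_trans En; apply: eq_lee; apply: eq_integral => w _.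
  by congr hnorm2; apply/funext => t; apply/funext => x; rewrite simple_field_of_elementary.
- apply/integrableP; split; first exact/measurable_EFinP.
  under eq_integral do rewrite /= ger0_norm ?sqr_ge0//.
  by apply: lt_trans In _; rewrite ltry.
- rewrite -lee_fin /Rintegral fineK ?(ltW In)//.
  rewrite ge0_fin_numE; first by apply: lt_trans In _; rewrite ltry.
  by apply: integral_ge0 => w _; rewrite lee_fin sqr_ge0.
Qed.

Lemma simple_energy_le (e : simple W) g eps : jointly_measurable g ->
  (energy g < +oo)%E ->
  (energy (fun t x w => simple_field e t x w - g t x w)%R <= eps%:E)%E ->
  (energy (simple_field e) <= 2%:E * eps%:E + 2%:E * energy g)%E.
Proof.
move=> mg gfin le; have me := jointly_measurable_simple e.
have h := energyD P H (jointly_measurableB me mg) mg.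
have E : (fun t x w => simple_field e t x w - g t x w + g t x w) = simple_field e.
  by apply/funext => t; apply/funext => x; apply/funext => w; rewrite subrK.
rewrite {}E in h; apply: (le_trans h); apply: leeD => //.
by apply: lee_wpmul2l.
Qed.

Lemma L1_sqrD (X Y : Om -> R) : measurable_fun setT X -> measurable_fun setT Y ->
  L1 P (fun w => X w ^+ 2) -> L1 P (fun w => Y w ^+ 2) ->
  L1 P (fun w => (X w + Y w) ^+ 2) /\
  \int[P]_w (X w + Y w) ^+ 2 <= 2 * \int[P]_w X w ^+ 2 + 2 * \int[P]_w Y w ^+ 2.
Proof.
move=> mX mY iX iY.
have le w : (X w + Y w) ^+ 2 <= 2 * X w ^+ 2 + 2 * Y w ^+ 2.
  by have := sqr_ge0 (X w - Y w); nra.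
have i2 : L1 P (fun w => 2 * X w ^+ 2 + 2 * Y w ^+ 2) by apply: L1D; exact: L1Z.
have i1 : L1 P (fun w => (X w + Y w) ^+ 2).
  apply: le_L1 i2 => [|w]; first by apply: measurable_funX; exact: measurable_funD.
  by rewrite ger0_norm ?sqr_ge0.
split => //; rewrite -!RintegralZl// -RintegralD//; [|exact: L1Z|exact: L1Z].
by apply: le_Rintegral => // w _; exact: le.
Qed.

Lemma L1_sqrN (X : Om -> R) : L1 P (fun w => X w ^+ 2) -> L1 P (fun w => (- X w) ^+ 2).
Proof. by move=> iX; under eq_fun do rewrite sqrrN. Qed.

Lemma energy_simple_lty (e : simple W) g (eps : R) : jointly_measurable g ->
  (energy g < +oo)%E ->
  (energy (fun t x w => simple_field e t x w - g t x w)%R <= eps%:E)%E ->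
  (energy (simple_field e) < +oo)%E.
Proof.
move=> mg gfin le; apply: le_lt_trans (simple_energy_le mg gfin le) _.
by apply: lte_add_pinfty; [rewrite -EFinM ltry|rewrite lte_mul_pinfty].
Qed.

(** An integral is approximated in [L^2] by simple integrals, which have mean zero. *)
Lemma stoch_integral_centered g J : jointly_measurable g -> (energy g < +oo)%E ->
  is_stoch_integral H W g J ->
  [/\ measurable_fun setT J, L1 P (fun w => J w ^+ 2) & \int[P]_w J w = 0].
Proof.
move=> mg gfin sJ; have [mJ _] := sJ.
have ap (eps : R) : 0 < eps -> exists X : Om -> R, [/\ measurable_fun setT X,
    L1 P (fun w => X w ^+ 2), \int[P]_w X w = 0, L1 P (fun w => (X w - J w) ^+ 2) &
    \int[P]_w (X w - J w) ^+ 2 <= eps].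
  move=> eps0; have [e [le i1 l1]] := stoch_integral_approx eps0 sJ.
  have [iI EI _] := simple_isometry H_range W_noise (energy_simple_lty mg gfin le).
  by exists (simple_integral e); split => //; exact: measurable_simple_integral.
have iJ : L1 P (fun w => J w ^+ 2).
  have [X [mX iX _ iXJ _]] := ap 1 ltr01.
  have mXJ : measurable_fun setT (fun w => - (X w - J w)).
    by apply: measurableT_comp => //; exact: measurable_funB.
  have [+ _] := L1_sqrD mX mXJ iX (L1_sqrN iXJ).
  by congr L1; apply/funext => w; congr (_ ^+ 2); ring.
split => //; have i1J := L1_of_sqr mJ iJ.
apply/eqP; rewrite -normr_le0 leNgt; apply/negP => m0.
pose del := `|\int[P]_w J w| / 4.
have d0 : 0 < del by rewrite divr_gt0.
have [X [mX iX EX iXJ leXJ]] := ap _ (mulr_gt0 d0 d0).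
have i1X := L1_of_sqr mX iX.
have i1XJ : L1 P (fun w => X w - J w) by exact: L1B.
have EJ : \int[P]_w J w = - \int[P]_w (X w - J w).
  by rewrite RintegralB// EX sub0r opprK.
have le : `|\int[P]_w (X w - J w)| <= del + del.
  have := le_normr_Rintegral measurableT i1XJ.
  move=> /le_trans; apply.
  have iR : L1 P (fun w => del + del^-1 * (X w - J w) ^+ 2).
    by apply: L1D; [exact: L1_cst|exact: L1Z].
  apply: (@le_trans _ _ (\int[P]_w (del + del^-1 * (X w - J w) ^+ 2))).
    apply: le_Rintegral => //; first exact: L1_norm.
    move=> w _; set z := X w - J w; rewrite -(real_normK (num_real z)).
    rewrite -(ler_pM2l d0) mulrDr [X in _ <= _ + X]mulrA divff ?gt_eqF// mul1r.
    by have := sqr_ge0 (del - `|z|); have := normr_ge0 z; nra.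
  have -> : \int[P]_w (del + del^-1 * (X w - J w) ^+ 2) =
      del + del^-1 * \int[P]_w (X w - J w) ^+ 2.
    rewrite RintegralD//; [|exact: L1_cst|exact: L1Z].
    by congr (_ + _); [exact: Rintegral_prob_cst|exact: RintegralZl].
  by rewrite lerD2l mulrC ler_pdivrMr.
by move: le; rewrite EJ normrN in d0 m0 *; rewrite /del EJ normrN; lra.
Qed.

(** With [k] the difference of two approximating simple processes and [r] the error
made in approximating the integrands, [g1 - g2 = k - r]. The energy of [k] is the
second moment of its integral, itself at most twice that of [J1 - J2] up to
an arbitrarily small error; the other factor two comes from [energyB]. *)
Lemma energy_le_second_moment g1 g2 J1 J2 :
  jointly_measurable g1 -> jointly_measurable g2 ->
  (energy g1 < +oo)%E -> (energy g2 < +oo)%E ->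
  is_stoch_integral H W g1 J1 -> is_stoch_integral H W g2 J2 ->
  (energy (fun t x w => g1 t x w - g2 t x w)%R <= (4 * \int[P]_w (J1 w - J2 w) ^+ 2)%:E)%E.
Proof.
move=> mg1 mg2 fin1 fin2 s1 s2.
have [mJ1 iJ1 _] := stoch_integral_centered mg1 fin1 s1.
have [mJ2 iJ2 _] := stoch_integral_centered mg2 fin2 s2.
apply/lee_addgt0Pr => eps eps0; have e0 : 0 < eps / 24 by rewrite divr_gt0.
have [e1 [le1 i1 l1]] := stoch_integral_approx e0 s1.
have [e2 [le2 i2 l2]] := stoch_integral_approx e0 s2.
have me1 := jointly_measurable_simple e1; have me2 := jointly_measurable_simple e2.
have f1 := energy_simple_lty mg1 fin1 le1; have f2 := energy_simple_lty mg2 fin2 le2.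
have two0 : (0 <= 2%:E :> \bar R)%E by rewrite lee_fin.
pose k := simple_sub e1 e2.
have kE : simple_field k = (fun t x w => simple_field e1 t x w - simple_field e2 t x w).
  by apply/funext => t; apply/funext => x; apply/funext => w; exact: simple_field_sub.
have mk := jointly_measurable_simple k.
have fk : (energy (simple_field k) < +oo)%E.
  rewrite kE; apply: le_lt_trans (energyB P H me1 me2) _.
  apply: lte_add_pinfty.
    by apply: lte_mul_pinfty; [rewrite lee_fin|by []|exact: f1].
  by apply: lte_mul_pinfty; [rewrite lee_fin|by []|exact: f2].
have [iIk _ Ek] := simple_isometry H_range W_noise fk.
pose r t x w := (simple_field e1 t x w - g1 t x w) - (simple_field e2 t x w - g2 t x w).
have m1 := jointly_measurableB me1 mg1; have m2 := jointly_measurableB me2 mg2.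
have mr : jointly_measurable r by exact: jointly_measurableB.
have er : (energy r <= (eps / 6)%:E)%E.
  apply: le_trans (energyB P H m1 m2) _.
  apply: (@le_trans _ _ (2%:E * (eps / 24)%:E + 2%:E * (eps / 24)%:E)%E).
    apply: leeD; [exact: (lee_wpmul2l two0 le1)|exact: (lee_wpmul2l two0 le2)].
  by rewrite -!EFinM -EFinD lee_fin; lra.
have gE : (fun t x w => g1 t x w - g2 t x w) = (fun t x w => simple_field k t x w - r t x w).
  by rewrite kE; apply/funext => t; apply/funext => x; apply/funext => w; rewrite /r; ring.
rewrite gE; apply: le_trans (energyB P H mk mr) _.
have Ik : \int[P]_w simple_integral k w ^+ 2 <= 2 * \int[P]_w (J1 w - J2 w) ^+ 2 + eps / 3.
  pose A w := simple_integral e1 w - J1 w; pose B w := simple_integral e2 w - J2 w.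
  have mA : measurable_fun setT A by apply: measurable_funB => //; exact: measurable_simple_integral.
  have mB : measurable_fun setT B by apply: measurable_funB => //; exact: measurable_simple_integral.
  have mNB : measurable_fun setT (fun w => - B w) by exact: measurableT_comp.
  have mNJ : measurable_fun setT (fun w => - J2 w) by exact: measurableT_comp.
  have [iAB leAB] := L1_sqrD mA mNB i1 (L1_sqrN i2).
  have [iJ leJ] := L1_sqrD mJ1 mNJ iJ1 (L1_sqrN iJ2).
  have mJ : measurable_fun setT (fun w => J1 w - J2 w) by exact: measurable_funB.
  have mAB : measurable_fun setT (fun w => A w - B w) by exact: measurable_funB.
  have [_ le] := L1_sqrD mJ mAB iJ iAB.
  have -> : \int[P]_w simple_integral k w ^+ 2 = \int[P]_w (J1 w - J2 w + (A w - B w)) ^+ 2.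
    by apply: eq_Rintegral => w _; rewrite simple_integral_sub /A /B; congr (_ ^+ 2); ring.
  apply: (le_trans le); rewrite lerD2l.
  have NB : \int[P]_w (- B w) ^+ 2 = \int[P]_w B w ^+ 2.
    by apply: eq_Rintegral => w _; rewrite sqrrN.
  by move: leAB l1 l2; rewrite NB /A /B; lra.
have Ek' : energy (simple_field k) = (\int[P]_w simple_integral k w ^+ 2)%:E by exact: Ek.
rewrite Ek'; apply: (@le_trans _ _ (2%:E * (2 * \int[P]_w (J1 w - J2 w) ^+ 2 + eps / 3)%:E + 2%:E * (eps / 6)%:E)%E).
  apply: leeD; last exact: (lee_wpmul2l two0 er).
  by apply: (lee_wpmul2l two0); rewrite lee_fin.
by rewrite -!EFinM -!EFinD lee_fin; lra.
Qed.

Lemma second_moment_eq0 g J : jointly_measurable g -> energy g = 0 ->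
  is_stoch_integral H W g J -> \int[P]_w J w ^+ 2 = 0.
Proof.
move=> mg g0 sJ; have gfin : (energy g < +oo)%E by rewrite g0.
have [mJ iJ _] := stoch_integral_centered mg gfin sJ.
apply/eqP; rewrite eq_le; apply/andP; split; last first.
  by apply: Rintegral_ge0 => w _; exact: sqr_ge0.
apply/ler_addgt0Pr => eps eps0; have e0 : 0 < eps / 6 by rewrite divr_gt0.
have [e [le i l]] := stoch_integral_approx e0 sJ.
have fe := energy_simple_lty mg gfin le.
have [iI _ EI] := simple_isometry H_range W_noise fe.
have mI := measurable_simple_integral e.
have mN : measurable_fun setT (fun w => - (simple_integral e w - J w)).
  by apply: measurableT_comp => //; exact: measurable_funB.
have [_ leJ] := L1_sqrD mI mN iI (L1_sqrN i).
have EJ : \int[P]_w (simple_integral e w - (simple_integral e w - J w)) ^+ 2 = \int[P]_w J w ^+ 2.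
  by apply: eq_Rintegral => w _; congr (_ ^+ 2); ring.
have NB : \int[P]_w (- (simple_integral e w - J w)) ^+ 2 = \int[P]_w (simple_integral e w - J w) ^+ 2.
  by apply: eq_Rintegral => w _; rewrite sqrrN.
have leI : \int[P]_w simple_integral e w ^+ 2 <= eps / 3.
  rewrite -lee_fin; have <- : energy (simple_field e) = (\int[P]_w simple_integral e w ^+ 2)%:E by exact: EI.
  apply: le_trans (simple_energy_le mg gfin le) _.
  by rewrite g0 mule0 adde0 -EFinM lee_fin; lra.
by move: leJ; rewrite EJ NB; lra.
Qed.

End stochastic_integral.

(** * Energy of the difference of two light cones *)

Section monotone_integral.
Context {d : measure_display} {T : measurableType d} {R : realType}.
Variable mu : {measure set T -> \bar R}.

(** Monotonicity holds without any measurability, because the integral of a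
nonnegative function is a supremum over the simple functions below it; this
allows comparisons inside iterated integrals without checking the measurability
of the inner ones. *)
Lemma ge0_le_integralT (f g : T -> \bar R) : (forall x, 0 <= f x)%E ->
  (forall x, f x <= g x)%E -> (\int[mu]_x f x <= \int[mu]_x g x)%E.
Proof.
move=> f0 fg; have g0 x : (0 <= g x)%E by exact: le_trans (fg x).
rewrite !ge0_integralTE//; apply: le_ereal_sup => _ [h hf <-].
by exists h => // x; exact: le_trans (fg x).
Qed.

End monotone_integral.

Section wave.
Context {R : realType} {d : measure_display} {Om : measurableType d}.
Variable P : probability Om R.
Variable H : R.
Hypothesis H_range : 0 < H < 2^-1.
Local Notation mu := (@lebesgue_measure R).

Lemma integral_cst_indic (k a b : R) : 0 <= k -> a <= b ->
  (\int[mu]_z (k * \1_(`]a, b] : set R) z)%:E = (k * (b - a))%:E)%E.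
Proof.
move=> k0; rewrite le_eqVlt => /predU1P[->|ab].
  by rewrite subrr mulr0 set_itv_ge ?bnd_simp//; under eq_integral do rewrite indic0 mulr0; rewrite integral0.
under eq_integral do rewrite EFinM.
rewrite ge0_integralZl//=; last first.
  by apply/measurable_EFinP; exact: measurable_indic.
by rewrite integral_indic//= setIT lebesgue_measure_itv/= lte_fin ab -EFinB -EFinM.
Qed.

Lemma jointly_measurable_vanishing (f : R -> R -> Om -> R) (D : set R) :
  measurable D ->
  measurable_fun (D `*` setT `*` setT) (fun z : R * R * Om => f z.1.1 z.1.2 z.2) ->
  (forall t x w, ~ D t -> f t x w = 0) -> jointly_measurable f.
Proof.
move=> mD mf f0.
have mDD : measurable (D `*` setT `*` setT : set (R * R * Om)).
  by apply: measurableX => //; exact: measurableX.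
have := (measurable_restrictT _ mDD).1 mf.
congr measurable_fun; apply/funext => z; rewrite patchE.
case: ifPn => //; rewrite notin_setE => Dz; apply/esym/f0 => Dt; apply: Dz.
by split => //; split.
Qed.

Variable v : R -> R -> Om -> R.

Lemma mild_integrand_neg t x s y w : ~ (`[0%R, +oo[%classic : set R) s ->
  mild_integrand v t x s y w = 0.
Proof.
rewrite /= in_itv/= andbT => s0; rewrite /mild_integrand indicE memNset ?mulr0//.
by rewrite /= in_itv/= => /andP[].
Qed.

Section increment.
Variables (T x h s1 s2 delta : R).
Hypotheses (h_gt0 : 0 < h) (s1_ge0 : 0 <= s1) (s12 : s1 < s2) (hs2 : h <= T - s2).
Hypothesis delta_ge0 : 0 <= delta.

(* Section at time [s] of the strip inside the cone of [(T, x)] and outside, to the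
   left, of the cone of [(T, x + h)]. *)
Let A (s : R) : set R := `]x - (T - s), x + h - (T - s)].

Hypothesis v_big : forall s y, s1 < s <= s2 -> A s y ->
  (delta%:E <= \int[P]_w (v s y w ^+ 2)%:E)%E.

Hypothesis v_meas : forall s y, s1 < s <= s2 -> measurable_fun setT (v s y).

Let g t y w := mild_integrand v T (x + h) t y w - mild_integrand v T x t y w.

Hypothesis mg : jointly_measurable g.

Let indic_T s : s1 < s <= s2 -> \1_(`[0, T] : set R) s = 1 :> R.
Proof.
move=> /andP[ss1 ss2]; rewrite indicE mem_set//= in_itv/=.
by move: h_gt0 s1_ge0 hs2; lra.
Qed.

Let g_left s y w : s1 < s <= s2 -> A s y -> g s y w = - (2^-1 * v s y w).
Proof.
move=> ss; rewrite /A/= in_itv/= => /andP[yl yr].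
rewrite /g /mild_integrand indic_T// !mulr1 /wave_kernel.
have /andP[ss1 ss2] := ss.
have -> : (`|x + h - y| < T - s) = false.
  by apply/negbTE; rewrite -leNgt; apply: le_trans (ler_norm _); lra.
have -> : `|x - y| < T - s by rewrite ltr_norml; move: h_gt0 hs2; lra.
by rewrite mul0r sub0r.
Qed.

Let g_outside s y z w : s1 < s <= s2 -> A s y -> z <= - h -> g s (y + z) w = 0.
Proof.
move=> ss; rewrite /A/= in_itv/= => /andP[yl yr] zh.
rewrite /g /mild_integrand indic_T// !mulr1 /wave_kernel.
have -> : (`|x + h - (y + z)| < T - s) = false.
  by apply/negbTE; rewrite -leNgt; apply: le_trans (ler_norm _); move: h_gt0; lra.
have -> : (`|x - (y + z)| < T - s) = false.
  by apply/negbTE; rewrite -leNgt; apply: le_trans (ler_norm _); move: h_gt0; lra.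
by rewrite !mul0r subrr.
Qed.

(** For [y] in the strip and [z] in []-2h, -h]], the point [y + z] is to the left of
both cones, so the increment of [g] from [y] to [y + z] is [v / 2] up to sign; the
kernel is at least [(2 h) `^ (2 H - 2)] for such [z], and both [y] and [z] range over
intervals of length [h]. *)
Lemma energy_wave_increment :
  ((noise_const H ^+ 2 * ((2 * h) `^ (2 * H - 2) / 4 * delta * h * h * (s2 - s1)))%:E
   <= energy P H g)%E.
Proof.
rewrite energyE// EFinM; apply: lee_wpmul2l; first by rewrite lee_fin sqr_ge0.
rewrite iterated_expectation_inside; last 2 first.
- exact: measurable_energy_density.
- exact: energy_density_ge0.
pose k := (2 * h) `^ (2 * H - 2) / 4 * delta.
have k0 : 0 <= k by rewrite mulr_ge0// divr_ge0// powR_ge0.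
pose I (a b z : R) : R := \1_(`]a, b] : set R) z.
have I0 a b z : 0 <= I a b z by rewrite /I indicE.
have -> : (k * h * h * (s2 - s1))%:E = (\int[mu]_s \int[mu]_y \int[mu]_z
   (k * I s1 s2 s * I (x - (T - s)) (x + h - (T - s)) y * I (- (2 * h)) (- h) z)%:E)%E.
  have h0 := ltW h_gt0.
  have khh : 0 <= k * h * h by apply: mulr_ge0 => //; exact: mulr_ge0.
  rewrite -(integral_cst_indic khh (ltW s12)).
  apply: eq_integral => s _.
  have i0 := I0 s1 s2 s.
  transitivity (\int[mu]_y ((k * I s1 s2 s * h) * I (x - (T - s)) (x + h - (T - s)) y)%:E)%E.
    rewrite integral_cst_indic.
    - by congr EFin; rewrite /I; ring.
    - by apply: mulr_ge0 => //; apply: mulr_ge0.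
    - by move: h_gt0; lra.
  apply: eq_integral => y _.
  have j0 := I0 (x - (T - s)) (x + h - (T - s)) y.
  rewrite integral_cst_indic.
  - by congr EFin; ring.
  - by apply: mulr_ge0 => //; apply: mulr_ge0 => //; apply: mulr_ge0.
  - by move: h_gt0; lra.
have kI0 s y z : 0 <= k * I s1 s2 s * I (x - (T - s)) (x + h - (T - s)) y * I (- (2 * h)) (- h) z.
  by apply: mulr_ge0 => //; apply: mulr_ge0 => //; apply: mulr_ge0.
apply: ge0_le_integralT => s.
  apply: integral_ge0 => y _; apply: integral_ge0 => z _.
  by rewrite lee_fin kI0.
apply: ge0_le_integralT => y.
  by apply: integral_ge0 => z _; rewrite lee_fin kI0.
apply: ge0_le_integralT => z; first by rewrite lee_fin kI0.
have D0 : (0 <= \int[P]_w energy_density H g (w, s, y, z))%E.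
  by apply: integral_ge0 => w _; exact: energy_density_ge0.
have [ss|ss] := boolP (s \in `]s1, s2]); last first.
  by rewrite [I s1 s2 s]indicE mem_setE (negbTE ss) mulr0 !mul0r.
have [yA|yA] := boolP (y \in `]x - (T - s), x + h - (T - s)]); last first.
  by rewrite [I _ _ y]indicE mem_setE (negbTE yA) mulr0 !mul0r.
have [zI|zI] := boolP (z \in `]- (2 * h), - h]); last first.
  by rewrite [I _ _ z]indicE mem_setE (negbTE zI) mulr0.
rewrite /I !indicE !mem_setE ss yA zI !mulr1.
rewrite in_itv/= in ss; rewrite in_itv/= in zI; have /andP[z2 zh] := zI.
have As : A s y by [].
have dE w : energy_density H g (w, s, y, z) =
    ((`|z| `^ (2 * H - 2) / 4)%:E * (v s y w ^+ 2)%:E)%E.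
  rewrite /energy_density/= (g_outside w ss As zh) (g_left w ss As).
  rewrite indicE mem_set/=; last first.
    by rewrite in_itv/= andbT (le_trans s1_ge0)// ltW//; have /andP[] := ss.
  by rewrite -EFinM; congr EFin; field.
under eq_integral do rewrite dE.
have kz : (2 * h) `^ (2 * H - 2) <= `|z| `^ (2 * H - 2).
  have z0 : 0 < `|z| by rewrite ltr0_norm; move: h_gt0; lra.
  have zle : `|z| <= 2 * h by rewrite ltr0_norm; move: h_gt0; lra.
  have -> : 2 * H - 2 = - (2 - 2 * H) by ring.
  have h20 : 0 < 2 * h by rewrite mulr_gt0.
  have e0 : 0 <= 2 - 2 * H by move: H_range; lra.
  rewrite !powRN lef_pV2 ?posrE ?powR_gt0//.
  by apply: (ge0_ler_powR e0) => //; rewrite nnegrE ltW.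
have mv2 : measurable_fun setT (fun w => (v s y w ^+ 2)%:E).
  by apply/measurable_EFinP; apply: measurable_funX; exact: v_meas.
have c0 : (0 <= (`|z| `^ (2 * H - 2) / 4)%:E)%E.
  by rewrite lee_fin divr_ge0// powR_ge0.
have sq0 w : setT w -> (0 <= (v s y w ^+ 2)%:E)%E by rewrite lee_fin sqr_ge0.
rewrite [leRHS](ge0_integralZl P measurableT mv2 sq0 c0).
rewrite /k EFinM; apply: lee_pmul.
- by rewrite lee_fin divr_ge0// powR_ge0.
- by rewrite lee_fin.
- by rewrite lee_fin ler_wpM2r// invr_ge0.
- exact: v_big.
Qed.

End increment.
End wave.

(** * Nontrivial data give a nonzero solution *)

Section small_intervals.
Context {R : realType}.
Local Notation mu := (@lebesgue_measure R).

(** By Lebesgue's differentiation theorem, almost every value of [f] is a limit of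
averages over small intervals centered there, and these averages vanish. *)
Lemma ae_eq0_small_intervals (f : R -> R) (T : R) : 0 < T ->
  locally_integrable setT f ->
  (forall x t, 0 <= t <= T -> \int[mu]_(y in `[x - t, x + t]) f y = 0) ->
  {ae mu, forall x, f x = 0}.
Proof.
move=> T0 lf f0; pose r (n : nat) : R := T / n.+1%:R.
have r0 n : 0 < r n by rewrite divr_gt0.
have rT n : r n <= T by rewrite ler_pdivrMr//; apply: ler_peMr; [exact: ltW|rewrite ler1n].
pose E (x : R) n : set R := `[x - r n, x + r n]%classic.
have Er x n : x - r n < x + r n by have := r0 n; lra.
have muE x n : mu (E x n) = (2 * r n)%:E.
  rewrite /E lebesgue_measure_itv/= lte_fin Er -EFinB; congr EFin; ring.
have nE x : nicely_shrinking x (E x).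
  split; first by move=> n; exact: measurable_itv.
  have r20 n : 0 < 2 * r n by rewrite mulr_gt0.
  (* The ball must contain the closed interval, whence the radius [2 * r n]. *)
  exists (2, fun n => PosNum (r20 n)); split => //=.
  - rewrite -[X in _ --> X](mulr0 (2 * T)).
    rewrite (_ : (fun n => _) = (fun n => 2 * T * n.+1%:R^-1)); last first.
      by apply/funext => n; rewrite /r mulrA.
    by apply: cvgMr; exact: cvg_harmonic.
  - move=> n y; rewrite /E/= in_itv/= => /andP[y1 y2].
    by rewrite /ball/= ltr_norml; have := r0 n; lra.
  - move=> n; rewrite (lebesgue_measure_ball _ (ltW (r20 n))) muE -EFinM lee_fin -mulr_natl.
    by have := r0 n; lra.
have iE x n : (\int[mu]_(y in E x n) (f y)%:E = 0)%E.
  have mf : mu.-integrable (E x n) (EFin \o f).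
    have [mf _ kf] := lf; apply/integrableP; split.
      by apply/measurable_EFinP; exact: measurable_funS mf.
    by apply: kf => //; exact: segment_compact.
  have [mE _] := nE x.
  have := f0 x (r n); rewrite ltW//= rT => /(_ isT).
  rewrite /Rintegral => h.
  by rewrite -(fineK (integrable_fin_num (mE n : measurable (E x n : set (measurableTypeR R))) mf)) h.
apply: (@filterS _ _ (ae_filter_ringOfSetsType mu) _ _ _ (lebesgue_differentiation lf)) => x fx.
have := nice_lebesgue_differentiation nE lf fx.
under eq_fun do rewrite iE mule0.
move=> cf; have : EFin (f x) = 0%E by apply: (cvg_unique _ cf); [exact: ereal_hausdorff|exact: cvg_cst].
by case.
Qed.

End small_intervals.

Section nontriviality.
Context {R : realType} {d : measure_display} {Om : measurableType d}.
Variable P : probability Om R.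
Variables (H : R) (W : R -> R -> {RV P >-> R}).
Hypothesis H_range : 0 < H < 2^-1.
Hypothesis W_noise : fractional_noise H W.
Variables (u0 v0 : R -> R) (T : R) (v : R -> R -> Om -> R).
Hypothesis T_gt0 : 0 < T.
Hypothesis v_sol : mild_solution H W u0 v0 T v.

Lemma mild_integrand_integrable t x : 0 <= t <= T ->
  jointly_measurable (mild_integrand v t x) /\ (energy P H (mild_integrand v t x) < +oo)%E.
Proof.
move=> tT; have [_ /(_ t x tT)[[[mg _] _ fin] _]] := v_sol; split; last exact: fin.
apply: jointly_measurable_vanishing mg _ => [|s y w s0]; first exact: measurable_itv.
exact: mild_integrand_neg.
Qed.

Lemma solution_measurable s y : 0 <= s <= T -> measurable_fun setT (v s y).
Proof.
move=> sT; have [[_ /(_ s y)] +] := v_sol.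
rewrite /= in_itv/= => /(_ sT) h _.
exact: measurable_wrt_measurable h.
Qed.

Lemma energy_mild_integrand_eq0 t x : 0 <= t <= T ->
  (forall s y, 0 <= s <= T -> {ae P, forall w, v s y w = 0}) ->
  energy P H (mild_integrand v t x) = 0%E.
Proof.
move=> tT v_0; have [mg _] := mild_integrand_integrable x tT.
have mD := measurable_energy_density H mg.
have D0 := @energy_density_ge0 _ _ _ H (mild_integrand v t x).
rewrite energyE// (iterated_expectation_inside P mD D0).
have g0 s y : {ae P, forall w, mild_integrand v t x s y w = 0}.
  have [st|st] := boolP (s \in `[0, t]); last first.
    apply: filterE => w; rewrite /mild_integrand indicE memNset ?mulr0//.
    exact/negP.
  have := v_0 s y; rewrite in_itv/= in st; move: st => /andP[s0 st].
  rewrite s0 (le_trans st) => [/(_ isT)|]; last by case/andP: tT.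
  by apply: filterS => w vw; rewrite /mild_integrand vw mulr0 mul0r.
suff E0 s y z : (\int[P]_w energy_density H (mild_integrand v t x) (w, s, y, z) = 0)%E.
  rewrite integral0_eq ?mule0// => s _; apply: integral0_eq => y _.
  by apply: integral0_eq => z _; exact: E0.
have ms : measurable_fun setT (fun w => energy_density H (mild_integrand v t x) (w, s, y, z)).
  apply: (measurableT_comp mD); apply: measurable_fun_pair => //.
  by apply: measurable_fun_pair => //; exact: measurable_fun_pair.
rewrite (ae_eq_integral (cst 0%E) _ measurableT ms)//; first exact: integral0.
have := g0 s y; have := g0 s (y + z).
apply: filterS2 => w g1 g2 _.
by rewrite /energy_density/= g1 g2 subrr expr0n/= mul0r mulr0.
Qed.

(** The stochastic integral of a vanishing field has second moment zero, and the
solution formula leaves only the deterministic part. *)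
Lemma wave_init_eq0 t x : 0 <= t <= T ->
  (forall s y, 0 <= s <= T -> {ae P, forall w, v s y w = 0}) ->
  wave_init u0 v0 t x = 0.
Proof.
move=> tT v_0; have [mg fin] := mild_integrand_integrable x tT.
have [_ /(_ t x tT)[_ [J [sJ vJ]]]] := v_sol.
have [mJ iJ _] := stoch_integral_centered H_range W_noise mg fin sJ.
have EJ := second_moment_eq0 H_range W_noise mg (energy_mild_integrand_eq0 x tT v_0) sJ.
have J0 : {ae P, forall w, J w = 0}.
  have mJ2 : measurable_fun setT (fun w => (J w ^+ 2)%:E).
    by apply/measurable_EFinP; exact: measurable_funX.
  have := (ae_eq_integral_abs P measurableT mJ2).1.
  under eq_integral do rewrite gee0_abs ?lee_fin ?sqr_ge0//.
  have -> : (\int[P]_w (J w ^+ 2)%:E = 0)%E.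
    rewrite -(fineK (integrable_fin_num measurableT iJ)); congr EFin; exact: EJ.
  move=> /(_ erefl); apply: filterS => w /(_ I) [] /eqP.
  by rewrite sqrf_eq0 => /eqP.
have c0 : {ae P, forall w, wave_init u0 v0 t x = 0}.
  move: vJ J0 (v_0 t x tT); apply: filterS3 => w -> ->.
  by rewrite addr0.
have PF : ProperFilter (almost_everywhere P).
  by apply: ae_properfilter_algebraOfSetsType; rewrite /= probability_setT lte_fin.
by have [] := @filter_ex _ _ PF _ c0.
Qed.

(** At time [0] the deterministic part is [u0]; once [u0 = 0], it is half the integral
of [v0] over the interval of radius [t] around [x]. *)
Lemma solution_nontrivial : locally_integrable setT v0 ->
  ~ ((forall x, u0 x = 0) /\ {ae @lebesgue_measure R, forall x, v0 x = 0}) ->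
  exists s y, 0 <= s <= T /\ ~ {ae P, forall w, v s y w = 0}.
Proof.
move=> lv0 nt; apply: contrapT => no; apply: nt.
have v_0 s y : 0 <= s <= T -> {ae P, forall w, v s y w = 0}.
  by move=> sT; apply: contrapT => h; apply: no; exists s, y.
have w0 t x := @wave_init_eq0 t x ^~ v_0.
have u00 x : u0 x = 0.
  have := w0 0 x; rewrite lexx ltW// => /(_ isT).
  rewrite /wave_init subr0 addr0 set_itv1 Rintegral_set1 mulr0 add0r.
  by lra.
split => //; apply: (ae_eq0_small_intervals T_gt0 lv0) => x t tT.
have := w0 t x tT; rewrite /wave_init !u00 addr0 mulr0 addr0.
by lra.
Qed.

End nontriviality.

(** * Lower bounds for moments of increments *)

Section second_moment.
Context {R : realType} {d : measure_display} {Om : measurableType d}.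
Variable P : probability Om R.

Lemma powR_sub2 (l p : R) : 0 < l -> l `^ (p - 2) * l ^+ 2 = l `^ p.
Proof.
move=> l0; rewrite -(@powR_mulrn _ l 2) ?ltW// -powRD ?subrK//.
by apply/implyP => _; rewrite gt_eqF.
Qed.

(** A form of Young's inequality at the scale [l]. Integrated, it shows that an [L^p]
norm at most [l] forces a second moment at most [2 * l ^+ 2], and that a second
moment at least [2 * l ^+ 2] forces a [p]-th moment at least [l `^ p]. *)
Lemma sqr_le_powR (l p a : R) : 0 < l -> 2 <= p -> 0 <= a ->
  l `^ (p - 2) * a ^+ 2 <= l `^ p + a `^ p.
Proof.
move=> l0 p2 a0; have [al|la] := lerP a l.
  apply: (@le_trans _ _ (l `^ p)); last by rewrite lerDl powR_ge0.
  rewrite -(powR_sub2 p l0) ler_wpM2l ?powR_ge0//.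
  by rewrite ler_sqr ?nnegrE// ltW.
have a_gt0 : 0 < a by exact: lt_trans la.
apply: (@le_trans _ _ (a `^ p)); last by rewrite lerDr powR_ge0.
rewrite -(powR_sub2 p a_gt0) ler_wpM2r ?sqr_ge0//.
have e0 : 0 <= p - 2 by rewrite subr_ge0.
by apply: (ge0_ler_powR e0); rewrite ?nnegrE ltW.
Qed.

Lemma second_moment_le_powR (l p : R) (Z : Om -> R) : 0 < l -> 2 <= p ->
  measurable_fun setT Z ->
  ((l `^ (p - 2))%:E * \int[P]_w (Z w ^+ 2)%:E <=
   (l `^ p)%:E + \int[P]_w (`|Z w| `^ p)%:E)%E.
Proof.
move=> l0 p2 mZ.
have mZ2 : measurable_fun setT (fun w => (Z w ^+ 2)%:E).
  by apply/measurable_EFinP; exact: measurable_funX.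
have mZp : measurable_fun setT (fun w => (`|Z w| `^ p)%:E).
  apply/measurable_EFinP; apply: (measurableT_comp (measurable_powR _)) => //.
  exact: measurableT_comp.
have Z20 w : setT w -> (0 <= (Z w ^+ 2)%:E)%E by rewrite lee_fin sqr_ge0.
have Zp0 w : setT w -> (0 <= (`|Z w| `^ p)%:E)%E by rewrite lee_fin powR_ge0.
have c0 : (0 <= (l `^ (p - 2))%:E)%E by rewrite lee_fin powR_ge0.
have lp0 : (0 <= (l `^ p)%:E)%E by rewrite lee_fin powR_ge0.
rewrite -(ge0_integralZl P measurableT mZ2 Z20 c0).
have -> : ((l `^ p)%:E + \int[P]_w (`|Z w| `^ p)%:E =
    \int[P]_w ((l `^ p)%:E + (`|Z w| `^ p)%:E))%E.
  rewrite ge0_integralD//.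
  by rewrite integral_cst//= probability_setT mule1.
apply: ge0_le_integralT => w; first by rewrite mule_ge0// Z20.
rewrite -EFinM -EFinD lee_fin -(real_normK (num_real (Z w))).
exact: sqr_le_powR.
Qed.

Lemma second_moment_le_Lnorm (l p : R) (Z : Om -> R) : 0 < l -> 2 <= p ->
  measurable_fun setT Z -> ('N[P]_(p%:E) [EFin \o Z] <= l%:E)%E ->
  (\int[P]_w (Z w ^+ 2)%:E <= (2 * l ^+ 2)%:E)%E.
Proof.
move=> l0 p2 mZ Zl; have p0 : 0 < p by lra.
have Zp : (\int[P]_w (`|Z w| `^ p)%:E <= (l `^ p)%:E)%E.
  have -> : (\int[P]_w (`|Z w| `^ p)%:E = 'N[P]_(p%:E) [EFin \o Z] `^ p)%E.
    rewrite poweR_Lnorm ?gt_eqF//; by apply: eq_integral => w _.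
  rewrite -poweR_EFin; apply: (gt0_ler_poweR (ltW p0)) => //.
  - by rewrite in_itv/= Lnorm_ge0 leey.
  - by rewrite in_itv/= lee_fin leey ltW.
have lp : 0 < l `^ (p - 2) by exact: powR_gt0.
have := second_moment_le_powR l0 p2 mZ => h.
rewrite -(@lee_pmul2l _ (l `^ (p - 2))%:E)//.
apply: (le_trans h); apply: (@le_trans _ _ ((l `^ p)%:E + (l `^ p)%:E)%E).
  exact: leeD.
by rewrite -EFinM -EFinD lee_fin mulrCA powR_sub2//; lra.
Qed.

Lemma powR_moment_ge (l p : R) (Z : Om -> R) : 0 < l -> 2 <= p ->
  measurable_fun setT Z -> ((2 * l ^+ 2)%:E <= \int[P]_w (Z w ^+ 2)%:E)%E ->
  ((l `^ p)%:E <= \int[P]_w (`|Z w| `^ p)%:E)%E.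
Proof.
move=> l0 p2 mZ Zl; have := second_moment_le_powR l0 p2 mZ.
have lp : (0 <= (l `^ (p - 2))%:E)%E by rewrite lee_fin powR_ge0.
move=> /(le_trans (lee_wpmul2l lp Zl)).
rewrite -EFinM mulrCA powR_sub2// mulr_natl mulr2n EFinD.
by rewrite leeD2lE.
Qed.

Lemma second_moment_perturb (c l p : R) (X Y : Om -> R) : 0 < l -> 2 <= p ->
  measurable_fun setT X -> measurable_fun setT Y ->
  ('N[P]_(p%:E) [(fun w => (Y w - X w)%:E)] <= l%:E)%E ->
  ((2 * c + 4 * l ^+ 2)%:E <= \int[P]_w (X w ^+ 2)%:E)%E ->
  (c%:E <= \int[P]_w (Y w ^+ 2)%:E)%E.
Proof.
move=> l0 p2 mX mY YX Xc.
have mZ : measurable_fun setT (fun w => Y w - X w) by exact: measurable_funB.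
have Z2 := second_moment_le_Lnorm l0 p2 mZ YX.
have m2 (Z : Om -> R) : measurable_fun setT Z ->
    measurable_fun setT (fun w => 2%:E * (Z w ^+ 2)%:E)%E.
  by move=> mZ'; apply: measurable_funeM; apply/measurable_EFinP; exact: measurable_funX.
have I2 (Z : Om -> R) : measurable_fun setT Z ->
    (\int[P]_w (2%:E * (Z w ^+ 2)%:E) = 2%:E * \int[P]_w (Z w ^+ 2)%:E)%E.
  move=> mZ'; apply: (@ge0_integralZl _ _ _ P setT measurableT (fun w => (Z w ^+ 2)%:E)).
  - by apply/measurable_EFinP; exact: measurable_funX.
  - by move=> w _; rewrite lee_fin sqr_ge0.
  - by rewrite lee_fin.
have p20 (Z : Om -> R) w : setT w -> (0 <= 2%:E * (Z w ^+ 2)%:E)%E.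
  by rewrite -EFinM lee_fin mulr_ge0// sqr_ge0.
have le : (\int[P]_w (X w ^+ 2)%:E <=
    2%:E * \int[P]_w (Y w ^+ 2)%:E + 2%:E * \int[P]_w ((Y w - X w) ^+ 2)%:E)%E.
  rewrite -I2// -I2// -(ge0_integralD P measurableT (p20 Y) (m2 _ mY) (p20 _) (m2 _ mZ)).
  apply: ge0_le_integralT => w; first by rewrite lee_fin sqr_ge0.
  by rewrite -!EFinM -EFinD lee_fin; have := sqr_ge0 (2 * Y w - X w); nra.
rewrite leNgt; apply/negP => Yc.
have Yfin : (\int[P]_w (Y w ^+ 2)%:E)%E \is a fin_num.
  rewrite ge0_fin_numE; last by apply: integral_ge0 => w _; rewrite lee_fin sqr_ge0.
  by apply: lt_trans Yc _; rewrite ltry.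
have two0 : (0 <= 2%:E :> \bar R)%E by rewrite lee_fin.
have := le_trans Xc (le_trans le (leeD (lexx _) (lee_wpmul2l two0 Z2))).
rewrite -(fineK Yfin) -!EFinM -EFinD lee_fin; rewrite -(fineK Yfin) lte_fin in Yc.
by move: Yc; lra.
Qed.

Lemma second_moment_gt0 (X : Om -> R) : measurable_fun setT X ->
  ~ {ae P, forall w, X w = 0} ->
  exists2 c : R, 0 < c & (c%:E <= \int[P]_w (X w ^+ 2)%:E)%E.
Proof.
move=> mX X0.
have mX2 : measurable_fun setT (fun w => (X w ^+ 2)%:E).
  by apply/measurable_EFinP; exact: measurable_funX.
have I0 : (0 <= \int[P]_w (X w ^+ 2)%:E)%E.
  by apply: integral_ge0 => w _; rewrite lee_fin sqr_ge0.
have I_gt0 : (0 < \int[P]_w (X w ^+ 2)%:E)%E.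
  rewrite lt_neqAle I0 andbT; apply/eqP => E0; apply: X0.
  have := (ae_eq_integral_abs P measurableT mX2).1.
  under eq_integral do rewrite gee0_abs ?lee_fin ?sqr_ge0//.
  rewrite -E0 => /(_ erefl); apply: filterS => w /(_ I) [] /eqP.
  by rewrite sqrf_eq0 => /eqP.
move: (\int[P]_w _)%E I_gt0 => [r||]//; rewrite ?lte_fin => r0.
  by exists r.
by exists 1; rewrite // leey.
Qed.

End second_moment.

Section increments.
Context {R : realType} {d : measure_display} {Om : measurableType d}.
Variable P : probability Om R.
Variables (H : R) (W : R -> R -> {RV P >-> R}).
Hypothesis H_range : 0 < H < 2^-1.
Hypothesis W_noise : fractional_noise H W.
Variables (u0 v0 : R -> R) (T p : R) (v : R -> R -> Om -> R).
Hypothesis T_gt0 : 0 < T.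
Hypothesis p_ge2 : 2 <= p.
Hypothesis v_sol : mild_solution H W u0 v0 T v.
Hypothesis v_Z : in_Z P H p T v.
Local Notation mu := (@lebesgue_measure R).

(** Continuity in [L^p] implies continuity in [L^2] as [p >= 2], so a positive second
moment stays bounded below near [(s0, y0)]. *)
Lemma second_moment_lower_bound s0 y0 : 0 <= s0 <= T ->
  ~ {ae P, forall w, v s0 y0 w = 0} ->
  exists eps c : R, [/\ 0 < eps, 0 < c & forall s y, 0 <= s <= T ->
    `|s - s0| < eps -> `|y - y0| < eps -> (c%:E <= \int[P]_w (v s y w ^+ 2)%:E)%E].
Proof.
move=> sT v00; have mv0 := solution_measurable v_sol y0 sT.
have [k k0 kv] := second_moment_gt0 mv0 v00.
(* [2 * (k / 4) + 4 * l ^+ 2 = k]. *)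
pose l := Num.sqrt (k / 8); have l0 : 0 < l by rewrite sqrtr_gt0 divr_gt0.
have l2 : l ^+ 2 = k / 8 by rewrite sqr_sqrtr// ltW// divr_gt0.
have [_ /(_ s0 y0 sT) cv _] := v_Z.
have small : nbhs (0 : \bar R) [set x | x < l%:E]%E.
  by apply: open_nbhs_nbhs; split; [exact: open_ereal_lt_ereal|rewrite /= lte_fin].
have := cv _ small; rewrite /= nbhs_filterE /within/= -nbhs_ballE => -[eps /= eps0 near].
exists eps, (k / 4); split => //; first by rewrite divr_gt0.
move=> s y sT' ss yy; have mv := solution_measurable v_sol y sT'.
have := near (s, y); rewrite /ball/= /prod_ball/= => /(_ _ sT').
rewrite /ball/= distrC ss distrC yy => /(_ (conj isT isT)) N.
apply: (second_moment_perturb l0 p_ge2 mv0 mv (ltW N)).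
by apply: le_trans kv; rewrite lee_fin l2; lra.
Qed.

(** The deterministic part of the increment is a constant [k]; as [J1 - J2] has mean
zero, the second moment of [k + (J1 - J2)] is [k^2] plus that of [J1 - J2]. *)
Lemma solution_increment x h s1 s2 c : 0 < h -> 0 <= s1 -> s1 < s2 -> h <= T - s2 -> 0 <= c ->
  (forall s y, s1 < s <= s2 -> y \in `]x - (T - s), x + h - (T - s)] ->
     (c%:E <= \int[P]_w (v s y w ^+ 2)%:E)%E) ->
  ((4^-1 * (noise_const H ^+2 * ((2 * h) `^ (2 * H - 2) / 4 * c * h * h * (s2 - s1))))%:E <=
    \int[P]_w ((v T (x + h) w - v T x w) ^+ 2)%:E)%E.
Proof.
move=> h0 s10 s12 hs2 c0 big; have TT : 0 <= T <= T by rewrite lexx ltW.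
have [mg1 fin1] := mild_integrand_integrable v_sol (x + h) TT.
have [mg2 fin2] := mild_integrand_integrable v_sol x TT.
have [_ solT] := v_sol.
have [_ [J1 [sJ1 vJ1]]] := solT T (x + h) TT.
have [_ [J2 [sJ2 vJ2]]] := solT T x TT.
have [mJ1 iJ1 EJ1] := stoch_integral_centered H_range W_noise mg1 fin1 sJ1.
have [mJ2 iJ2 EJ2] := stoch_integral_centered H_range W_noise mg2 fin2 sJ2.
have mv s y : s1 < s <= s2 -> measurable_fun setT (v s y).
  by move=> ss; apply: (solution_measurable v_sol); move: ss h0 s10 hs2; lra.
have low := energy_wave_increment H_range h0 s10 s12 hs2 c0 big mv
  (jointly_measurableB mg1 mg2).
have := le_trans low (energy_le_second_moment H_range W_noise mg1 mg2 fin1 fin2 sJ1 sJ2).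
rewrite lee_fin => {}low.
pose k := wave_init u0 v0 T (x + h) - wave_init u0 v0 T x.
pose Z w := J1 w - J2 w.
have mZ : measurable_fun setT Z by exact: measurable_funB.
have mN : measurable_fun setT (fun w => - J2 w) by exact: measurableT_comp.
have [iZ2 _] := L1_sqrD mJ1 mN iJ1 (L1_sqrN iJ2).
have i1 := L1_of_sqr mJ1 iJ1; have i2 := L1_of_sqr mJ2 iJ2.
have iZ : L1 P Z by exact: L1B.
have EZ : \int[P]_w Z w = 0 by rewrite /Z RintegralB// EJ1 EJ2 subr0.
have mD : measurable_fun setT (fun w => v T (x + h) w - v T x w).
  by apply: measurable_funB; exact: (solution_measurable v_sol).
have -> : (\int[P]_w ((v T (x + h) w - v T x w) ^+ 2)%:E =
    \int[P]_w ((k + Z w) ^+ 2)%:E)%E.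
  apply: ae_eq_integral => //.
  - by apply/measurable_EFinP; exact: measurable_funX.
  - by apply/measurable_EFinP; apply: measurable_funX; exact: measurable_funD.
  move: vJ1 vJ2; apply: filterS2 => w -> -> _.
  by rewrite /k /Z; congr EFin; congr (_ ^+ 2); ring.
have iD : L1 P (fun w => k ^+ 2 + (2 * k * Z w + Z w ^+ 2)).
  by apply: L1D; [exact: L1_cst|apply: L1D => //; exact: L1Z].
have E : (fun w => (k + Z w) ^+ 2) = (fun w => k ^+ 2 + (2 * k * Z w + Z w ^+ 2)).
  by apply/funext => w; ring.
have fin : (\int[P]_w ((k + Z w) ^+ 2)%:E)%E \is a fin_num.
  by apply: (integrable_fin_num measurableT); rewrite -E in iD; exact: iD.
rewrite -(fineK fin) lee_fin.
have -> : fine (\int[P]_w ((k + Z w) ^+ 2)%:E)%E = k ^+ 2 + \int[P]_w Z w ^+ 2.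
  transitivity (\int[P]_w (k ^+ 2 + (2 * k * Z w + Z w ^+ 2))).
    by rewrite -E.
  rewrite RintegralD//; [|exact: L1_cst|apply: L1D => //; exact: L1Z].
  rewrite RintegralD//; [|exact: L1Z].
  rewrite RintegralZl// EZ mulr0 add0r; congr (_ + _).
  exact: Rintegral_prob_cst.
have := sqr_ge0 k; move: low; rewrite -/(Z _).
move: (\int[P]_w _) (noise_const H ^+ 2 * _) => I A; lra.
Qed.

(** The times [s1 < s2 < T] and the range of [x] are chosen so that the strips of
[energy_wave_increment] stay within the neighbourhood of [(s0, y0)] where the
second moment of [v] is at least [c]; the interval of times is put before or after
[s0] so as to stay in [[0, T]]. *)
Lemma solution_increment_lower_bound s0 y0 : 0 <= s0 <= T ->
  ~ {ae P, forall w, v s0 y0 w = 0} ->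
  exists a b h0 C : R, [/\ a < b, 0 < h0, 0 < C & forall x h,
    x \in `]a, b] -> 0 < h <= h0 ->
    ((C * h `^ (2 * H))%:E <= \int[P]_w ((v T (x + h) w - v T x w) ^+ 2)%:E)%E].
Proof.
move=> sT v00; have [e0 [c [e00 c0 big]]] := second_moment_lower_bound sT v00.
have [e [e_gt0 ee0 eT]] : exists e, [/\ 0 < e, e <= e0 & e <= T].
  by exists (Num.min e0 T); split; rewrite ?lt_min ?e00// ge_min lexx ?orbT.
have [s1 [s2 [s12 s10 s2T s1s s2s]]] : exists s1 s2, [/\ s1 < s2 <= s1 + e / 4, 0 <= s1,
    s2 < T, s0 - e / 2 < s1 & s2 < s0 + e / 2].
  have [sl|sl] := leP s0 (T / 2).
    by exists s0, (s0 + e / 4); split; move: e_gt0 sT eT; lra.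
  by exists (s0 - e / 4), (s0 - e / 8); split; move: e_gt0 sT eT; lra.
have [s12' s21] := andP s12.
pose h0 := Num.min (e / 4) (T - s2).
have h00 : 0 < h0 by rewrite lt_min divr_gt0// subr_gt0.
have h0e : h0 <= e / 4 by rewrite ge_min lexx.
have h0T : h0 <= T - s2 by rewrite ge_min lexx orbT.
pose K := 4^-1 * (noise_const H ^+ 2 * (2 `^ (2 * H - 2) / 4 * c * (s2 - s1))).
have n0 : 0 < noise_const H ^+ 2.
  rewrite /noise_const exprn_gt0// sqrtr_gt0 mulr_gt0//; by move: H_range; lra.
have K0 : 0 < K.
  have q0 : 0 < 2 `^ (2 * H - 2) / 4 :> R by rewrite divr_gt0 ?powR_gt0.
  have ds : 0 < s2 - s1 by rewrite subr_gt0.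
  by apply: mulr_gt0 => //; apply: mulr_gt0 => //; apply: mulr_gt0 => //; exact: mulr_gt0.
exists (y0 - e / 2 + T - s1), (y0 + e / 4 + T - s2), h0, K; split => //.
  by move: e_gt0; lra.
move=> x h; rewrite in_itv/= => /andP[xl xr] /andP[h_gt0 hh].
have hT : h <= T - s2 by exact: le_trans h0T.
have cge : 0 <= c by exact: ltW.
have bigx s y : s1 < s <= s2 -> y \in `]x - (T - s), x + h - (T - s)] ->
    (c%:E <= \int[P]_w (v s y w ^+ 2)%:E)%E.
  move=> /andP[ss1 ss2]; rewrite in_itv/= => /andP[yl yr].
  apply: big.
  - by lra.
  - by rewrite ltr_norml; lra.
  - by rewrite ltr_norml; lra.
apply: le_trans (solution_increment h_gt0 s10 s12' hT cge bigx).
rewrite lee_fin /K powRM ?(ltW h_gt0)//.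
have -> : h `^ (2 * H) = h `^ (2 * H - 2) * h ^+ 2 by rewrite powR_sub2.
by rewrite le_eqVlt; apply/orP; left; apply/eqP; ring.
Qed.

End increments.

(** * Divergence of the fractional seminorm *)

Section divergence.
Context {R : realType}.
Local Notation mu := (@lebesgue_measure R).

(** For [H <= 1/4] and [h <= 1], [h `^ (4 H - 2)] is at least [h `^ (r - 1)] for every
[r] in []0, 1]], whose integral over []0, h0]] is [h0 `^ r / r >= h0 / r]; these
lower bounds are unbounded as [r] tends to [0]. *)
Lemma singular_integral_infty (H h0 k : R) (N : R -> \bar R) :
  H <= 4^-1 -> 0 < h0 <= 1 -> 0 < k -> (forall h, 0 <= N h)%E ->
  (forall h, 0 < h <= h0 -> ((k * h `^ (2 * H))%:E <= N h)%E) ->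
  (\int[mu]_h (N h * (`|h| `^ (2 * H - 2))%:E) = +oo)%E.
Proof.
move=> H4 /andP[h00 h01] k0 N0 Nk.
have p0 (h : R) : (0 <= (`|h| `^ (2 * H - 2))%:E)%E by rewrite lee_fin powR_ge0.
have low r : 0 < r -> r <= 1 ->
    ((k * h0 / r)%:E <= \int[mu]_h (N h * (`|h| `^ (2 * H - 2))%:E))%E.
  move=> r0 r1.
  apply: (@le_trans _ _ (k%:E * \int[mu]_(h in `]0%R, h0]) (h `^ (r - 1))%:E)%E).
    rewrite integral_powR_0// -EFinM lee_fin mulrA ler_wpM2r ?invr_ge0 ?(ltW r0)//.
    rewrite ler_wpM2l ?(ltW k0)//.
    rewrite -{1}(powRr1 (ltW h00)); apply: ger_powR => //.
    by rewrite h00.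
  have mp : measurable_fun `]0%R, h0]%classic (fun h : R => (h `^ (r - 1))%:E).
    by apply/measurable_EFinP; apply: measurable_funTS; exact: measurable_powR.
  have pp (h : R) : `]0%R, h0]%classic h -> (0 <= (h `^ (r - 1))%:E)%E.
    by rewrite lee_fin powR_ge0.
  have k0' : (0 <= k%:E)%E by rewrite lee_fin ltW.
  rewrite -(ge0_integralZl mu (measurable_itv _) mp pp k0').
  rewrite integral_mkcond; apply: ge0_le_integralT => h; rewrite patchE.
    by case: ifPn => // _; apply: mule_ge0 => //; rewrite lee_fin powR_ge0.
  case: ifPn => [|_]; last exact: mule_ge0.
  rewrite mem_setE in_itv/= => hh; have /andP[h_gt0 hh0] := hh.
  apply: (@le_trans _ _ ((k * h `^ (2 * H))%:E * (`|h| `^ (2 * H - 2))%:E)%E); last first.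
    by apply: lee_wpmul2r => //; exact: Nk.
  rewrite -!EFinM lee_fin -mulrA ler_wpM2l ?(ltW k0)// gtr0_norm//.
  rewrite -powRD; last by apply/implyP => _; rewrite gt_eqF.
  apply: ger_powR; last by lra.
  by rewrite h_gt0 (le_trans hh0).
move: (\int[mu]_h _)%E low => [M|//|]; last first.
  by move=> /(_ 1 ltr01 (lexx 1)).
move=> low; exfalso.
have kh : 0 < k * h0 by exact: mulr_gt0.
have M0 : 0 <= M.
  by have := low 1 ltr01 (lexx 1); rewrite lee_fin divr1; lra.
(* This value makes [k * h0 / r = M + 1 + k * h0 > M]. *)
pose r := k * h0 / (M + 1 + k * h0).
have den : 0 < M + 1 + k * h0 by lra.
have r0 : 0 < r by exact: divr_gt0.
have r1 : r <= 1 by rewrite ler_pdivrMr// mul1r; lra.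
have := low r r0 r1; rewrite lee_fin /r invf_div mulrCA divff ?gt_eqF// mulr1.
by lra.
Qed.

End divergence.

Section mixed_norms.
Context {R : realType} {d : measure_display} {Om : measurableType d}.
Variable P : probability Om R.
Local Notation mu := (@lebesgue_measure R).

Lemma norm_OmR_ge0 (p : R) (g : R -> Om -> R) : (0 <= norm_OmR P p g)%E.
Proof. exact: poweR_ge0. Qed.

Lemma norm_OmR_lower_bound (p l a b : R) (g : R -> Om -> R) :
  0 < l -> 2 <= p -> a < b ->
  (forall x, measurable_fun setT (g x)) ->
  (forall x, x \in `]a, b] -> ((2 * l ^+ 2)%:E <= \int[P]_w (g x w ^+ 2)%:E)%E) ->
  ((l ^+ 2 * (b - a) `^ (2 / p))%:E <= norm_OmR P p g ^+ 2)%E.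
Proof.
move=> l0 p2 ab mg gl; have p0 : 0 < p by lra.
have ba0 : 0 < b - a by rewrite subr_gt0.
have lp0 : 0 <= l `^ p by exact: powR_ge0.
have I : ((l `^ p * (b - a))%:E <= \int[mu]_x \int[P]_w (`|g x w| `^ p)%:E)%E.
  rewrite -(integral_cst_indic lp0 (ltW ab)).
  apply: ge0_le_integralT => x; first by rewrite lee_fin mulr_ge0.
  have [xab|xab] := boolP (x \in `]a, b]); last first.
    rewrite indicE mem_setE (negbTE xab) mulr0.
    by apply: integral_ge0 => w _; rewrite lee_fin powR_ge0.
  rewrite indicE mem_setE xab mulr1.
  exact: (powR_moment_ge l0 p2 (mg x) (gl x xab)).
have nl : ((l * (b - a) `^ p^-1)%:E <= norm_OmR P p g)%E.
  rewrite (_ : l * _ = (l `^ p * (b - a)) `^ p^-1); last first.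
    rewrite powRM ?(ltW ba0)// -powRrM divff ?gt_eqF// powRr1//.
    exact: ltW.
  rewrite -poweR_EFin; have pV : 0 <= p^-1 by rewrite invr_ge0 ltW.
  apply: (gt0_ler_poweR pV) => //.
  - by rewrite in_itv/= lee_fin leey mulr_ge0// ltW.
  - rewrite in_itv/= leey andbT; apply: integral_ge0 => x _.
    by apply: integral_ge0 => w _; rewrite lee_fin powR_ge0.
have e0 : (0 <= (l * (b - a) `^ p^-1)%:E)%E by rewrite lee_fin mulr_ge0 ?powR_ge0 ?(ltW l0).
apply: le_trans (lee_pmul e0 e0 nl nl).
rewrite -EFinM lee_fin le_eqVlt; apply/orP; left; apply/eqP.
rewrite mulrACA -expr2; congr (_ * _).
rewrite -powRD; last by apply/implyP => _; rewrite gt_eqF.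
by congr (_ `^ _); ring.
Qed.

Lemma frac_norm_finite (H p T : R) (f : R -> R -> Om -> R) : 0 <= T ->
  (Znorm P H p T f < +oo)%E -> (frac_norm_OmR P H p (f T) < +oo)%E.
Proof.
move=> T0; rewrite /Znorm.
have TT : (`[0%R, T]%classic : set R) T by rewrite /= in_itv/= lexx T0.
have n1 : (norm_OmR P p (f T) <= ereal_sup [set norm_OmR P p (f t) | t in `[0%R, T]])%E.
  by apply: ereal_sup_ubound; exists T.
have n2 : (frac_norm_OmR P H p (f T) <= ereal_sup [set frac_norm_OmR P H p (f t) | t in `[0%R, T]])%E.
  by apply: ereal_sup_ubound; exists T.
have := le_trans (norm_OmR_ge0 p (f T)) n1; move: n2.
move: (ereal_sup _) (ereal_sup _) => A B fA B0 BA.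
apply: le_lt_trans fA _; apply: le_lt_trans BA.
exact: leeDr.
Qed.

End mixed_norms.

Theorem theorem2p7 (R : realType) (d : measure_display) (Om : measurableType d)
  (P : probability Om R) (P_complete : measure_is_complete P)
  (H : R) (H_range : 0 < H < 2^-1)
  (W : R -> R -> {RV P >-> R}) (W_noise : fractional_noise H W)
  (u0 v0 : R -> R) (v0_loc : locally_integrable setT v0)
  (data_nontrivial : ~ ((forall x, u0 x = 0) /\
                        {ae @lebesgue_measure R, forall x, v0 x = 0}))
  (ex_solution : exists p T : R, 2 <= p /\ 0 < T /\
     exists v : R -> R -> Om -> R,
       mild_solution H W u0 v0 T v /\ in_Z P H p T v) :
  4^-1 < H.
Proof.
have [p [T [p2 [T0 [v [v_sol v_Z]]]]]] := ex_solution.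
have [s0 [y0 [sT v00]]] :=
  solution_nontrivial H_range W_noise T0 v_sol v0_loc data_nontrivial.
have [a [b [h1 [C [ab h10 C0 low]]]]] :=
  solution_increment_lower_bound H_range W_noise T0 p2 v_sol v_Z sT v00.
rewrite ltNge; apply/negP => H4.
have [_ _ Zfin] := v_Z; have := frac_norm_finite (ltW T0) Zfin.
rewrite /frac_norm_OmR.
pose h0 := Num.min h1 1.
have h00 : 0 < h0 <= 1 by rewrite lt_min h10 ltr01 ge_min lexx orbT.
have ba0 : 0 < (b - a) `^ (2 / p) by rewrite powR_gt0// subr_gt0.
have k0 : 0 < C / 2 * (b - a) `^ (2 / p) by apply: mulr_gt0 => //; exact: divr_gt0.
rewrite (singular_integral_infty H4 h00 k0).
- by rewrite poweRyr ?invr_eq0.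
- by move=> h; apply: mule_ge0; exact: norm_OmR_ge0.
move=> h /andP[h_gt0 hh]; have hh1 : h <= h1 by rewrite (le_trans hh)// ge_min lexx.
have hH : 0 < h `^ (2 * H) by exact: powR_gt0.
(* Twice [l ^+ 2] is the lower bound for the second moment of the increment. *)
pose l := Num.sqrt (C / 2 * h `^ (2 * H)).
have ll : 0 < C / 2 * h `^ (2 * H) by apply: mulr_gt0 => //; exact: divr_gt0.
have l0 : 0 < l by rewrite sqrtr_gt0.
have l2 : l ^+ 2 = C / 2 * h `^ (2 * H) by rewrite sqr_sqrtr// ltW.
rewrite mulrAC -l2; apply: norm_OmR_lower_bound => //.
  move=> x; have TT : 0 <= T <= T by rewrite lexx ltW.
  by apply: measurable_funB; exact: (solution_measurable v_sol).
move=> x xab; rewrite l2 (_ : 2 * _ = C * h `^ (2 * H)); last by field.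
by apply: low => //; rewrite h_gt0.
Qed.
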